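(* Let $n, m \in \mathbb{N}$, let $\Bbbk$ be a field, and let $S := \Bbbk[x_0, x_1, \dotsc, x_n]$. The closed convex cone $R_{n,m}$ lies in the subspace $V_{n,m} \subset V_{n+1,m}$ and is the intersection of the closed half-spaces of $V_{n,m}$, with elements denoted $h$, given by the inequalities: $$(n+j+1)\,h(j) \geq (j+1)\,h(j+1) \quad \text{for } 0 \leq j < m,$$ $$h(m) \geq q_h(m), \quad \text{and}$$ $$(n-i)\,\nabla^i q_h(m) \geq (n+m-i)\,\nabla^{i+1} q_h(m) \quad \text{for } 0 \leq i < n.$$ This cone is a simplicial polyhedral cone, and its extreme rays are generated by the Hilbert functions of the following cyclic modules: $$\frac{S}{\langle x_0, x_1, \dotsc, x_n \rangle},\ \frac{S}{\langle x_0, x_1, \dotsc, x_n \rangle^2},\ \dotsc,\ \frac{S}{\langle x_0, x_1, \dotsc, x_n \rangle^m},\ \frac{S}{\langle x_0, x_1, \dotsc, x_n \rangle^{m+1}},\ \frac{S}{\langle x_0, x_1, \dotsc, x_{n-1} \rangle^{m+1}},\ \dotsc,\ \frac{S}{\langle x_0 \rangle^{m+1}}.$$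
   Context: $\mathbb{N}$ is the set of non-negative integers. $S$ has the standard $\mathbb{N}$-grading with $\deg(x_i)=1$. For a finitely generated $\mathbb{N}$-graded $S$-module $M$, the Hilbert function is $h_M(j) := \dim_{\Bbbk} M_j$ for $j \in \mathbb{N}$, the graded Betti numbers are $\beta_{i,j}(M) := \dim_{\Bbbk}\bigl(\operatorname{Tor}_i^S(M,\Bbbk)_j\bigr)$, and the Castelnuovo--Mumford regularity is $\operatorname{reg}(M) := \max\{ j \in \mathbb{Z} : \beta_{i,i+j}(M) \neq 0 \text{ for some } i\}$. For $k \in \mathbb{N}$ and $a \in \mathbb{Z}$ with $a \geq -k$, $V_{k,a} \subset \mathbb{Q}^{\mathbb{N}}$ is the finite-dimensional $\mathbb{Q}$-subspace of all functions $h \colon \mathbb{N} \to \mathbb{Q}$ such that $\sum_{j \in \mathbb{N}} h(j) t^j = (b_0 + b_1 t + \dotsb + b_{a+k} t^{a+k})/(1-t)^k$ for some $b_0, \dotsc, b_{a+k} \in \mathbb{Q}$. For $h \in V_{k,a}$, the Hilbert polynomial of $h$ is the unique polynomial $q_h \in \mathbb{Q}[s]$ such that $q_h(j) = h(j)$ for all integers $j > a$ (with $j \ge 0$ if $a<0$). $R_{n,m}$ denotes the closed convex hull in $V_{n+1,m}$ (with its Euclidean topology) of the Hilbert functions of finitely generated $\mathbb{N}$-graded $S$-modules that are generated in degree zero, have no free summands (i.e. $\dim(M) < n+1$), and have Castelnuovo--Mumford regularity at most $m$. The backward difference operator $\nabla \colon \mathbb{Q}[s] \to \mathbb{Q}[s]$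 is $\nabla q(s) := q(s) - q(s-1)$, and $\nabla^i$ is its $i$-fold composition. A finite-dimensional cone is simplicial if it is generated by linearly independent vectors. *)

(* Defs.v *)
From HB Require Import structures.
From mathcomp Require Import all_boot all_order all_algebra.
From mathcomp Require Import boolp classical_sets topology.
From mathcomp Require Import ring_quotient mpoly.

Set Implicit Arguments.
Unset Strict Implicit.
Unset Printing Implicit Defensive.

Import GRing.Theory Num.Theory.
Local Open Scope classical_set_scope.
Local Open Scope ring_scope.

(* Throughout, S = k[x_0, ..., x_n] is {mpoly K[n.+1]} with x_i = 'X_i.       *)

(* The last two axioms say that M is the internal direct sum of the M_d.      *)
Record gradedModule (K : fieldType) (n : nat) := GradedModule {
  gm_sort :> lmodType {mpoly K[n.+1]};
  gm_piece : nat -> set gm_sort;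
  gm_piece0 : forall d, gm_piece d 0;
  gm_pieceD : forall d u v,
    gm_piece d u -> gm_piece d v -> gm_piece d (u + v);
  gm_pieceZ : forall e d (p : {mpoly K[n.+1]}) u,
    p \is e.-homog -> gm_piece d u -> gm_piece (e + d)%N (p *: u);
  gm_span : forall u, exists N (v : nat -> gm_sort),
    (forall d, gm_piece d (v d)) /\ u = \sum_(d < N) v d;
  gm_direct : forall N (v : nat -> gm_sort),
    (forall d, gm_piece d (v d)) -> \sum_(d < N) v d = 0 ->
    forall d, (d < N)%N -> v d = 0
}.

Definition finitely_generated (K : fieldType) (n : nat)
    (M : gradedModule K n) : Prop :=
  exists r (g : 'I_r -> M), forall u, exists p : 'I_r -> {mpoly K[n.+1]},
    u = \sum_i p i *: g i.

Definition generated_in_degree_zero (K : fieldType) (n : nat)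
    (M : gradedModule K n) : Prop :=
  forall u : M, exists r (g : 'I_r -> M) (p : 'I_r -> {mpoly K[n.+1]}),
    (forall i, gm_piece 0 (g i)) /\ u = \sum_i p i *: g i.

(* h d = dim_K M_d: there is a K-basis of M_d with h d elements, K acting     *)
(* through the constant polynomials.                                          *)
Definition hilbert_function (K : fieldType) (n : nat) (M : gradedModule K n)
    (h : nat -> nat) : Prop :=
  forall d, exists b : 'I_(h d) -> M,
    (forall i, gm_piece d (b i)) /\
    forall u, gm_piece d u ->
      exists! c : 'rV[K]_(h d), u = \sum_i (c 0 i)%:MP *: b i.

Definition annihilator (K : fieldType) (n : nat) (M : gradedModule K n) :
    set {mpoly K[n.+1]} :=
  [set p | forall u : M, p *: u = 0].

(* dim M = dim (S / Ann M) is at least d. *)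
Definition krull_dim_ge (K : fieldType) (n : nat) (M : gradedModule K n)
    (d : nat) : Prop :=
  exists P : nat -> {pred {mpoly K[n.+1]}},
    (forall i, (i <= d)%N -> [/\ idealr_closed (P i),
       prime_idealr_closed (P i) &
       forall p, annihilator M p -> p \in P i]) /\
    (forall i, (i < d)%N ->
       {subset P i <= P i.+1} /\ ~ {subset P i.+1 <= P i}).

(* A sequence F_0 <- F_1 <- ... of finite free S-modules with homogeneous     *)
(* bases: the b-th basis vector of F_i has degree fs_deg b, elements of F_i   *)
(* are row vectors, and the i-th map F_{i+1} -> F_i is p |-> p *m fs_map i.   *)
Record freeSeq (K : fieldType) (n : nat) := FreeSeq {
  fs_rank : nat -> nat;
  fs_deg : forall i, 'I_(fs_rank i) -> nat;
  fs_map : forall i, 'M[{mpoly K[n.+1]}]_(fs_rank i.+1, fs_rank i)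
}.
Arguments fs_deg {K n} f i.

(* The maps have degree zero: the (a, b) entry is homogeneous of degree       *)
(* deg a - deg b, hence zero if this number is negative.                      *)
Definition degree_preserving (K : fieldType) (n : nat) (F : freeSeq K n) :
    Prop :=
  forall i a b,
    ((fs_deg F i b <= fs_deg F i.+1 a)%N ->
       fs_map F i a b \is (fs_deg F i.+1 a - fs_deg F i b).-homog) /\
    ((fs_deg F i.+1 a < fs_deg F i b)%N -> fs_map F i a b = 0).

(* The augmentation F_0 -> M sends the b-th basis vector to g b. *)
Definition graded_free_resolution (K : fieldType) (n : nat)
    (F : freeSeq K n) (M : gradedModule K n) : Prop :=
  degree_preserving F /\
  exists g : 'I_(fs_rank F 0) -> M,
    [/\ forall b, gm_piece (fs_deg F 0 b) (g b),
        forall u, exists p : 'rV_(fs_rank F 0), u = \sum_b p 0 b *: g b,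
        forall p : 'rV_(fs_rank F 0), \sum_b p 0 b *: g b = 0 <->
          exists q, p = q *m fs_map F 0 &
        forall i (p : 'rV_(fs_rank F i.+1)), p *m fs_map F i = 0 <->
          exists q, p = q *m fs_map F i.+1].

(* F_i (x)_S K is the space of row vectors over K; its part of degree j is    *)
(* spanned by the basis vectors of degree j, i.e. it is the row space of      *)
(* strand_space F i j. On it, the differential F_{i+1} (x) K -> F_i (x) K is  *)
(* given by the constant terms of fs_map.                                     *)
Definition strand_space (K : fieldType) (n : nat) (F : freeSeq K n)
    (i j : nat) : 'M[K]_(fs_rank F i) :=
  diag_mx (\row_a (fs_deg F i a == j)%:R).

Definition strand_map (K : fieldType) (n : nat) (F : freeSeq K n)
    (i j : nat) : 'M[K]_(fs_rank F i.+1, fs_rank F i) :=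
  strand_space F i.+1 j *m map_mx (mcoeff 0%MM) (fs_map F i)
    *m strand_space F i j.

Definition strand_cycles (K : fieldType) (n : nat) (F : freeSeq K n)
    (i j : nat) : 'M[K]_(fs_rank F i) :=
  match i with
  | 0 => strand_space F 0 j
  | i'.+1 => (strand_space F i'.+1 j :&: kermx (strand_map F i' j))%MS
  end.

(* dim_K H_i(F (x)_S K)_j; if F is a free resolution of M, this is            *)
(* dim_K Tor_i^S(M, K)_j, the graded Betti number beta_{i,j}(M).              *)
Definition betti (K : fieldType) (n : nat) (F : freeSeq K n) (i j : nat) :
    nat :=
  (\rank (strand_cycles F i j) - \rank (strand_map F i j))%N.

(* reg M <= m. Tor does not depend on the resolution, and every finitely      *)
(* generated graded module has one by finite free modules, so that it does    *)
(* not matter whether F is quantified existentially or universally.           *)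
Definition regularity_le (K : fieldType) (n : nat) (M : gradedModule K n)
    (m : nat) : Prop :=
  exists F : freeSeq K n, graded_free_resolution F M /\
    forall i j, betti F i j != 0 -> (j <= i + m)%N.

(* The coefficient of t^j in (1 - t)^k * \sum_i h(i) t^i. *)
Definition numerator_coef (k : nat) (h : nat -> rat) (j : nat) : rat :=
  \sum_(i < j.+1) ((1 - 'X : {poly rat}) ^+ k)`_(j - i) * h i.

Definition V (k a : nat) : set (nat -> rat) :=
  [set h | exists2 b : {poly rat}, (size b <= (a + k).+1)%N &
     forall j, numerator_coef k h j = b`_j].

(* The linear isomorphism h |-> (b_0, ..., b_{a+k}) from V_{k,a} to           *)
(* Q^(a+k+1), through which V_{k,a} gets its Euclidean topology.              *)
Definition V_coord (k a : nat) (h : nat -> rat) : 'rV[rat^o]_(a + k).+1 :=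
  \row_(j < (a + k).+1) numerator_coef k h j.

(* q_h: the unique q with q(j) = h(j) for all j > a, for h in V_{k,a}. *)
Definition hilbert_poly (a : nat) (h : nat -> rat) : {poly rat} :=
  xget 0 [set q : {poly rat} | forall j : nat, (a < j)%N -> q.[j%:R] = h j].

Definition nabla (q : {poly rat}) : {poly rat} := q - (q \Po ('X - 1)).

Definition convex_hull (A : set (nat -> rat)) : set (nat -> rat) :=
  [set h | exists r (w : 'I_r -> rat) (a : 'I_r -> nat -> rat),
     [/\ forall i, 0 <= w i, \sum_i w i = 1, forall i, A (a i) &
         forall j, h j = \sum_i w i * a i j]].

Definition closed_convex_hull_V (k a : nat) (A : set (nat -> rat)) :
    set (nat -> rat) :=
  [set h | V k a h /\
     closure (V_coord k a @` convex_hull A) (V_coord k a h)].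

Definition simplicial_cone (C : set (nat -> rat)) : Prop :=
  exists r (v : 'I_r -> nat -> rat),
    (forall c : 'I_r -> rat,
       (forall j, \sum_i c i * v i j = 0) -> forall i, c i = 0) /\
    C = [set h | exists2 c : 'I_r -> rat, forall i, 0 <= c i &
           forall j, h j = \sum_i c i * v i j].

Definition ray (v : nat -> rat) : set (nat -> rat) :=
  [set h | exists2 c : rat, 0 <= c & forall j, h j = c * v j].

Definition extreme_ray (C rho : set (nat -> rat)) : Prop :=
  [/\ exists2 v : nat -> rat, (exists j, v j != 0) & rho = ray v,
      rho `<=` C &
      forall x y, C x -> C y -> rho (fun j => x j + y j) -> rho x /\ rho y].

Definition regular_hilbert_functions (K : fieldType) (n m : nat) :
    set (nat -> rat) :=
  [set h | exists (M : gradedModule K n) (h0 : nat -> nat),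
     [/\ finitely_generated M, generated_in_degree_zero M,
         ~ krull_dim_ge M n.+1, regularity_le M m &
         hilbert_function M h0 /\ h = fun j => (h0 j)%:R]].

Definition R_cone (K : fieldType) (n m : nat) : set (nat -> rat) :=
  closed_convex_hull_V n.+1 m (regular_hilbert_functions K n m).

Definition ideal_gen (K : fieldType) (n : nat) (A : set {mpoly K[n]}) :
    set {mpoly K[n]} :=
  [set p | exists r (c a : 'I_r -> {mpoly K[n]}),
     (forall i, A (a i)) /\ p = \sum_i c i * a i].

Definition ideal_pow (K : fieldType) (n : nat) (I : set {mpoly K[n]})
    (e : nat) : set {mpoly K[n]} :=
  ideal_gen [set p | exists f : 'I_e -> {mpoly K[n]},
     (forall i, I (f i)) /\ p = \prod_i f i].

Definition var_ideal (K : fieldType) (n : nat) (i : nat) :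
    set {mpoly K[n.+1]} :=
  ideal_gen [set p | exists2 l : 'I_n.+1, (l <= i)%N & p = 'X_l].

(* M is isomorphic to S/I as a graded module: the map S -> M, p |-> p *: g,   *)
(* preserves degrees since g is in M_0, is surjective and has kernel I.       *)
Definition graded_iso_quotient (K : fieldType) (n : nat)
    (M : gradedModule K n) (I : set {mpoly K[n.+1]}) : Prop :=
  exists g : M, [/\ gm_piece 0 g, forall u : M, exists p, u = p *: g &
    forall p, p *: g = 0 <-> I p].

Definition quotient_hilbert_function (K : fieldType) (n : nat)
    (I : set {mpoly K[n.+1]}) (h : nat -> rat) : Prop :=
  exists (M : gradedModule K n) (h0 : nat -> nat),
    [/\ graded_iso_quotient M I, hilbert_function M h0 &
        h = fun j => (h0 j)%:R].

(* Main.v *)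
(* The inequalities are dual to the listed modules: each of the m + 1 + n linear
   functionals is positive on exactly one of the m + 1 + n listed Hilbert functions
   and vanishes on the others, so both descriptions give the same simplicial cone C.

   R is contained in C. Over the field K(u), a module M of regularity at most m
   becomes torsion free after dividing by its m_S-torsion, which lives in degrees
   <= m, and then the generic form sum_i u^i x_i is a nonzerodivisor. Dividing by it
   keeps the regularity, lowers the number of generating variables by one, and turns
   the Hilbert function into its backward difference. By induction on this number, the
   Hilbert function is polynomial in degrees > m and satisfies the inequalities on the
   nabla^i q; the remaining ones are Macaulay's growth bound
   (j + 1) h(j + 1) <= (n + j + 1) h(j) for modules generated in degree 0. Having
   dimension at most n costs the polynomial its coefficient of degree n.

   C is contained in R. The module S / <x_0, ..., x_(r-1)>^e with e <= m + 1 has the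
   resolution given by the Koszul complex of the operators x_l - y_l on
   S (x) K[y_0, ..., y_(r-1)] / <y>^e, so that its regularity is at most m, and the
   same holds for its direct sums with itself. Convex combinations of the Hilbert
   functions of such sums exhaust C. *)

(* Tor is balanced, so regularity can be tested on the Koszul complex of M instead of on a
   resolution. This form speaks only of matrices between graded pieces and therefore passes to
   extensions of the ground field, torsion quotients and sections by a form, for which no resolution
   is at hand; the ground field changes at every section, so the induction quantifies over it. Betti
   numbers of an arbitrary, possibly non-minimal resolution are converted once, by a chase through
   the double complex formed with the Koszul complex of the variables.

   The zero module, as the sum of no copies, fills up the weights of a convex combination, so each
   point of C lies in the hull itself; the closure only matters for R inside C, where linear
   functionals are bounded in coordinates.

   The dimension is defined by chains of primes, and both directions are elementary: a faithful
   module admits the chain of the ideals generated by the first i variables, and a power of x_0 in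
   the annihilator leaves too few algebraically independent elements to separate n + 2 primes. *)
From HB Require Import structures.
Require Import Defs.
From mathcomp Require Import all_boot all_order all_algebra.
From mathcomp Require Import boolp classical_sets topology.
From mathcomp Require Import ring_quotient mpoly.
From mathcomp Require Import zify ring lra.
Set Implicit Arguments.
Unset Strict Implicit.
Unset Printing Implicit Defensive.
Import Order.TTheory GRing.Theory Num.Theory.
Local Open Scope classical_set_scope.
Local Open Scope ring_scope.

(** * Koszul complexes *)

(* The binomial coefficient 'C(r, p), as the rank of the p-th Koszul module on
   r operators; this recursion makes the splitting of the complex off the last
   operator definitional. *)
Fixpoint krank (r p : nat) : nat :=
  match r, p with
  | 0, 0 => 1
  | 0, _.+1 => 0
  | r.+1, 0 => krank r 0
  | r.+1, p.+1 => krank r p.+1 + krank r p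
  end.

Lemma krank_small r p : (r < p)%N -> krank r p = 0%N.
Proof.
elim: r p => [|r IH] [|p] //=; rewrite ltnS => lt_rp.
by rewrite !IH // ltnW.
Qed.

Lemma krank_diag r : krank r r = 1%N.
Proof. by elim: r => //= r ->; rewrite krank_small. Qed.

Section Koszul.
Variables (R : nzRingType) (g g' : nat) (X : nat -> 'M[R]_(g, g')).

(* The differential of the mapping cone of X_(r-1) on the Koszul complex of
   X_0, ..., X_(r-2); source and target of the X_i may differ, since in a graded
   module each degree has its own space. *)
Fixpoint kd (r p : nat) : 'M[R]_(krank r p.+1, g) -> 'M[R]_(krank r p, g') :=
  match r, p return 'M[R]_(krank r p.+1, g) -> 'M[R]_(krank r p, g') with
  | 0, _ => fun _ => 0
  | r.+1, 0 => fun f => kd (usubmx f) + dsubmx f *m X r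
  | r.+1, p.+1 => fun f =>
      col_mx (kd (usubmx f) + dsubmx f *m X r) (- kd (dsubmx f))
  end.

Lemma kdD r p (f f' : 'M[R]_(krank r p.+1, g)) : kd (f + f') = kd f + kd f'.
Proof.
elim: r p f f' => [|r IH] p f f' /=; first by rewrite addr0.
have eu : usubmx (f + f') = usubmx f + usubmx f' by apply/matrixP => i j; rewrite !mxE.
have ed : dsubmx (f + f') = dsubmx f + dsubmx f' by apply/matrixP => i j; rewrite !mxE.
case: p f f' eu ed => [|p] f f' eu ed; rewrite eu ed !IH mulmxDl.
  by rewrite addrACA.
by rewrite add_col_mx opprD addrACA.
Qed.

Lemma kdN r p (f : 'M[R]_(krank r p.+1, g)) : kd (- f) = - kd f.
Proof.
apply/eqP; rewrite -addr_eq0 -kdD addNr.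
by apply/eqP/(addrI (kd 0)); rewrite -kdD !addr0.
Qed.

Lemma kdB r p (f f' : 'M[R]_(krank r p.+1, g)) : kd (f - f') = kd f - kd f'.
Proof. by rewrite kdD kdN. Qed.

End Koszul.

(* Naturality with respect to a relation, rather than a map, covers linear maps,
   base change and taking homogeneous components at once. *)
Lemma kd_rel (R R' : nzRingType) g g' h h' (X : nat -> 'M[R]_(g, g'))
    (Y : nat -> 'M[R']_(h, h')) (rho : 'rV[R]_g -> 'rV[R']_h -> Prop)
    (rho' : 'rV[R]_g' -> 'rV[R']_h' -> Prop) r p f f' :
  rho' 0 0 ->
  (forall u v u' v', rho' u v -> rho' u' v' -> rho' (u + u') (v + v')) ->
  (forall u v, rho' u v -> rho' (- u) (- v)) ->
  (forall i, (i < r)%N -> forall u v, rho u v -> rho' (u *m X i) (v *m Y i)) ->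
  (forall A, rho (row A f) (row A f')) ->
  forall A, rho' (row A (@kd R g g' X r p f)) (row A (@kd R' h h' Y r p f')).
Proof.
move=> r0 rD rN rX.
elim: r p f f' rX => [|r IH] p f f' rX rf A /=; first by rewrite !row0.
have rX' i : (i < r)%N -> forall u v, rho u v -> rho' (u *m X i) (v *m Y i).
  by move=> ir; apply: rX; apply: ltnW.
case: p f f' rf A => [|p] f f' rf A.
  rewrite !linearD /= !row_mul; apply: rD.
    by apply: IH => // B; rewrite !row_usubmx.
  by apply: rX => //; rewrite !row_dsubmx.
case: (fintype.splitP A) => B eA.
  have {eA} -> : A = lshift _ B by apply: val_inj; rewrite /= eA.
  rewrite !rowKu !linearD /= !row_mul; apply: rD.
    by apply: IH => // C; rewrite !row_usubmx.
  by apply: rX => //; rewrite !row_dsubmx.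
have {eA} -> : A = rshift _ B by apply: val_inj; rewrite /= eA.
rewrite !rowKd !linearN /=; apply: rN.
by apply: IH => // C; rewrite !row_dsubmx.
Qed.

Lemma kd_nat (R : nzRingType) g g' h h' (X : nat -> 'M[R]_(g, g'))
    (Y : nat -> 'M[R]_(h, h')) (P : 'M_(g, h)) (P' : 'M_(g', h')) r p f :
  (forall i, (i < r)%N -> X i *m P' = P *m Y i) ->
  @kd R g g' X r p f *m P' = kd Y (f *m P).
Proof.
move=> XY; apply/row_matrixP => A; rewrite row_mul; symmetry.
apply: (@kd_rel R R _ _ _ _ X Y (fun u v => v = u *m P) (fun u v => v = u *m P')).
- by rewrite mul0mx.
- by move=> u v u' v' -> ->; rewrite mulmxDl.
- by move=> u v ->; rewrite mulNmx.
- by move=> i ir u v ->; rewrite -!mulmxA XY.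
- by move=> B; rewrite row_mul.
Qed.

Lemma kd_map (R R' : nzRingType) (phi : {rmorphism R -> R'}) g g'
    (X : nat -> 'M[R]_(g, g')) r p f :
  map_mx phi (@kd R g g' X r p f) = kd (fun i => map_mx phi (X i)) (map_mx phi f).
Proof.
apply/row_matrixP => A; rewrite -map_row; symmetry.
apply: (@kd_rel R R' _ _ _ _ X _ (fun u v => v = map_mx phi u) (fun u v => v = map_mx phi u)).
- by rewrite map_mx0.
- by move=> u v u' v' -> ->; rewrite map_mxD.
- by move=> u v ->; rewrite map_mxN.
- by move=> i _ u v ->; rewrite map_mxM.
- by move=> B; rewrite map_row.
Qed.

Lemma kdZ (R : comNzRingType) g g' (X : nat -> 'M[R]_(g, g')) r p c f :
  kd X (c *: f) = c *: @kd R g g' X r p f.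
Proof.
rewrite -[in RHS](mul_mx_scalar c) -[in LHS](mul_mx_scalar c); symmetry.
by apply: kd_nat => i _; rewrite scalar_mxC.
Qed.

(** The two terms in which the last operator acts exactly once cancel, by naturality of [kd] under
    that operator. *)
Lemma kdkd (R : nzRingType) g1 g2 g3 (X : nat -> 'M[R]_(g1, g2))
    (Y : nat -> 'M[R]_(g2, g3)) r p (f : 'M[R]_(krank r p.+2, g1)) :
  (forall i j, X i *m Y j = X j *m Y i) -> kd Y (kd X f) = 0.
Proof.
move=> XY; elim: r p f => [|r IH] p f //=.
have nat q (b : 'M_(krank r q.+1, g1)) : kd Y (b *m X r) = kd X b *m Y r.
  by symmetry; apply: kd_nat => i _.
case: p f => [|p] f; rewrite col_mxKu col_mxKd kdD IH nat add0r mulNmx subrr //.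
by rewrite kdN IH !oppr0 col_mx0.
Qed.

(** * Koszul complexes of the variables of a polynomial ring *)

Section Polynomials.
Variables (K : fieldType) (n : nat).
Local Notation S := {mpoly K[n]}.

(** Total in i, with value 0 beyond the last variable, so that the variables form a family indexed
    by [nat] as [kd] expects. *)
Definition xvar (i : nat) : S :=
  if insub i is Some j then 'X_(j : 'I_n) else 0.

Lemma xvarE (i : 'I_n) : xvar i = 'X_i.
Proof. by rewrite /xvar valK. Qed.

(** This substitution realizes S / <x_0, ..., x_(r-1)> inside S itself, so that membership in the
    ideal and its primality become statements about equations in a domain. *)
Definition kill (r : nat) : S -> S :=
  comp_mpoly [tuple (if (i < r)%N then 0 else 'X_i) | i < n].

Lemma kill_rmorph r : {f : {rmorphism S -> S} | kill r = f}.
Proof. by exists (comp_mpoly [tuple (if (i < r)%N then 0 else 'X_i) | i < n]). Qed.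

Lemma killM r p q : kill r (p * q) = kill r p * kill r q.
Proof. by case: (kill_rmorph r) => f ->; rewrite rmorphM. Qed.
Lemma killD r p q : kill r (p + q) = kill r p + kill r q.
Proof. by case: (kill_rmorph r) => f ->; rewrite rmorphD. Qed.
Lemma kill0 r : kill r 0 = 0.
Proof. by case: (kill_rmorph r) => f ->; rewrite rmorph0. Qed.
Lemma kill1 r : kill r 1 = 1.
Proof. by case: (kill_rmorph r) => f ->; rewrite rmorph1. Qed.

Lemma kill_var r (i : 'I_n) : kill r 'X_i = if (i < r)%N then 0 else 'X_i.
Proof. by rewrite /kill comp_mpolyXU (nth_map i) ?size_enum_ord ?nth_ord_enum. Qed.

Lemma kill_xvar r i : kill r (xvar i) = if (i < r)%N then 0 else xvar i.
Proof.
rewrite /xvar; case: insubP => [j _ <-|_]; first exact: kill_var.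
by rewrite kill0 if_same.
Qed.

Lemma killZ r c p : kill r (c *: p) = c *: kill r p.
Proof. by rewrite /kill comp_mpolyZ. Qed.

Lemma sub_kill r p : exists c : nat -> S, p - kill r p = \sum_(i < r) c i * xvar i.
Proof.
elim/mpolyind: p => [|c m p _ _ [d IH]].
  by exists (fun=> 0); rewrite kill0 subrr big1 // => i _; rewrite mul0r.
have [e He] : exists e : nat -> S, 'X_[m] - kill r 'X_[m] = \sum_(i < r) e i * xvar i.
  case: (pickP (fun j : 'I_n => (j < r)%N && (m j != 0)%N)) => [j /andP[jr mj]|Hm].
    exists (fun i : nat => (i == j :> nat)%:R * 'X_[m - U_(j)]).
    have em : 'X_[m] = 'X_[m - U_(j)] * 'X_j :> S.
      by rewrite -mpolyXD submK // lep1mP.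
    rewrite em killM kill_var jr mulr0 subr0 (bigD1 (Ordinal jr)) //=.
    rewrite eqxx mul1r xvarE big1 ?addr0 // => i ne.
    by rewrite -val_eqE /= in ne; rewrite (negPf ne) !mul0r.
  exists (fun=> 0); rewrite big1 => [|i _]; last by rewrite mul0r.
  apply/eqP; rewrite subr_eq0 {2}mpolyXE_id; apply/eqP.
  have -> : kill r (\prod_(i < n) 'X_i ^+ m i) = \prod_(i < n) kill r 'X_i ^+ m i.
    case: (kill_rmorph r) => f ->; rewrite rmorph_prod.
    by apply: eq_bigr => i _; rewrite rmorphXn.
  rewrite mpolyXE_id; apply: eq_bigr => i _; rewrite kill_var.
  by case: ifP => // ir; move/negbT: (Hm i); rewrite ir negbK => /eqP ->; rewrite !expr0.
exists (fun i => c *: e i + d i).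
rewrite killD killZ opprD addrACA -scalerBr He IH scaler_sumr -big_split /=.
by apply: eq_bigr => i _; rewrite mulrDl scalerAl.
Qed.

Lemma kill_eq0P r p :
  kill r p = 0 <-> exists c : nat -> S, p = \sum_(i < r) c i * xvar i.
Proof.
split=> [p0|[c ->]]; first by have [c] := sub_kill r p; rewrite p0 subr0; exists c.
case E: (kill_rmorph r) => [f Hf]; rewrite Hf rmorph_sum big1 // => i _.
by rewrite rmorphM -Hf kill_xvar ltn_ord mulr0.
Qed.

Lemma kill_mulX r p : (r < n)%N -> kill r (xvar r * p) = 0 -> kill r p = 0.
Proof.
move=> rn; rewrite killM kill_xvar ltnn => /eqP; rewrite mulf_eq0 => /orP[|/eqP //].
have -> : xvar r = 'X_(Ordinal rn) by rewrite -xvarE.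
move=> /eqP X0; have := mcoeffXU K (Ordinal rn) (Ordinal rn); rewrite X0 mcoeff0 eqxx => /esym/eqP.
by rewrite oner_eq0.
Qed.

Lemma kill_all p : kill n p = (p@_0)%:MP.
Proof.
elim/mpolyind: p => [|c m p _ _ IH]; first by rewrite kill0 mcoeff0 mpolyC0.
rewrite killD killZ IH mcoeffD mcoeffZ mcoeffX mpolyCD; congr (_ + _).
have [->|m0] := eqVneq m 0%MM; first by rewrite mpolyX0 kill1 mulr1 -alg_mpolyC.
rewrite mulr0 mpolyC0.
have [j mj] : exists j, m j != 0%N.
  apply/existsP; apply: contraNT m0; rewrite negb_exists => /forallP H.
  by apply/eqP/mnmP => i; rewrite mnm0E; apply/eqP/negPn/H.
have -> : 'X_[m] = 'X_[m - U_(j)] * 'X_j :> S by rewrite -mpolyXD submK // lep1mP.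
by rewrite killM kill_var ltn_ord mulr0 scaler0.
Qed.

Definition xmul g (i : nat) : 'M[S]_g := (xvar i)%:M.

Definition killmx r a b (f : 'M[S]_(a, b)) : Prop := forall i j, kill r (f i j) = 0.

Lemma koszul_aug_im r g (f : 'M[S]_(krank r 1, g)) : killmx r (kd (xmul g) f).
Proof.
elim: r f => [|r IH] f i j; first by rewrite mxE kill0.
suff : kill r.+1 ((kd (xmul g) (usubmx f) + dsubmx f *m xmul g r) i j) = 0 by [].
rewrite /xmul mul_mx_scalar !mxE killD killM kill_xvar ltnSn mul0r addr0.
have /kill_eq0P[c Hc] := IH (usubmx f) i j; apply/kill_eq0P.
exists (fun k => if (k < r)%N then c k else 0).
rewrite big_ord_recr /= ltnn mul0r addr0 Hc.
by apply: eq_bigr => k _; rewrite ltn_ord.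
Qed.

(** Together with [koszul_aug_im], this computes H_0 of the Koszul complex as g copies of S / <x_0,
    ..., x_(r-1)>. *)
Lemma koszul_aug r g (f : 'M[S]_(krank r 0, g)) : killmx r f ->
  exists h : 'M[S]_(krank r 1, g), f = kd (xmul g) h.
Proof.
elim: r f => [|r IH] /= f kf.
  exists 0; apply/matrixP => i j; rewrite mxE.
  by have /kill_eq0P[c ->] := kf i j; rewrite big_ord0.
have H i j : exists t, kill r (f i j - t * xvar r) = 0.
  have /kill_eq0P[c] := kf i j; rewrite big_ord_recr /= => ->; exists (c r).
  by rewrite addrK; apply/kill_eq0P; exists c.
pose t := \matrix_(i, j) xget 0 [set t | kill r (f i j - t * xvar r) = 0].
have Ht : killmx r (f - t *m xmul g r).
  move=> i j; rewrite mul_mx_scalar !mxE; case: (H i j) => t0 Ht0.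
  by rewrite mulrC; case: xgetP => [x -> //|/(_ t0)].
have [a Ha] := IH _ Ht.
exists (col_mx a t : 'M_(krank r.+1 1, g)) => /=.
by rewrite col_mxKu col_mxKd -Ha subrK.
Qed.

(* x_r is a nonzerodivisor modulo x_0, ..., x_{r-1}, which is tested by
   substituting 0 for these variables. *)
Lemma koszul_exact r p g (f : 'M[S]_(krank r p.+1, g)) : (r <= n)%N ->
  kd (xmul g) f = 0 -> exists h : 'M[S]_(krank r p.+2, g), f = kd (xmul g) h.
Proof.
elim: r p f => [|r IH] p f rn; first by exists 0; apply: flatmx0.
move=> kf0; set a := usubmx (f : 'M_(krank r p.+1 + krank r p, g)).
set b := dsubmx (f : 'M_(krank r p.+1 + krank r p, g)).
have [kab [c bE]] : kd (xmul g) a + b *m xmul g r = 0 /\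
    exists c : 'M[S]_(krank r p.+1, g), b = kd (xmul g) c.
  case: p f kf0 @a @b => [|p] f kf0 a b.
    split; [exact: kf0 | apply: koszul_aug => i j; apply: kill_mulX => //].
    have /matrixP/(_ i j) : kd (xmul g) a + b *m xmul g r = 0 by exact: kf0.
    rewrite /xmul mul_mx_scalar !mxE => /eqP.
    rewrite addrC addr_eq0 => /eqP ->.
    by have := koszul_aug_im (- a) i j; rewrite kdN mxE.
  have : col_mx (kd (xmul g) a + b *m xmul g r) (- kd (xmul g) b) = 0 by exact: kf0.
  rewrite -[RHS](@col_mx0 _ (krank r p.+1) (krank r p) g) => /eq_col_mx[e1 e2].
  by split=> //; apply: IH (ltnW rn) _; apply/eqP; rewrite -oppr_eq0; apply/eqP.
(* Since b is the boundary of c, adding [c x_r] to a turns a into a cycle for the first r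
   variables. *)
have [a' Ha'] : exists a', a + c *m xmul g r = kd (xmul g) a'.
  apply: IH (ltnW rn) _; rewrite kdD -[RHS]kab bE; congr (_ + _).
  by symmetry; apply: kd_nat => i _; rewrite /xmul scalar_mxC.
exists (col_mx a' (- c) : 'M_(krank r.+1 p.+2, g)) => /=.
rewrite col_mxKu col_mxKd kdN opprK -bE -Ha' mulNmx addrK.
by rewrite /a /b vsubmxK.
Qed.

End Polynomials.

(** * Difference calculus on polynomials *)

Lemma nablaE q (x : rat) : (nabla q).[x] = q.[x] - q.[x - 1].
Proof. by rewrite /nabla hornerD hornerN horner_comp !hornerE. Qed.

Lemma nablaD q1 q2 : nabla (q1 + q2) = nabla q1 + nabla q2.
Proof. by rewrite /nabla linearD /= opprD addrACA. Qed.

Lemma nablaZ c q : nabla (c *: q) = c *: nabla q.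
Proof. by rewrite /nabla linearZ /= scalerBr. Qed.

Lemma nablaC c : nabla c%:P = 0.
Proof. by rewrite /nabla comp_polyC subrr. Qed.

(** The backward difference acts on these rising factorials as the derivative acts on powers of
    s. *)
Definition rising (k : nat) : {poly rat} := \prod_(i < k) ('X + (i%:R)%:P).

Lemma monic_rising k : rising k \is monic.
Proof. by apply: monic_prod => i _; rewrite monicXaddC. Qed.

Lemma size_rising k : size (rising k) = k.+1.
Proof.
elim: k => [|k IH]; first by rewrite /rising big_ord0 size_poly1.
rewrite /rising big_ord_recr /= size_Mmonic ?monicXaddC ?monic_neq0 ?monic_rising //.
by rewrite -/(rising k) IH size_XaddC /=; lia.
Qed.

Lemma nabla_rising k : nabla (rising k.+1) = k.+1%:R *: rising k.
Proof.
rewrite /nabla.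
have -> : rising k.+1 \Po ('X - 1) = ('X - 1) * rising k.
  rewrite rmorph_prod /= big_ord_recl; congr (_ * _).
    by rewrite rmorphD /= comp_polyX comp_polyC polyC0 addr0.
  apply: eq_bigr => i _; rewrite rmorphD /= comp_polyX comp_polyC -addrA; congr (_ + _).
  by rewrite /bump leq0n natrD polyCD polyC1 addKr.
have -> : rising k.+1 = rising k * ('X + (k%:R)%:P) by rewrite /rising big_ord_recr.
by rewrite -mul_polyC -[k.+1]addn1 natrD polyCD polyC1; ring.
Qed.

(** The leading term is removed by a multiple of [rising k], whose antidifference is a multiple of
    [rising k.+1]. *)
Lemma antidifference k (p : {poly rat}) : (size p <= k)%N ->
  exists2 q : {poly rat}, (size q <= k.+1)%N & nabla q = p.
Proof.
elim: k p => [|k IH] p sp.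
  by exists 0; rewrite ?size_poly0 // (_ : p = 0) ?(nablaC 0) //; apply/eqP;
    rewrite -size_poly_leq0.
pose c := p`_k; have sp' : (size (p - c *: rising k)%R <= k)%N.
  apply/leq_sizeP => j kj; rewrite coefB coefZ.
  move: kj; rewrite leq_eqVlt => /predU1P[<-|kj].
    have /eqP := monic_rising k; rewrite lead_coefE size_rising /= => ->.
    by rewrite mulr1 subrr.
  by rewrite !nth_default ?mulr0 ?subrr ?size_rising // (leq_trans sp).
have [q sq Hq] := IH _ sp'.
exists (q + (c / k.+1%:R) *: rising k.+1); last first.
  by rewrite nablaD nablaZ nabla_rising Hq scalerA mulfVK ?pnatr_eq0 // subrK.
rewrite (leq_trans (size_polyD _ _)) // geq_max (leq_trans sq) //=.
by rewrite (leq_trans (size_scale_leq _ _)) // size_rising.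
Qed.

Lemma poly_eq_large (p q : {poly rat}) a :
  (forall j : nat, (a < j)%N -> p.[j%:R] = q.[j%:R]) -> p = q.
Proof.
move=> pq; apply/eqP; rewrite -subr_eq0; apply/negPn/negP => nz.
have := max_poly_roots nz (rs := [seq j%:R | j <- iota a.+1 (size (p - q))]).
rewrite size_map size_iota ltnn => /(_ _ _)H; suff : false by []; apply: H.
- apply/allP => _ /mapP[j + ->]; rewrite mem_iota => /andP[aj _].
  by rewrite /root !hornerE pq // subrr.
- rewrite map_inj_uniq ?iota_uniq // => i j /eqP; rewrite eqr_nat => /eqP //.
Qed.

(** * Graded vector spaces with commuting operators *)

Section GradedData.
Variable F : fieldType.
Implicit Types (h : nat -> nat).

(* A graded module over a polynomial ring, in coordinates: X i d is multiplication
   by x_i from degree d to degree d + 1, acting on row vectors. *)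
Definition ops h := nat -> forall d, 'M[F]_(h d, h d.+1).

Definition ops_comm h (X : ops h) :=
  forall i j d, X i d *m X j d.+1 = X j d *m X i d.+1.

(** Stated for any number of rows, this applies to identity matrices and to whole Koszul chains at
    once. *)
Definition ops_gen r h (X : ops h) := forall d k (v : 'M_(k, h d.+1)),
  exists u : nat -> 'M_(k, h d), v = \sum_(i < r) u i *m X i d.

Definition is_quotient h (X : ops h) h' (X' : ops h')
    (P : forall d, 'M[F]_(h d, h' d)) :=
  (forall d, row_full (P d)) /\ (forall i d, X i d *m P d.+1 = P d *m X' i d).

(** The operators descend along the arbitrary section [pinvmx (P d)]: another section differs from
    it by elements of [W d], and W is stable. *)
Lemma quotient_exists h (X : ops h) (W : forall d, 'M[F]_(h d)) :
  (forall i d, (W d *m X i d <= W d.+1)%MS) ->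
  exists h' (X' : ops h') P, [/\ is_quotient X X' P,
    forall d k (v : 'M_(k, h d)), (v *m P d == 0) = (v <= W d)%MS &
    forall d, (h' d + \rank (W d))%N = h d].
Proof.
move=> WX; pose C d := cokermx (W d); pose h' d := \rank (C d).
pose P d : 'M_(h d, h' d) := col_base (C d).
have P0 d k (v : 'M_(k, h d)) : (v *m P d == 0) = (v <= W d)%MS.
  rewrite submxE -/(C d) -[in RHS](mulmx_base (C d)) mulmxA.
  rewrite -[in RHS](mul0mx _ (row_base (C d))).
  by rewrite (inj_eq (row_free_inj (row_base_free _))).
have Pf d : row_full (P d) by apply: col_base_full.
have hE d : (h' d + \rank (W d))%N = h d.
  by rewrite /h' mxrank_coker subnK // rank_leq_row.
clearbody P h'.
exists h', (fun i d => pinvmx (P d) *m X i d *m P d.+1), P; split=> //.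
  split=> // i d; rewrite !mulmxA; apply/eqP.
  have : (X i d - P d *m pinvmx (P d) *m X i d <= W d.+1)%MS.
    rewrite -{1}[X i d]mul1mx -mulmxBl.
    apply: submx_trans (WX i d); apply: submxMr.
    by rewrite -P0 mulmxBl mul1mx -mulmxA mulVpmx // mulmx1 subrr.
  by rewrite -P0 mulmxBl subr_eq0 !mulmxA.
Qed.

Section Quotient.
Variables (h : nat -> nat) (X : ops h) (h' : nat -> nat) (X' : ops h').
Variable P : forall d, 'M[F]_(h d, h' d).
Hypothesis XP : is_quotient X X' P.

Lemma quotient_comm : ops_comm X -> ops_comm X'.
Proof.
case: XP => Pf E cX i j d; apply: (row_full_inj (Pf d)).
by rewrite /= !mulmxA -!E -!mulmxA -!E !mulmxA cX.
Qed.

Lemma quotient_lift d k (v : 'M_(k, h' d)) : v *m pinvmx (P d) *m P d = v.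
Proof. by case: XP => Pf _; rewrite -mulmxA mulVpmx // mulmx1. Qed.

Lemma quotient_gen r : ops_gen r X -> ops_gen r X'.
Proof.
case: XP => Pf E gX d k v.
have [u Hu] := gX d k (v *m pinvmx (P d.+1)).
exists (fun i => u i *m P d); rewrite -[LHS]quotient_lift Hu mulmx_suml.
by apply: eq_bigr => i _; rewrite -!mulmxA E.
Qed.
End Quotient.

(** * Macaulay's growth bound *)

Lemma rank_adds_coker m1 m2 n (A : 'M[F]_(m1, n)) (B : 'M[F]_(m2, n)) :
  \rank (A + B)%MS = (\rank B + \rank (A *m cokermx B))%N.
Proof.
rewrite -(mxrank_mul_ker (A + B)%MS (cokermx B)) addnC; congr (_ + _)%N.
  apply: eqmx_rank; apply/andP; split; last first.
    by rewrite sub_capmx addsmxSr; apply/sub_kermxP; exact: mulmx_coker.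
  apply: (submx_trans (capmxSr _ _)); rewrite submxE; apply/eqP.
  exact: mulmx_ker.
by rewrite (addsmxMr _ _ _) mulmx_coker addsmx0.
Qed.

Section Growth.
Variables (h : nat -> nat) (X : ops h) (r : nat).
Hypothesis cX : ops_comm X.

(* 0 : x^a for x = X r. Filtering M by the images of the 0 : x^a and of x M reduces
   the growth bound to modules generated by one variable less. *)
Fixpoint xker (a d : nat) : 'M[F]_(h d) :=
  if a is a'.+1 then kermx (X r d *m cokermx (xker a' d.+1)) else 0.

Lemma sub_xkerS a d k (v : 'M_(k, h d)) :
  (v <= xker a.+1 d)%MS = (v *m X r d <= xker a d.+1)%MS.
Proof. by apply/sub_kermxP/idP; rewrite submxE mulmxA => /eqP. Qed.

Lemma xker_stable a i d : (xker a d *m X i d <= xker a d.+1)%MS.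
Proof.
elim: a d => [|a IH] d; first by rewrite /= mul0mx sub0mx.
rewrite sub_xkerS -mulmxA cX mulmxA; apply: submx_trans (IH _).
by apply: submxMr; rewrite -sub_xkerS.
Qed.

Lemma xker_mono a d : (xker a d <= xker a.+1 d)%MS.
Proof.
elim: a d => [|a IH] d; first exact: sub0mx.
by rewrite sub_xkerS; apply: submx_trans (IH _); rewrite -sub_xkerS.
Qed.

Definition xstep (a d : nat) : 'M[F]_(h d) :=
  match d return 'M[F]_(h d) with
  | 0 => xker a 0
  | d'.+1 => (X r d' + xker a d'.+1)%MS
  end.

Lemma xstep_stable a i d : (xstep a d *m X i d <= xstep a d.+1)%MS.
Proof.
case: d => [|d] /=; first by apply: submx_trans (xker_stable _ _ _) (addsmxSr _ _).
rewrite (addsmxMr _ _ _) addsmx_sub cX; apply/andP; split.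
  by apply: submx_trans (submxMl _ _) (addsmxSl _ _).
by apply: submx_trans (xker_stable _ _ _) (addsmxSr _ _).
Qed.

Lemma xstep_mono a d : (xstep a d <= xstep a.+1 d)%MS.
Proof.
case: d => [|d]; first exact: xker_mono.
by apply: addsmxS => //; apply: xker_mono.
Qed.

Definition xrank a d := (h d - \rank (xker a d))%N.
Definition xgr a d := (h d - \rank (xstep a d))%N.

(** Multiplication by x maps M / (0 : x^(a+1)) isomorphically onto the kernel of the projection from
    M / (0 : x^a) to M / (xM + (0 : x^a)). *)
Lemma xgrS a d : xrank a d.+1 = (xgr a d.+1 + xrank a.+1 d)%N.
Proof.
have := rank_leq_col (xstep a d.+1).
rewrite /xrank /xgr /= rank_adds_coker mxrank_ker.
have := rank_leq_row (X r d *m cokermx (xker a d.+1)); lia.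
Qed.

Lemma xrank_sum a d : xrank a d = (\sum_(b < d.+1) xgr (a + b) (d - b))%N.
Proof.
elim: d a => [|d IH] a; first by rewrite big_ord_recl big_ord0 addn0 /= addn0.
rewrite xgrS IH [RHS]big_ord_recl addn0 subn0; congr (_ + _)%N.
by apply: eq_bigr => b _; rewrite lift0 subSS addSnnS.
Qed.
End Growth.

(** The factor j + 1 is split as (j + 1 - a) + a. The first part is bounded by the growth of [g a]
    from degree s = j - a, the second, after a shift of a by one, by monotonicity in a; the factors
    add up to (r + s) + (a + 1) = r + 1 + j. *)
Lemma convolution_growth (g : nat -> nat -> nat) r j :
  (forall a s, s.+1 * g a s.+1 <= (r + s) * g a s)%N ->
  (forall a s, g a.+1 s <= g a s)%N ->
  (j.+1 * (\sum_(a < j.+2) g a (j.+1 - a)) <=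
   (r.+1 + j) * \sum_(a < j.+1) g a (j - a))%N.
Proof.
move=> gS gm.
have -> : (j.+1 * (\sum_(a < j.+2) g a (j.+1 - a)) =
   \sum_(a < j.+2) (j.+1 - a) * g a (j.+1 - a) + \sum_(a < j.+2) a * g a (j.+1 - a))%N.
  rewrite big_distrr -big_split /=; apply: eq_bigr => a _; rewrite -mulnDl.
  by have := ltn_ord a; rewrite ltnS => aj; rewrite subnK.
rewrite big_ord_recr /= subnn mul0n addn0 [X in (_ + X)%N]big_ord_recl mul0n add0n.
rewrite -big_split big_distrr /=; apply: leq_sum => a _.
change (bump 0 a) with a.+1; rewrite subSS.
have := ltn_ord a; rewrite ltnS => aj; rewrite subSn //.
have := gS a (j - a)%N; have := gm a (j - a)%N; set s := (j - a)%N.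
have -> : (r.+1 + j = (r + s) + a.+1)%N by rewrite -{1}(subnK aj) -/s; lia.
nia.
Qed.

Lemma growth r h (X : ops h) : ops_comm X -> ops_gen r X ->
  forall j, (j.+1 * h j.+1 <= (r + j) * h j)%N.
Proof.
elim: r h X => [|r IH] h X cX gX j.
  rewrite (_ : h j.+1 = 0%N) ?muln0 //; case E : (h j.+1) => [//|k].
  have [u] := gX j _ 1%:M; rewrite big_ord0 => /eqP.
  by rewrite -mxrank_eq0 mxrank1 E.
have H a s : (s.+1 * xgr X r a s.+1 <= (r + s) * xgr X r a s)%N.
  have [h' [X' [P [XP P0 hE]]]] := quotient_exists (xstep_stable r cX a).
  have E d : xgr X r a d = h' d by have := hE d; rewrite /xgr; lia.
  rewrite !E; apply: IH (quotient_comm XP cX) _ _ => d k v.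
  have [u ->] := quotient_gen XP gX v; exists u; rewrite big_ord_recr /=.
  (* The image of the last operator lies in [xstep], so that this operator is zero on the quotient
     and the other r generate it. *)
  rewrite (_ : X' r d = 0) ?mulmx0 ?addr0 //; case: XP => Pf PE.
  apply: (row_full_inj (Pf d)); rewrite /= -PE mulmx0; apply/eqP.
  by rewrite P0; apply: addsmxSl.
have hE d : h d = (\sum_(b < d.+1) xgr X r b (d - b))%N.
  by rewrite -(xrank_sum X r 0 d) /xrank mxrank0 subn0.
rewrite (hE j) (hE j.+1); apply: convolution_growth => // a s.
by rewrite leq_sub2l // mxrankS // xstep_mono.
Qed.
End GradedData.

(** * Regularity through Koszul complexes, and torsion *)

Section Regularity.
Variable m r0 : nat.

(* Regularity at most m: Tor, computed by the Koszul complex, vanishes in positive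
   homological degree p above internal degree p + m. *)
Definition ops_reg (F : fieldType) h (X : ops F h) :=
  forall d p (f : 'M[F]_(krank r0 p.+1, h d.+1)), (m <= d)%N ->
    kd (X^~ d.+1) f = 0 -> exists g, f = kd (X^~ d) g.

(* The first r operators span all of them; r drops with each hyperplane section
   while the Koszul complexes keep using all r0 operators. *)
Definition ops_span (F : fieldType) r h (X : ops F h) :=
  exists2 c : nat -> nat -> F,
    forall i j, (i < r)%N -> (j < r)%N -> c i j = (i == j)%:R &
    forall i d, X i d = \sum_(j < r) c i j *: X j d.

Section Field.
Variable F : fieldType.

(** An element killed by all operators is a cycle in the top homological degree r0; the Koszul
    module above it is zero, so exactness makes the element vanish. *)
Lemma no_socle h (X : ops F h) : (0 < r0)%N -> ops_reg X ->
  forall d (u : 'rV_(h d.+1)), (m <= d)%N ->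
    (forall i, (i < r0)%N -> u *m X i d.+1 = 0) -> u = 0.
Proof.
rewrite /ops_reg; case: r0 => // r1 _ rX d u md uX.
pose f : 'M[F]_(krank r1.+1 r1.+1, h d.+1) := \matrix_(i, j) u 0 j.
have fE A : row A f = u by apply/rowP => j; rewrite !mxE.
have [|g fg] := rX d r1 f md.
  apply/row_matrixP => A; rewrite row0.
  apply: (@kd_rel F F _ _ _ _ (X^~ d.+1) (X^~ d.+1) (fun a _ => a = u) (fun a _ => a = 0)) => //.
  - by move=> a _ b _ -> ->; rewrite addr0.
  - by move=> a _ ->; rewrite oppr0.
  - by move=> i ir a _ ->; apply: uX.
have g0 : g = 0.
  apply/matrixP => i; suff : False by []; move: (ltn_ord i) => {fg}.
  by move: (nat_of_ord i) => k; rewrite krank_small.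
have i0 : 'I_(krank r1.+1 r1.+1) by rewrite krank_diag; exact: ord0.
by rewrite -(fE i0) fg g0 -(subrr 0) kdB subrr row0.
Qed.

Lemma koszul_gen_aug h (X : ops F h) d r (u : nat -> 'M_(krank r 0, h d)) :
  exists e : 'M_(krank r 1, h d), kd (X^~ d) e = \sum_(i < r) u i *m X i d.
Proof.
elim: r u => [|r IH] u; first by exists 0; rewrite big_ord0.
have [e He] := IH u; exists (col_mx e (u r) : 'M_(krank r.+1 1, h d)) => /=.
by rewrite col_mxKu col_mxKd He big_ord_recr.
Qed.

Lemma ops_gen_le r h (X : ops F h) : (r <= r0)%N -> ops_gen r X -> ops_gen r0 X.
Proof.
move=> le_r gX d k v; have [u ->] := gX d k v.
exists (fun i => if (i < r)%N then u i else 0).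
rewrite (big_ord_widen _ (fun i => u i *m X i d) le_r) big_mkcond /=.
by apply: eq_bigr => i _; case: ifP; rewrite ?mul0mx.
Qed.

Lemma ops_span_quotient r h (X : ops F h) h' (X' : ops F h') P :
  is_quotient X X' P -> ops_span r X -> ops_span r X'.
Proof.
move=> [Pf PE] [c cE XE]; exists c => // i d.
apply: (row_full_inj (Pf d)); rewrite /= -PE XE mulmx_suml mulmx_sumr.
by apply: eq_bigr => j _; rewrite -scalemxAl -scalemxAr PE.
Qed.

Section Torsion.
Variables (h : nat -> nat) (X : ops F h).

Fixpoint tors_upto (t d : nat) : 'M[F]_(h d) :=
  if t is t'.+1 then
    (\bigcap_(i < r0) kermx (X i d *m cokermx (tors_upto t' d.+1)))%MS
  else 0.

(* By regularity the elements killed by a power of the irrelevant ideal live in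
   degrees <= m, so m + 1 - d steps suffice in degree d. *)
Definition tors (d : nat) := tors_upto (m.+1 - d) d.

Hypothesis r0_gt0 : (0 < r0)%N.
Hypothesis rX : ops_reg X.

Lemma tors0 d : (m < d)%N -> tors d = 0.
Proof. by rewrite /tors -subn_eq0 => /eqP ->. Qed.

(** In degrees at most m this is the recursion; beyond m both sides say that u is zero, by
    [no_socle]. *)
Lemma sub_tors d (u : 'rV_(h d)) :
  (u <= tors d)%MS <-> forall i, (i < r0)%N -> (u *m X i d <= tors d.+1)%MS.
Proof.
have [dm|md] := leqP d m.
  rewrite /tors subSS subSn //=; split=> [/sub_bigcapmxP H i ir|H].
    by have /sub_kermxP := H (Ordinal ir) isT; rewrite submxE mulmxA => ->.
  apply/sub_bigcapmxP => i _; apply/sub_kermxP; rewrite mulmxA.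
  by apply/eqP; rewrite -submxE H.
rewrite !tors0 ?(ltnW md) //; last exact: ltnW.
rewrite submx0; split=> [/eqP -> i _|H]; first by rewrite mul0mx sub0mx.
case: d md u H => // d md u H; apply/eqP; apply: (no_socle r0_gt0 rX md) => i ir.
by apply/eqP; rewrite -submx0 H.
Qed.

Lemma tors_stable r : (r <= r0)%N -> ops_span r X ->
  forall i d, (tors d *m X i d <= tors d.+1)%MS.
Proof.
move=> le_r [c _ XE] i d; rewrite XE mulmx_sumr; apply: summx_sub => j _.
rewrite -scalemxAr scalemx_sub //; apply/row_subP => k; rewrite row_mul.
by have /sub_tors := row_sub k (tors d); apply; apply: leq_trans le_r.
Qed.

Lemma torsion_quotient r : (r <= r0)%N -> ops_comm X -> ops_gen r X ->
  ops_span r X ->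
  exists h' (X' : ops F h'), [/\ ops_comm X', ops_gen r X', ops_span r X',
    ops_reg X' & [/\ (forall d (u : 'rV_(h' d)),
       (forall i, (i < r0)%N -> u *m X' i d = 0) -> u = 0),
    forall d, (m < d)%N -> h' d = h d & forall d, (h' d <= h d)%N]].
Proof.
move=> le_r cX gX sX.
have [h' [X' [P [XP P0 hE]]]] := quotient_exists (tors_stable le_r sX).
have [Pf PE] := XP.
have lift := quotient_lift XP.
exists h', X'; split.
- exact: quotient_comm XP cX.
- exact (quotient_gen XP gX).
- exact: ops_span_quotient XP sX.
- move=> d p f md kf0; set f1 := f *m pinvmx (P d.+1).
  (* The boundary of the lift is torsion in degree d + 2 > m, where no torsion is left, so that
     cycles lift to cycles. *)
  have kf1 : kd (X^~ d.+1) f1 = 0.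
    have : (kd (X^~ d.+1) f1 <= tors d.+2)%MS.
      rewrite -P0 (kd_nat (Y := X'^~ d.+1) (P := P d.+1)) => [|i _]; last exact: PE.
      by rewrite lift kf0.
    by rewrite tors0 ?submx0 => [/eqP //|]; rewrite ltnS ltnW.
  have [g fg] := rX md kf1; exists (g *m P d); rewrite -[LHS]lift -/f1 fg.
  by apply: kd_nat => i _; apply: PE.
- split=> [d u uX|d md|d]; last by rewrite -(hE d) leq_addr.
    rewrite -[LHS]lift; apply/eqP; rewrite P0; apply/sub_tors => i ir.
    by rewrite -P0 -mulmxA PE mulmxA lift uX.
  by rewrite -(hE d) tors0 // mxrank0 addn0.
Qed.
End Torsion.
End Field.
End Regularity.

(** Linearity lets [lin_mx] turn the differential into a matrix, both for base change and for
    writing down a free resolution. *)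
HB.instance Definition _ (R : comNzRingType) g g' (X : nat -> 'M[R]_(g, g')) r p :=
  GRing.isLinear.Build R 'M[R]_(krank r p.+1, g) 'M[R]_(krank r p, g') _ (@kd R g g' X r p)
    (fun a u v => etrans (kdD X (a *: u) v) (congr1 (fun x => x + kd X v) (kdZ X a u))).

(** * Extension of the ground field *)

Section BaseChange.
Variables (F F' : fieldType) (phi : {rmorphism F -> F'}).
Variables (m r0 : nat) (h : nat -> nat) (X : ops F h).

Definition ops_map : ops F' h := fun i d => map_mx phi (X i d).

Lemma map_comm : ops_comm X -> ops_comm ops_map.
Proof. by move=> cX i j d; rewrite -!map_mxM cX. Qed.

Lemma map_gen r : ops_gen r X -> ops_gen r ops_map.
Proof.
move=> gX d k v; have [u Hu] := gX d _ 1%:M.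
exists (fun i => v *m map_mx phi (u i)).
rewrite -[LHS]mulmx1 -(map_mx1 phi) Hu map_mx_sum mulmx_sumr.
by apply: eq_bigr => i _; rewrite map_mxM mulmxA.
Qed.

(** Exactness says that the kernel of one matrix lies in the row space of another, which is
    preserved by field extensions. *)
Lemma map_reg : ops_reg m r0 X -> ops_reg m r0 ops_map.
Proof.
move=> rX d p f md kf0.
pose A : 'M[F]_(krank r0 p.+2 * h d, krank r0 p.+1 * h d.+1) := lin_mx (@kd F _ _ (X^~ d) r0 p.+1).
pose B : 'M[F]_(krank r0 p.+1 * h d.+1, krank r0 p * h d.+2) := lin_mx (@kd F _ _ (X^~ d.+1) r0 p).
have AE : map_mx phi A = lin_mx (@kd F' _ _ (ops_map^~ d) r0 p.+1).
  by apply: map_lin_mx => x; apply: kd_map.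
have BE : map_mx phi B = lin_mx (@kd F' _ _ (ops_map^~ d.+1) r0 p).
  by apply: map_lin_mx => x; apply: kd_map.
have AB : (kermx B <= A)%MS.
  apply/row_subP => i; have /sub_kermxP : (row i (kermx B) <= kermx B)%MS by apply: row_sub.
  set v := row i _ => vB; have : kd (X^~ d.+1) (vec_mx v) = 0.
    by apply: (can_inj mxvecK); rewrite -mul_vec_lin vec_mxK vB linear0.
  move=> /(rX _ _ _ md)[g vg]; apply/submxP; exists (mxvec g).
  by rewrite mul_vec_lin /= -vg vec_mxK.
have : (mxvec f <= map_mx phi A)%MS.
  apply: submx_trans (_ : (_ <= map_mx phi (kermx B))%MS) _; last by rewrite map_submx.
  by rewrite map_kermx; apply/sub_kermxP; rewrite BE mul_vec_lin /= kf0 linear0.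
case/submxP => w Hw; exists (vec_mx w).
by apply: (can_inj mxvecK); rewrite -mul_vec_lin vec_mxK -AE.
Qed.
End BaseChange.

(** * Generic linear forms over a field of fractions *)

Lemma frac_num_den (R : idomainType) (x : {fraction R}) :
  exists a b : R, b != 0 /\ FracField.tofrac b * x = FracField.tofrac a.
Proof.
elim/quotW: x => r; exists (frac r).1, (frac r).2; split; first exact: denom_ratioP.
rewrite !piE; apply/eqP; rewrite FracField.equivf_def /FracField.mulf.
by rewrite !numden_Ratio ?oner_neq0 ?mul1r ?mulr1 ?denom_ratioP // mulrC.
Qed.

Lemma frac_rV_den (R : idomainType) k (v : 'rV[{fraction R}]_k) :
  exists b (w : 'rV[R]_k), b != 0 /\
    FracField.tofrac b *: v = map_mx (@FracField.tofrac R) w.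
Proof.
have H j := frac_num_den (v 0 j).
have Hb j : {b : R | b != 0 /\ exists a, FracField.tofrac b * v 0 j = FracField.tofrac a}.
  by apply: cid; have [a [b [b0 E]]] := H j; exists b; split=> //; exists a.
pose b j := sval (Hb j).
have Ha j : {a : R | FracField.tofrac (b j) * v 0 j = FracField.tofrac a}.
  by apply: cid; have [_] := svalP (Hb j).
exists (\prod_j b j), (\row_j ((\prod_(i | i != j) b i) * sval (Ha j))); split.
  by rewrite prodf_seq_neq0; apply/allP => j _ /=; have [] := svalP (Hb j).
apply/rowP => j; rewrite !mxE (bigD1 j) //= [b j * _]mulrC !rmorphM /= -mulrA.
by congr (_ * _); apply: (svalP (Ha j)).
Qed.

Section McCoy.
Variables (F : fieldType) (r0 : nat) (h : nat -> nat) (X : ops F h).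
Hypothesis cX : ops_comm X.
Hypothesis soc : forall d (u : 'rV_(h d)),
  (forall i, (i < r0)%N -> u *m X i d = 0) -> u = 0.

Definition generic_form d : 'M[{poly F}]_(h d, h d.+1) :=
  \sum_(i < r0) 'X^i *: map_mx polyC (X i d).

(* McCoy's argument: if w is killed by the form sum_i u^i x_i, then so is every w x_i,
   and, for i descending from r0 - 1, the top coefficient of w is killed by x_i, so
   that w x_i has smaller degree and vanishes by induction. *)
Lemma generic_form_inj s d (w : 'rV[{poly F}]_(h d)) :
  (forall j, (size (w 0%R j) <= s)%N) -> w *m generic_form d = 0 -> w = 0.
Proof.
elim: s d w => [|s IH] d w ws wl0.
  by apply/rowP => j; rewrite mxE; apply/eqP; rewrite -size_poly_leq0.
pose XC i := map_mx polyC (X i d).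
have coefw i j : (w *m XC i) 0 j = \sum_k w 0 k * (X i d k j)%:P.
  by rewrite mxE; apply: eq_bigr => k _; rewrite mxE.
have sw i j : (size ((w *m XC i) 0 j)%R <= s.+1)%N.
  rewrite coefw (leq_trans (size_sum _ _ _)) //; apply/bigmax_leqP => k _.
  by rewrite mulrC mul_polyC (leq_trans (size_scale_leq _ _)).
have wX k i : (r0 - k <= i)%N -> (i < r0)%N -> w *m XC i = 0.
  elim: k i => [|k IHk] i; first by rewrite subn0 => h1 h2; lia.
  move=> ri ir; have [|rik] := leqP (r0 - k) i; first by move/IHk; apply.
  apply: (IH d.+1); last first.
    rewrite -mulmxA (_ : XC i *m _ = generic_form d *m map_mx polyC (X i d.+1)).
      by rewrite mulmxA wl0 mul0mx.
    rewrite mulmx_sumr mulmx_suml; apply: eq_bigr => j _.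
    by rewrite -scalemxAr -scalemxAl -!map_mxM cX.
  move=> j; apply/leq_sizeP => a; rewrite leq_eqVlt => /predU1P[<-|sa]; last first.
    by rewrite nth_default // (leq_trans (sw i j)).
  (* In the coefficient of u^(i+s), the operators before i contribute nothing because w has degree
     at most s in u, those after i because of [IHk]. *)
  have := congr1 (fun M : 'rV[{poly F}]_(h d.+1) => (M 0 j)`_(i + s)) wl0.
  rewrite mulmx_sumr summxE coef_sum mxE coef0 (bigD1 (Ordinal ir)) //= big1 => [|t ti].
    by rewrite addr0 -scalemxAr mxE coefXnM ltnNge leq_addr addKn.
  rewrite -scalemxAr mxE coefXnM; case: ltnP => // tis.
  have [ti'|ti'] := ltnP t i.
    by rewrite nth_default // (leq_trans (sw t j)) //; lia.
  rewrite IHk ?mxE ?coef0 //.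
  by move: ti; rewrite -val_eqE /= => /eqP ti; lia.
apply/rowP => j; rewrite mxE; apply/polyP => a; rewrite coef0.
have : map_mx (coefp a) w = 0.
  apply: soc => i ir; have := wX r0 i; rewrite subnn => /(_ isT ir) wX0.
  apply/rowP => k; have := congr1 (fun M : 'rV[{poly F}]_(h d.+1) => (M 0 k)`_a) wX0.
  rewrite coefw mxE coef0 coef_sum => E; rewrite !mxE -[RHS]E.
  by apply: eq_bigr => t _; rewrite mxE coefMC.
by move/rowP/(_ j); rewrite !mxE.
Qed.

Lemma generic_form_frac_inj d k (v : 'M[{fraction {poly F}}]_(k, h d)) :
  v *m map_mx (@FracField.tofrac _) (generic_form d) = 0 -> v = 0.
Proof.
move=> vl0; apply/row_matrixP => A; rewrite row0.
have [b [w [b0 bw]]] := frac_rV_den (row A v).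
have w0 : w = 0.
  apply: (@generic_form_inj (\max_j size (w 0%R j))%N d).
    by move=> j; apply: (leq_bigmax (F := fun j => size (w 0%R j))).
  have : map_mx (@FracField.tofrac _) (w *m generic_form d) = 0.
    by rewrite map_mxM -bw -scalemxAl -row_mul vl0 row0 scaler0.
  move/matrixP => E; apply/matrixP => i j; apply/eqP.
  rewrite [X in _ == X]mxE -tofrac_eq0; move: (E i j); rewrite mxE [in X in _ = X -> _]mxE => ->.
  exact: eqxx.
apply: (scalerI (a := FracField.tofrac b)); first by rewrite tofrac_eq0.
by rewrite bw w0 map_mx0 scaler0.
Qed.
End McCoy.

(* The hyperplane is generic over K(u), which is infinite even if K is finite. *)
Lemma hyperplane_section (F : fieldType) m r0 r h (X : ops F h) :
  (r < r0)%N -> ops_comm X -> ops_gen r.+1 X -> ops_span r.+1 X ->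
  ops_reg m r0 X ->
  (forall d (u : 'rV_(h d)), (forall i, (i < r0)%N -> u *m X i d = 0) -> u = 0) ->
  exists (F' : fieldType) h' (X' : ops F' h'),
    [/\ ops_comm X', ops_gen r X', ops_span r X', ops_reg m r0 X' &
        h' 0%N = h 0%N /\ forall d, (h' d.+1 + h d)%N = h d.+1].
Proof.
move=> r_lt cX gX [c cE XE] rX soc.
pose F' : fieldType := {fraction {poly F}}.
pose tof : {rmorphism {poly F} -> F'} := @FracField.tofrac {poly F}.
pose phi : {rmorphism F -> F'} := tof \o polyC.
pose Y : ops F' h := ops_map phi X.
have cY : ops_comm Y by apply: map_comm.
have gY : ops_gen r.+1 Y by apply: map_gen.
have rY : ops_reg m r0 Y by apply: map_reg.
pose b i j := phi (c i j).
have bE i j : (i < r.+1)%N -> (j < r.+1)%N -> b i j = (i == j)%:R.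
  by move=> ir jr; rewrite /b cE // rmorph_nat.
have YE i d : Y i d = \sum_(j < r.+1) b i j *: Y j d.
  by rewrite {1}/Y /ops_map XE map_mx_sum; apply: eq_bigr => j _; rewrite map_mxZ.
pose u : F' := tof 'X.
pose l d : 'M[F']_(h d, h d.+1) := \sum_(i < r0) u ^+ i *: Y i d.
have lE d : l d = map_mx tof (generic_form r0 X d).
  rewrite /l /generic_form map_mx_sum; apply: eq_bigr => i _.
  by rewrite map_mxZ rmorphXn -map_mx_comp.
have linj d k (v : 'M_(k, h d)) : v *m l d = 0 -> v = 0.
  by rewrite lE; apply: (generic_form_frac_inj cX soc).
have lY i d : Y i d *m l d.+1 = l d *m Y i d.+1.
  rewrite mulmx_sumr mulmx_suml; apply: eq_bigr => j _.
  by rewrite -scalemxAl -scalemxAr cY.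
(* Written in the first r + 1 operators, l is the sum of the e_j x_j. The coefficient of u^r in
   [e r] is c r r = 1, so [e r] is invertible and x_r can be eliminated modulo l. *)
pose e j := \sum_(i < r0) u ^+ i * b i j.
have er0 : e r != 0.
  have -> : e r = tof (\sum_(i < r0) 'X^i * (c i r)%:P).
    rewrite rmorph_sum; apply: eq_bigr => i _.
    by rewrite rmorphM rmorphXn.
  rewrite /tof tofrac_eq0; apply/eqP => /(congr1 (fun p : {poly F} => p`_r)).
  rewrite coef_sum coef0 (bigD1 (Ordinal r_lt)) //= big1 => [|i ir].
    by rewrite addr0 coefXnM ltnn subnn coefC /= cE // eqxx => /eqP; rewrite oner_eq0.
  rewrite coefXnM; case: ltnP => // ri; rewrite coefC.
  by move: ir; rewrite -val_eqE subn_eq0 leqNgt ltn_neqAle ri andbT => /= ->.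
clearbody Y u b; clear XE cX gX rX soc X cE c phi lE.
pose W d : 'M[F']_(h d) := match d return 'M[F']_(h d) with 0 => 0 | d'.+1 => <<l d'>>%MS end.
have WY i d : (W d *m Y i d <= W d.+1)%MS.
  case: d => [|d] /=; first by rewrite mul0mx sub0mx.
  by rewrite genmxE (eqmxMr _ (genmxE _)) -lY submxMl.
have [h' [Z [P [YP P0 hE]]]] := quotient_exists WY.
have [Pf PE] := YP; have lift := quotient_lift YP.
have lP d : l d *m P d.+1 = 0.
  by apply/eqP; rewrite P0 /= genmxE.
have ZE i d : Z i d = \sum_(j < r.+1) b i j *: Z j d.
  apply: (row_full_inj (Pf d)); rewrite /= -PE YE mulmx_suml mulmx_sumr.
  by apply: eq_bigr => j _; rewrite -scalemxAl -scalemxAr PE.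
have Zr d : Z r d = \sum_(j < r) (- (e j / e r)) *: Z j d.
  have : \sum_(j < r.+1) e j *: Z j d = 0.
    apply: (row_full_inj (Pf d)); rewrite /= mulmx0 -[RHS](lP d) mulmx_suml mulmx_sumr.
    transitivity (\sum_(j < r.+1) \sum_(i < r0) (u ^+ i * b i j) *: (P d *m Z j d)).
      by apply: eq_bigr => j _; rewrite -scalemxAr scaler_suml.
    rewrite exchange_big /=; apply: eq_bigr => i _.
    rewrite -scalemxAl PE ZE mulmx_sumr scaler_sumr; apply: eq_bigr => j _.
    by rewrite -scalemxAr scalerA.
  rewrite big_ord_recr /= => /eqP; rewrite addrC addr_eq0 => /eqP E.
  apply: (scalerI er0); rewrite E scaler_sumr -sumrN; apply: eq_bigr => j _.
  by rewrite scalerA mulrN mulrCA divff // mulr1 scaleNr.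
exists F', h', Z; split.
- exact: quotient_comm YP cY.
- move=> d k v; have [w ->] := quotient_gen YP gY v.
  exists (fun j => w j + (- (e j / e r)) *: w r).
  rewrite big_ord_recr /= Zr mulmx_sumr -big_split /=; apply: eq_bigr => j _.
  by rewrite mulmxDl -scalemxAl scalemxAr.
- exists (fun i j => b i j + b i r * (- (e j / e r))) => [i j ir jr|i d].
    rewrite (bE i r (leqW ir) (ltnSn r)) (bE i j (leqW ir) (leqW jr)).
    by rewrite (ltn_eqF ir) mul0r addr0.
  rewrite ZE big_ord_recr /= Zr scaler_sumr -big_split /=; apply: eq_bigr => j _.
  by rewrite scalerA scalerDl.
- move=> d p f md kf0; set f1 := f *m pinvmx (P d.+1).
  have kP q d' (x : 'M_(krank r0 q.+1, h d')) : kd (Y^~ d') x *m P d'.+1 = kd (Z^~ d') (x *m P d').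
    by apply: kd_nat => i _; apply: PE.
  have kl q d' (x : 'M_(krank r0 q.+1, h d')) : kd (Y^~ d') x *m l d'.+1 = kd (Y^~ d'.+1) (x *m l
    d').
    by apply: kd_nat => i _; apply: lY.
  (* The boundary of the lift [f1] is a multiple g l. As l is injective, g is a cycle and hence a
     boundary of some w; in homological degree 0 it is one because the operators generate all
     positive degrees. Then [f1 - w *m l d] is a cycle that still lifts f. *)
  have [g kf1] : exists g, kd (Y^~ d.+1) f1 = g *m l d.+1.
    apply/submxP; have : (kd (Y^~ d.+1) f1 <= W d.+2)%MS by rewrite -P0 kP lift kf0.
    by rewrite /= genmxE.
  have [w gw] : exists w, g = kd (Y^~ d) w.
    case: p f kf0 f1 g kf1 => [|p] f kf0 f1 g kf1.
      have [v ->] := ops_gen_le r_lt gY g.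
      by have [w <-] := koszul_gen_aug Y v; exists w.
    apply: rY md _; apply: (linj); rewrite kl -kf1; apply: kdkd => i j; exact: cY.
  have : kd (Y^~ d.+1) (f1 - w *m l d) = 0 by rewrite kdB -kl -gw kf1 subrr.
  move=> /(rY _ _ _ md)[t tE]; exists (t *m P d).
  by rewrite -kP -tE mulmxBl -(mulmxA w) lP mulmx0 subr0 lift.
- split=> [|d]; first by have := hE 0%N; rewrite mxrank0 addn0.
  rewrite -(hE d.+1) /= genmxE; congr (_ + _)%N; symmetry; apply/eqP.
  change (row_free (l d)); rewrite -kermx_eq0; apply/eqP/(linj d); exact: mulmx_ker.
Qed.

(** * Inequalities for regular modules *)

(** For r = n + 1 the last bound is the inequality of the theorem with nabla^(k+1) q(m) expanded as
    nabla^k q(m) - nabla^k q(m - 1). It is the growth bound from m - 1 to m for the k-th difference,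
    and it keeps its shape when q is replaced by [nabla q] and r by r - 1. *)
Definition hilbert_poly_bounds (r m : nat) (h : nat -> nat) := exists q : {poly rat},
  [/\ (size q <= r)%N, forall j, (m < j)%N -> q.[j%:R] = (h j)%:R,
      q.[m%:R] <= (h m)%:R &
      forall k, (k < r)%N -> m%:R * (iter k nabla q).[m%:R] <=
         (r.-1 + m - k)%N%:R * (iter k nabla q).[m%:R - 1]].

Lemma regular_hilbert_poly m r0 r (F : fieldType) h (X : ops F h) :
  (0 < r0)%N -> (r <= r0)%N -> ops_comm X -> ops_gen r X -> ops_span r X ->
  ops_reg m r0 X -> hilbert_poly_bounds r m h.
Proof.
move=> r0_gt0; elim: r F h X => [|r IH] F h X rr0 cX gX sX rX.
  have h0 j : h j.+1 = 0%N.
    case E : (h j.+1) => [//|k]; have [u] := gX j _ 1%:M.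
    by rewrite big_ord0 => /eqP; rewrite -mxrank_eq0 mxrank1 E.
  exists 0; split; rewrite ?size_poly0 ?horner0 ?ler0n // => -[//|j] _.
  by rewrite horner0 h0.
have [h1 [X1 [cX1 gX1 sX1 rX1 [soc h1E h1le]]]] := torsion_quotient r0_gt0 rX rr0 cX gX sX.
have [F' [h2 [X2 [cX2 gX2 sX2 rX2 [h20 h2S]]]]] := hyperplane_section rr0 cX1 gX1 sX1 rX1 soc.
have [q2 [sq2 q2E q2m q2n]] := IH _ _ _ (ltnW rr0) cX2 gX2 sX2 rX2.
have [q1 sq1 q1E] := antidifference sq2.
(* The constant of integration makes q agree at m with the torsion-free quotient; h may be larger
   there, whence the inequality at m. *)
pose q := q1 + ((h1 m)%:R - q1.[m%:R])%:P.
have nq : nabla q = q2 by rewrite nablaD nablaC addr0.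
have qm : q.[m%:R] = (h1 m)%:R by rewrite /q hornerD hornerC addrC subrK.
have qE j : q.[(m + j)%N%:R] = (h1 (m + j)%N)%:R.
  elim: j => [|j IHj]; first by rewrite addn0.
  have := nablaE q (m + j.+1)%N%:R; rewrite nq q2E; last by rewrite addnS ltnS leq_addr.
  rewrite addnS -(h2S (m + j)%N) !natrD -[(m + j).+1]addn1 natrD addrK -natrD IHj => ->.
  by rewrite subrK.
exists q; split.
- rewrite (leq_trans (size_polyD _ _)) // geq_max sq1 size_polyC.
  by case: (_ != 0).
- by move=> j mj; rewrite -(subnKC (ltnW mj)) qE subnKC ?(ltnW mj) // h1E.
- by rewrite qm ler_nat.
- case=> [_|k kr] /=; last first.
    rewrite -iterS iterSr nq; have := q2n k kr; congr (_ <= _%:R * _); lia.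
  (* From q2(m) <= h2(m) = h1(m) - h1(m - 1) it follows that q(m - 1) >= h1(m - 1), so that the
     growth bound for h1 from m - 1 to m suffices. For m = 0 only q(-1) >= 0 is at stake. *)
  have qm1 : q.[m%:R - 1] = q.[m%:R] - q2.[m%:R] by rewrite -nq nablaE; ring.
  rewrite qm1 qm subn0; case: m q2m @q qm {qE qm1 nq rX rX1 rX2 IH q2n q2E h1E} => [|m] q2m q qm.
    rewrite mul0r addn0 mulr_ge0 ?ler0n // subr_ge0 -h20 //.
  have := growth cX1 gX1 m; rewrite -(ler_nat rat) !natrM => G.
  apply: le_trans G _; rewrite addSnnS ler_wpM2l ?ler0n // -(h2S m) natrD.
  by rewrite lerBrDr addrC lerD2r.
Qed.

(** * Homogeneous components and coordinates of graded modules *)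

Section Homogeneous.
Variables (K : fieldType) (n : nat).
Local Notation S := {mpoly K[n]}.

Lemma pihomogM_homog e k (p f : S) : f \is e.-homog ->
  pihomog mdeg k (p * f) = if (e <= k)%N then pihomog mdeg (k - e) p * f else 0.
Proof.
move=> fh; have pE := pihomog_partitionE (leqnn (msize p)).
have H j : pihomog mdeg k (pihomog mdeg j p * f) = if (j + e == k)%N then pihomog mdeg j p * f
  else 0.
  have jh : pihomog mdeg j p * f \is (j + e).-homog by apply: dhomogM (pihomogP _ _ _) fh.
  by case: eqP => [<-|/eqP ne]; [rewrite pihomog_dE | rewrite (pihomog_ne0 ne)].
have E q : pihomog mdeg q p = \sum_(j < msize p) if (j == q :> nat) then pihomog mdeg j p else 0.
  rewrite {1}pE linear_sum; apply: eq_bigr => j _ /=.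
  case: eqP => [<-|/eqP ne]; first by rewrite pihomog_id.
  by rewrite (pihomog_ne0 ne) ?pihomogP.
rewrite {1}pE mulr_suml linear_sum /=; under eq_bigr => j _ do rewrite H.
case: leqP => ek; last first.
  by rewrite big1 // => j _; case: eqP => // jk; move: ek; rewrite -jk ltnNge leq_addl.
rewrite [in RHS]E mulr_suml; apply: eq_bigr => j _.
by rewrite -{1}(subnK ek) eqn_add2r; case: eqP => _; rewrite ?mul0r.
Qed.

Lemma xvar_homog i : xvar K n i \is 1.-homog.
Proof.
rewrite /xvar; case: insubP => [j _ _|_]; last exact: dhomog0.
by rewrite dhomogX /= mdeg1.
Qed.

Lemma pihomog_mulX i k (p : S) :
  pihomog mdeg k.+1 (p * xvar K n i) = pihomog mdeg k p * xvar K n i.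
Proof. by rewrite (pihomogM_homog _ _ (xvar_homog i)) /= subn1. Qed.

Lemma homog_split d (p : S) : p \is d.+1.-homog ->
  exists c : nat -> S, (forall i, c i \is d.-homog) /\ p = \sum_(i < n) c i * xvar K n i.
Proof.
move=> ph; have : kill n p = 0.
  by rewrite kill_all (dhomog_nemf_coeff ph) ?mpolyC0 //= mdeg0.
move=> /kill_eq0P[c pE]; exists (fun i => pihomog mdeg d (c i)); split=> [i|].
  exact: pihomogP.
rewrite -[LHS](pihomog_dE ph) pE linear_sum /=.
by apply: eq_bigr => i _; rewrite pihomog_mulX.
Qed.
End Homogeneous.

Section GradedModule.
Variables (K : fieldType) (n : nat) (M : gradedModule K n).
Local Notation S := {mpoly K[n.+1]}.

Lemma gm_pieceN d (u : M) : gm_piece d u -> gm_piece d (- u).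
Proof.
move=> ud; rewrite -scaleN1r -[d]add0n; apply: gm_pieceZ ud.
by rewrite -mpolyC1 -mpolyCN -alg_mpolyC rpredZ // dhomog1.
Qed.

Lemma gm_pieceC d c (u : M) : gm_piece d u -> gm_piece d (c%:MP *: u).
Proof.
move=> ud; rewrite -[d]add0n; apply: gm_pieceZ ud.
by rewrite -alg_mpolyC rpredZ // dhomog1.
Qed.

Lemma gm_piece_sum d (I : Type) (r : seq I) (P : pred I) (F : I -> M) :
  (forall i, P i -> gm_piece d (F i)) -> gm_piece d (\sum_(i <- r | P i) F i).
Proof. by move=> H; elim/big_rec: _ => [|i x Pi xd]; [apply: gm_piece0 | apply: gm_pieceD => //;
  apply: H]. Qed.

Lemma gm_pieceX i d (u : M) : gm_piece d u -> gm_piece d.+1 (xvar K n.+1 i *: u).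
Proof. exact: gm_pieceZ (xvar_homog _ _ _). Qed.

Lemma gm_piece_comb r (e : 'I_r -> nat) (g : 'I_r -> M) (p : 'I_r -> S) d :
  (forall i, gm_piece (e i) (g i)) ->
  (forall i, (e i <= d)%N -> p i \is (d - e i).-homog) ->
  (forall i, (d < e i)%N -> p i = 0) -> gm_piece d (\sum_i p i *: g i).
Proof.
move=> ge ph p0; apply: gm_piece_sum => i _.
have [ed|de] := leqP (e i) d; last by rewrite p0 // scale0r; apply: gm_piece0.
by rewrite -(subnK ed); apply: gm_pieceZ (ge i); apply: ph.
Qed.

(** The components of the combination, with u subtracted in degree d, are homogeneous elements of
    distinct degrees with sum zero, so they vanish by [gm_direct]. Thus coefficients of homogeneous
    elements may be taken homogeneous. *)
Lemma homog_component r (e : 'I_r -> nat) (g : 'I_r -> M) (p : 'I_r -> S) d :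
  (forall i, gm_piece (e i) (g i)) -> gm_piece d (\sum_i p i *: g i) ->
  \sum_i p i *: g i =
  \sum_i (if (e i <= d)%N then pihomog mdeg (d - e i) (p i) else 0) *: g i.
Proof.
move=> ge; set u := \sum_i _ => ud.
pose c k i := if (e i <= k)%N then pihomog mdeg (k - e i) (p i) else 0.
pose v k := \sum_i c k i *: g i - (if k == d then u else 0).
have vk k : gm_piece k (v k).
  apply: gm_pieceD; last first.
    by apply: gm_pieceN; case: eqP => [->//|_]; apply: gm_piece0.
  apply: (@gm_piece_comb _ e) => // i; rewrite /c; first by move=> ->; apply: pihomogP.
  by rewrite ltnNge => /negPf ->.
pose N := (d.+1 + \max_i (e i + msize (p i)))%N.
have Ni i : (e i + msize (p i) <= N)%N.
  by rewrite /N (leq_trans _ (leq_addl _ _)) // (leq_bigmax (F := fun i => e i + msize (p i))%N).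
have dN : (d < N)%N by rewrite /N leq_addr.
have /(gm_direct vk)/(_ d dN)/eqP : \sum_(k < N) v k = 0.
  rewrite sumrB exchange_big /= (_ : \sum_(k < N) (if k == d :> nat then u else 0) = u); last first.
    rewrite (bigD1 (Ordinal dN)) //= eqxx big1 ?addr0 // => k ne.
    by case: eqP => // kd; case/eqP: ne; apply: val_inj.
  rewrite /u -sumrB big1 // => i _; rewrite -scaler_suml.
  suff -> : \sum_(k < N) c k i = p i by rewrite subrr.
  have eN : (e i <= N)%N by apply: leq_trans (leq_addr _ _) (Ni i).
  rewrite -(big_mkord xpredT (fun k => c k i)) (big_cat_nat (n := e i)) //=.
  rewrite big_nat big1 ?add0r => [|k /andP[_ ke]]; last by rewrite /c leqNgt ke.
  rewrite -{1}[e i]add0n big_addn big_mkord [RHS](@pihomog_partitionE _ _ mdeg (N - e i)).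
    by apply: eq_bigr => k _; rewrite /c leq_addl addnK.
  by rewrite leq_subRL // Ni.
by rewrite /v eqxx subr_eq0 => /eqP.
Qed.
End GradedModule.

Section Coordinates.
Variables (K : fieldType) (n : nat) (M : gradedModule K n) (h : nat -> nat).
Hypothesis Hh : hilbert_function M h.
Local Notation S := {mpoly K[n.+1]}.

Definition hbasis d : 'I_(h d) -> M := sval (cid (Hh d)).

Definition from_coord d (c : 'rV[K]_(h d)) : M := \sum_i (c 0 i)%:MP *: hbasis i.

Lemma from_coord_piece d c : gm_piece d (from_coord (d := d) c).
Proof.
apply: gm_piece_sum => i _; apply: gm_pieceC.
exact: (svalP (cid (Hh d))).1.
Qed.

Lemma from_coord_surj d u : gm_piece d u -> exists c, u = from_coord (d := d) c.
Proof. by move=> ud; case: (svalP (cid (Hh d))) => _ /(_ u ud)[c [cE _]]; exists c. Qed.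

Lemma from_coord_inj d : injective (@from_coord d).
Proof.
move=> c c' cc'; case: (svalP (cid (Hh d))) => _ /(_ _ (from_coord_piece c))[x [_ xU]].
by rewrite -(xU c) // -(xU c').
Qed.

Lemma from_coordD d (c c' : 'rV_(h d)) : from_coord (c + c') = from_coord c + from_coord c'.
Proof.
rewrite -big_split /=; apply: eq_bigr => i _.
by rewrite mxE mpolyCD scalerDl.
Qed.

Lemma from_coordN d (c : 'rV_(h d)) : from_coord (- c) = - from_coord c.
Proof.
rewrite -sumrN; apply: eq_bigr => i _.
by rewrite mxE mpolyCN scaleNr.
Qed.

Lemma from_coord0 d : from_coord (0 : 'rV_(h d)) = 0.
Proof. by apply: (addrI (from_coord (0 : 'rV_(h d)))); rewrite -from_coordD !addr0. Qed.

Lemma from_coordZ d a (c : 'rV_(h d)) : from_coord (a *: c) = a%:MP *: from_coord c.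
Proof.
rewrite scaler_sumr; apply: eq_bigr => i _.
by rewrite mxE mpolyCM scalerA.
Qed.

Lemma from_coord_sum d I (r : seq I) (F : I -> 'rV_(h d)) :
  from_coord (\sum_(i <- r) F i) = \sum_(i <- r) from_coord (F i).
Proof. by elim/big_rec2: _ => [|i x y _ <-]; rewrite ?from_coord0 ?from_coordD. Qed.

Definition to_coord d (u : M) : 'rV[K]_(h d) := xget 0 [set c | u = from_coord c].

Lemma to_coordK d u : gm_piece d u -> from_coord (to_coord d u) = u.
Proof.
move=> /from_coord_surj[c uc]; rewrite /to_coord; case: xgetP => [x _ <- //|/(_ c)].
by case.
Qed.

Definition mod_ops : ops K h := fun i d =>
  \matrix_k to_coord d.+1 (xvar K n.+1 i *: hbasis k).

Lemma from_coord_ops i d (c : 'rV_(h d)) :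
  from_coord (c *m mod_ops i d) = xvar K n.+1 i *: from_coord c.
Proof.
rewrite mulmx_sum_row from_coord_sum scaler_sumr; apply: eq_bigr => k _.
rewrite from_coordZ rowK to_coordK ?scalerA 1?mulrC //.
by apply: gm_pieceX; exact: (svalP (cid (Hh d))).1.
Qed.

Lemma mod_ops_comm : ops_comm mod_ops.
Proof.
move=> i j d; apply/row_matrixP => k; apply: from_coord_inj.
by rewrite !rowE !mulmxA !from_coord_ops !scalerA [xvar _ _ j * _]mulrC.
Qed.

Lemma mod_ops_gen : generated_in_degree_zero M -> ops_gen n.+1 mod_ops.
Proof.
move=> gM d k v.
have H (w : 'rV_(h d.+1)) : exists u : nat -> 'rV_(h d), w = \sum_(i < n.+1) u i *m mod_ops i d.
  have [r [g [p [g0 uE]]]] := gM (from_coord w).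
  have ud : gm_piece d.+1 (\sum_i p i *: g i) by rewrite -uE; apply: from_coord_piece.
  have := homog_component (e := fun=> 0%N) g0 ud; rewrite -uE /= => wE.
  have Hc i := homog_split (pihomogP mdeg d.+1 (p i)).
  pose c i := sval (cid (Hc i)).
  have [cd cE] : (forall i l, c i l \is d.-homog) /\
      forall i, pihomog mdeg d.+1 (p i) = \sum_(l < n.+1) c i l * xvar K n.+1 l.
    by split=> i; have [] := svalP (cid (Hc i)).
  exists (fun l => to_coord d (\sum_i c i l *: g i)); apply: from_coord_inj.
  rewrite from_coord_sum wE.
  transitivity (\sum_i \sum_(l < n.+1) xvar K n.+1 l *: (c i l *: g i)).
    apply: eq_bigr => i _; rewrite subn0 cE scaler_suml; apply: eq_bigr => l _.
    by rewrite scalerA mulrC.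
  rewrite exchange_big /=; apply: eq_bigr => l _.
  rewrite from_coord_ops to_coordK ?scaler_sumr //.
  by apply: (gm_piece_comb (e := fun=> 0%N)) => // i; rewrite subn0.
pose u A := sval (cid (H (row A v))).
exists (fun i => \matrix_A u A i); apply/row_matrixP => A.
rewrite {1}(svalP (cid (H (row A v)))) -/(u A) linear_sum /=; apply: eq_bigr => i _.
by rewrite row_mul rowK.
Qed.

Lemma mod_ops_span : ops_span n.+1 mod_ops.
Proof.
exists (fun i j => (i == j)%:R) => // i d.
have [ir|ri] := ltnP i n.+1.
  rewrite (bigD1 (Ordinal ir)) //= eqxx scale1r big1 ?addr0 // => j ji.
  rewrite (negPf (_ : i != j)) ?scale0r //.
  by apply: contraNneq ji => ij; apply/eqP/val_inj.
rewrite big1 => [|j _]; last by rewrite gtn_eqF ?scale0r // (leq_trans (ltn_ord j)).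
apply/row_matrixP => k; apply: from_coord_inj.
rewrite rowE from_coord_ops row0 from_coord0 /xvar insubF ?scale0r //.
by rewrite ltnNge ri.
Qed.

Lemma mod_growth : generated_in_degree_zero M ->
  forall j, (j.+1 * h j.+1 <= (n.+1 + j) * h j)%N.
Proof. by move=> gM; apply: growth mod_ops_comm (mod_ops_gen gM). Qed.

Section Resolution.
Variables (m : nat) (F : freeSeq K n).
Hypothesis F_deg : degree_preserving F.

(** The component of degree d in the graded free module F_i; cutting chains down to components keeps
    control of the degrees in the chase below. *)
Definition hpart i d (z : 'rV[S]_(fs_rank F i)) : 'rV[S]_(fs_rank F i) :=
  \row_b if (fs_deg F i b <= d)%N then pihomog mdeg (d - fs_deg F i b) (z 0 b) else 0.

Lemma hpart_id i d z : hpart (i := i) d (hpart d z) = hpart d z.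
Proof. by apply/rowP => b; rewrite !mxE; case: leqP => // _; rewrite pihomog_id. Qed.

Lemma hpartD i d u v : hpart (i := i) d (u + v) = hpart d u + hpart d v.
Proof. by apply/rowP => b; rewrite !mxE; case: leqP => // _; rewrite ?linearD ?addr0. Qed.

Lemma hpartN i d u : hpart (i := i) d (- u) = - hpart d u.
Proof. by apply/rowP => b; rewrite !mxE; case: leqP => // _; rewrite ?linearN ?oppr0. Qed.

Lemma hpart0 i d : hpart (i := i) d 0 = 0.
Proof. by apply/rowP => b; rewrite !mxE linear0 if_same. Qed.

Lemma hpart_map i d z : hpart d (z *m fs_map F i) = hpart d z *m fs_map F i.
Proof.
apply/rowP => b; rewrite !mxE; have [bd|db] := leqP (fs_deg F i b) d; last first.
  rewrite big1 // => a _; rewrite mxE; case: leqP => ad; last by rewrite mul0r.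
  by rewrite (F_deg a b).2 ?mulr0 // (leq_ltn_trans ad).
rewrite linear_sum; apply: eq_bigr => a _ /=; rewrite mxE.
have [ba|ab] := leqP (fs_deg F i b) (fs_deg F i.+1 a); last first.
  by rewrite (F_deg a b).2 // !mulr0 linear0.
rewrite (pihomogM_homog _ _ ((F_deg a b).1 ba)) leq_sub2rE //.
by case: leqP => ad; rewrite ?mul0r //; congr (pihomog _ _ _ * _); lia.
Qed.

Lemma hpart_xmul i d j z :
  hpart d.+1 (z *m xmul K n.+1 (fs_rank F i) j) =
  hpart d z *m xmul K n.+1 (fs_rank F i) j.
Proof.
rewrite /xmul !mul_mx_scalar; apply/rowP => b; rewrite !mxE ![xvar _ _ _ * _]mulrC.
have [bd|db] := leqP (fs_deg F i b) d.
  by rewrite leqW // subSn // pihomog_mulX.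
rewrite mul0r; case: leqP => // bd; have -> : fs_deg F i b = d.+1 by lia.
rewrite subnn (pihomogM_homog _ _ (xvar_homog _ _ _)) //.
Qed.

Lemma hpart_kd i d r p (z : 'M[S]_(krank r p.+1, fs_rank F i)) :
  (forall A, hpart d (row A z) = row A z) ->
  forall A, hpart d.+1 (row A (kd (xmul K n.+1 _) z)) = row A (kd (xmul K n.+1 _) z).
Proof.
move=> zd A.
apply: (@kd_rel _ _ _ _ _ _ (xmul K n.+1 _) (xmul K n.+1 (fs_rank F i)) (fun u _ => hpart d u = u)
  (fun u _ => hpart d.+1 u = u) r p z z) => //; first exact: hpart0.
- by move=> u v u' v' uE vE; rewrite hpartD uE vE.
- by move=> u v uE; rewrite hpartN uE.
- by move=> j _ u v uE; rewrite hpart_xmul uE.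
Qed.

Definition hpartM i d a (z : 'M[S]_(a, fs_rank F i)) := \matrix_A hpart d (row A z).

Lemma hpartM_row i d a (z : 'M[S]_(a, fs_rank F i)) A :
  hpart d (row A (hpartM d z)) = row A (hpartM d z).
Proof. by rewrite rowK hpart_id. Qed.

Lemma hpartM_idP i d a (z : 'M[S]_(a, fs_rank F i)) :
  (forall A, hpart d (row A z) = row A z) -> hpartM d z = z.
Proof. by move=> zE; apply/row_matrixP => A; rewrite rowK. Qed.

Lemma hpartM_map i d a (z : 'M[S]_(a, fs_rank F i.+1)) :
  hpartM d (z *m fs_map F i) = hpartM d z *m fs_map F i.
Proof. by apply/row_matrixP => A; rewrite row_mul !rowK row_mul hpart_map. Qed.

Lemma hpartM_kd i d r p (z : 'M[S]_(krank r p.+1, fs_rank F i)) :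
  hpartM d.+1 (kd (xmul K n.+1 _) z) = kd (xmul K n.+1 _) (hpartM d z).
Proof.
apply/row_matrixP => A; rewrite rowK; symmetry.
apply: (@kd_rel _ _ _ _ _ _ (xmul K n.+1 _) (xmul K n.+1 (fs_rank F i)) (fun u v => u = hpart d v)
  (fun u v => u = hpart d.+1 v) r p) => //; first by rewrite hpart0.
- by move=> u v u' v' -> ->; rewrite hpartD.
- by move=> u v ->; rewrite hpartN.
- by move=> j _ u v ->; rewrite hpart_xmul.
- by move=> B; rewrite rowK.
Qed.
End Resolution.
End Coordinates.

(** * From Betti numbers to Koszul homology *)

Section BettiRegularity.
Variables (K : fieldType) (n : nat) (M : gradedModule K n) (m : nat) (F : freeSeq K n).
Local Notation S := {mpoly K[n.+1]}.
Local Notation kx := (kd (xmul K n.+1 _)).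
Hypothesis F_deg : degree_preserving F.
Hypothesis F_betti : forall i j, betti F i j != 0%N -> (j <= i + m)%N.
Hypothesis F_exact : forall i (p : 'rV_(fs_rank F i.+1)),
  p *m fs_map F i = 0 <-> exists q, p = q *m fs_map F i.+1.

Lemma fs_map_exact i a (z : 'M_(a, fs_rank F i.+1)) : z *m fs_map F i = 0 ->
  exists w, z = w *m fs_map F i.+1.
Proof.
move=> z0; have H A : exists q, row A z = q *m fs_map F i.+1.
  by apply/F_exact; rewrite -row_mul z0 row0.
exists (\matrix_A sval (cid (H A))); apply/row_matrixP => A.
by rewrite row_mul rowK -(svalP (cid (H A))).
Qed.

Lemma fs_map_comp i : fs_map F i.+1 *m fs_map F i = 0.
Proof.
apply/row_matrixP => A; rewrite row_mul row0; apply/F_exact.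
by exists (delta_mx 0 A); rewrite -rowE.
Qed.

Local Notation const0 := (mcoeff (0%MM : 'X_{1..n.+1})).

Lemma fs_map_const i a b : fs_deg F i.+1 a != fs_deg F i b ->
  const0 (fs_map F i a b) = 0.
Proof.
move=> ne; have [ba|ab] := leqP (fs_deg F i b) (fs_deg F i.+1 a).
  apply: (dhomog_nemf_coeff ((F_deg a b).1 ba)).
  by rewrite /= mdeg0 eq_sym subn_eq0 -ltnNge ltn_neqAle eq_sym ne.
by rewrite (F_deg a b).2 // mcoeff0.
Qed.

(** A nonzero constant entry of a degree-preserving map joins basis vectors of equal degree, so the
    projection on the target changes nothing. *)
Lemma strandE i j : strand_space F i.+1 j *m map_mx const0 (fs_map F i) =
  strand_map F i j.
Proof.
rewrite /strand_map -mulmxA mul_diag_mx mul_mx_diag mul_diag_mx.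
apply/matrixP => a b; rewrite !mxE; case: eqP => [<-|_]; last by rewrite !mul0r.
by case: eqP => [|/eqP ne]; rewrite ?mulr1 // fs_map_const 1?eq_sym ?mul0r ?mulr0.
Qed.

(** Above degree i + 1 + m the Betti number is zero, and boundaries of the strand, having the same
    rank as the cycles that contain them, are all of them. *)
Lemma strand_exact i j (c : 'rV_(fs_rank F i.+1)) :
  (i.+1 + m < j)%N -> c = c *m strand_space F i.+1 j ->
  c *m strand_map F i j = 0 -> exists w, c = w *m map_mx const0 (fs_map F i.+1).
Proof.
move=> ij cE c0; have : (c <= strand_cycles F i.+1 j)%MS.
  by rewrite sub_capmx {1}cE submxMl; apply/sub_kermxP.
have le1 : (strand_map F i.+1 j <= strand_cycles F i.+1 j)%MS.
  rewrite sub_capmx submxMl; apply/sub_kermxP.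
  have SS : strand_space F i.+1 j *m strand_space F i.+1 j = strand_space F i.+1 j.
    rewrite mulmx_diag; congr diag_mx; apply/rowP => a; rewrite !mxE.
    by case: eqP => _; rewrite ?mulr1 ?mulr0.
  rewrite -(strandE i) {1}/strand_map -mulmxA (mulmxA _ _ (map_mx _ _)) SS mulmxA.
  rewrite -/(strand_map F i.+1 j) -strandE -mulmxA -map_mxM fs_map_comp.
  by rewrite map_mx0 mulmx0.
have b0 : betti F i.+1 j = 0%N.
  by apply/eqP/negPn/negP => /F_betti; rewrite leqNgt ij.
have le2 : (strand_cycles F i.+1 j <= strand_map F i.+1 j)%MS.
  have := mxrank_leqif_sup le1; rewrite /leqif => -[le_r <-].
  by rewrite eqn_leq le_r; move/eqP: b0; rewrite /betti subn_eq0.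
move=> /submx_trans/(_ le2)/submxP[w ->]; rewrite -strandE.
by exists (w *m strand_space F i.+2 j); rewrite mulmxA.
Qed.

Local Notation homogM i d z := (forall A, hpart (F := F) (i := i) d (row A z) = row A z).

(** The constant terms of z form a cycle of F (x) K in a degree where the Betti number vanishes; the
    vector w that bounds it is lifted to constant polynomials. *)
Lemma chase0 i d a (z : 'M[S]_(a, fs_rank F i.+1)) :
  (i.+1 + m < d)%N -> homogM i.+1 d z -> killmx n.+1 (z *m fs_map F i) ->
  exists w, killmx n.+1 (z - w *m fs_map F i.+1).
Proof.
move=> id zd kz.
have H A : exists w : 'rV[K]_(fs_rank F i.+2),
    map_mx const0 (row A z) = w *m map_mx const0 (fs_map F i.+1).
  apply: (@strand_exact i d) => //.
    rewrite mul_mx_diag; apply/rowP => b; rewrite !mxE.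
    case: eqP => [_|/eqP ne]; first by rewrite mulr1.
    rewrite mulr0; have := congr1 (fun M : 'rV[S]_(fs_rank F i.+1) => M 0 b) (zd A);
      rewrite !mxE => <-.
    case: leqP => bd; last by rewrite mcoeff0.
    apply: (dhomog_nemf_coeff (pihomogP mdeg _ _)).
    by rewrite /= mdeg0 eq_sym subn_eq0 -ltnNge ltn_neqAle ne.
  rewrite /strand_map !mulmxA; set s := strand_space _ _ _.
  have -> : map_mx const0 (row A z) *m s *m map_mx const0 (fs_map F i) *m strand_space F i d =
     map_mx const0 (row A z) *m map_mx const0 (fs_map F i) *m strand_space F i d.
    apply/rowP => b; rewrite !mul_mx_diag !mxE; case: eqP => [bd|_]; last by rewrite !mulr0.
    rewrite !mulr1; apply: eq_bigr => k _; rewrite !mxE.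
    case: eqP => [_|/eqP kd']; first by rewrite mulr1.
    by rewrite fs_map_const ?mulr0 // bd.
  rewrite -map_mxM -row_mul (_ : map_mx const0 _ = 0) ?mul0mx //.
  apply/rowP => b; rewrite !mxE; have := kz A b; rewrite kill_all mxE => /eqP.
  by rewrite mpolyC_eq0 => /eqP.
exists (\matrix_A map_mx (@mpolyC n.+1 K) (sval (cid (H A)))) => A b.
rewrite kill_all; apply/eqP; rewrite mpolyC_eq0; apply/eqP.
have := congr1 (fun M : 'rV[K]_(fs_rank F i.+1) => M 0 b) (svalP (cid (H A))).
rewrite !mxE mcoeffB => ->; apply/eqP; rewrite subr_eq0; apply/eqP.
rewrite raddf_sum; apply: eq_bigr => k _ /=; rewrite !mxE.
by rewrite rmorphM /= mpolyCK.
Qed.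

Lemma koszul0 i d (z : 'M[S]_(krank n.+1 0, fs_rank F i.+1)) :
  (i.+1 + m < d)%N -> homogM i.+1 d z ->
  (exists y : 'M_(krank n.+1 1, fs_rank F i), z *m fs_map F i = kx y) ->
  exists v w, z = kx v + w *m fs_map F i.+1.
Proof.
move=> id zd [y zy]; have [|w Hw] := chase0 id zd; first by rewrite zy; apply: koszul_aug_im.
by have [v vE] := koszul_aug Hw; exists v, w; rewrite -vE subrK.
Qed.

Lemma kx_map i p (z : 'M[S]_(krank n.+1 p.+1, fs_rank F i.+1)) :
  kx z *m fs_map F i = kx (z *m fs_map F i).
Proof. by apply: kd_nat => j _; rewrite /xmul scalar_mxC. Qed.

Lemma kxkx g p (z : 'M[S]_(krank n.+1 p.+2, g)) : kx (kx z) = 0.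
Proof. by apply: kdkd => i j; rewrite /xmul scalar_mxC. Qed.

(** Each step trades one Koszul degree for one step up the resolution. The internal degree grows by
    one as well, so the bound [i.+1 + m < d] is kept until Koszul degree 0, where [koszul0] applies.
    Exactness of the Koszul complex of the variables carries the correction back. *)
Lemma koszulS p i d (z : 'M[S]_(krank n.+1 p.+1, fs_rank F i.+1)) :
  (i.+1 + m < d)%N -> homogM i.+1 d z ->
  (exists w, kx z = w *m fs_map F i.+1) ->
  exists v w, z = kx v + w *m fs_map F i.+1.
Proof.
elim: p i d z => [|p IH] i d z id zd [w0 zw0].
all: set w := hpartM d.+1 w0.
all: have zw : kx z = w *m fs_map F i.+1 by
  rewrite -hpartM_map // -zw0 hpartM_idP //; apply: hpart_kd.
all: have wd : homogM i.+2 d.+1 w by apply: hpartM_row.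
all: suff [v [t wE]] : exists v t, w = kx v + t *m fs_map F i.+2.
1,3: have [|x xE] := @koszul_exact K n.+1 n.+1 _ _ (z - v *m fs_map F i.+1) (leqnn _).
1,3: by rewrite kdB zw wE mulmxDl -mulmxA fs_map_comp mulmx0 addr0 kx_map subrr.
1,2: by exists x, v; rewrite -xE subrK.
- by apply: koszul0 (wd) _; [lia | exists z].
- apply: IH wd _; first by lia.
  by apply: fs_map_exact; rewrite kx_map -zw kxkx.
Qed.

Lemma koszul_top p d (z : 'M[S]_(krank n.+1 p.+1, fs_rank F 0)) y : (m <= d)%N ->
  homogM 1 d.+2 y -> kx z = y *m fs_map F 0 ->
  exists v w, y = kx v + w *m fs_map F 1.
Proof.
case: p z y => [|p] z y md yd ky; first by apply: koszul0 yd _; [lia | exists z].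
apply: koszulS yd _; first by lia.
by apply: fs_map_exact; rewrite kx_map -ky kxkx.
Qed.

Variables (h : nat -> nat) (Hh : hilbert_function M h) (g : 'I_(fs_rank F 0) -> M).
Hypothesis g_deg : forall b, gm_piece (fs_deg F 0 b) (g b).
Hypothesis g_gen : forall u, exists p : 'rV_(fs_rank F 0), u = \sum_b p 0 b *: g b.
Hypothesis g_rel : forall p : 'rV_(fs_rank F 0), \sum_b p 0 b *: g b = 0 <->
  exists q, p = q *m fs_map F 0.

Let ev (p : 'rV[S]_(fs_rank F 0)) : M := \sum_b p 0 b *: g b.

Let evD p q : ev (p + q) = ev p + ev q.
Proof. by rewrite -big_split; apply: eq_bigr => b _; rewrite mxE scalerDl. Qed.

Let evN p : ev (- p) = - ev p.
Proof. by rewrite -sumrN; apply: eq_bigr => b _; rewrite mxE scaleNr. Qed.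

Let ev0 : ev 0 = 0.
Proof. by rewrite /ev big1 // => b _; rewrite mxE scale0r. Qed.

Let ev_xmul i p : ev (p *m xmul K n.+1 _ i) = xvar K n.+1 i *: ev p.
Proof.
rewrite /xmul mul_mx_scalar scaler_sumr; apply: eq_bigr => b _.
by rewrite mxE scalerA.
Qed.

Let ev_map q : ev (q *m fs_map F 0) = 0.
Proof. by apply/g_rel; exists q. Qed.

Let ev_kd d p (f : 'M[K]_(krank n.+1 p.+1, h d)) (z : 'M[S]_(krank n.+1 p.+1, fs_rank F 0)) :
  (forall A, from_coord Hh (row A f) = ev (row A z)) ->
  forall A, from_coord Hh (row A (kd ((mod_ops Hh)^~ d) f)) = ev (row A (kx z)).
Proof.
move=> fz; apply: (@kd_rel _ _ _ _ _ _ ((mod_ops Hh)^~ d) (xmul K n.+1 _)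
  (fun u v => from_coord Hh u = ev v) (fun u v => from_coord Hh u = ev v)) => //.
- by rewrite from_coord0 ev0.
- by move=> u v u' v' uv uv'; rewrite from_coordD evD uv uv'.
- by move=> u v uv; rewrite from_coordN evN uv.
- by move=> i _ u v uv; rewrite from_coord_ops ev_xmul uv.
Qed.

(** A Koszul cycle on M is lifted to z over F_0, and the boundary of z to y over F_1. Splitting y by
    [koszul_top] gives a correction of z, invisible in M, that makes it a Koszul cycle over F_0,
    hence a boundary. *)
Lemma betti_mod_reg : ops_reg m n.+1 (mod_ops Hh).
Proof.
move=> d p f md kf0.
have Hz A : exists z : 'rV_(fs_rank F 0), from_coord Hh (row A f) = ev z /\ hpart d.+1 z = z.
  have [z zE] := g_gen (from_coord Hh (row A f)); exists (hpart d.+1 z).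
  rewrite hpart_id; split=> //; rewrite {1}zE (homog_component (d := d.+1) g_deg).
    by apply: eq_bigr => b _; rewrite mxE.
  by rewrite -zE; apply: from_coord_piece.
pose z := \matrix_A sval (cid (Hz A)).
have zf A : from_coord Hh (row A f) = ev (row A z).
  by rewrite rowK; case: (svalP (cid (Hz A))).
have zd : homogM 0 d.+1 z by move=> A; rewrite rowK; case: (svalP (cid (Hz A))).
have [y0 kzy] : exists y, kx z = y *m fs_map F 0.
  have H A : exists q, row A (kx z) = q *m fs_map F 0.
    by apply/g_rel; rewrite -/(ev _) -(ev_kd zf) kf0 row0 from_coord0.
  exists (\matrix_A sval (cid (H A))); apply/row_matrixP => A.
  by rewrite row_mul rowK -(svalP (cid (H A))).
pose y := hpartM d.+2 y0.
have ky : kx z = y *m fs_map F 0.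
  by rewrite -hpartM_map // -kzy hpartM_idP //; apply: hpart_kd.
have yd : homogM 1 d.+2 y by apply: hpartM_row.
have [v [w yE]] : exists v w, y = kx v + w *m fs_map F 1.
  exact: koszul_top md yd ky.
have [|t tE] := @koszul_exact K n.+1 n.+1 _ _ (z - v *m fs_map F 0) (leqnn _).
  by rewrite kdB ky yE mulmxDl -mulmxA fs_map_comp mulmx0 addr0 kx_map subrr.
(* Taking components of degree d + 1 in [tE] replaces t by its component of degree d, whose image
   lies in M_d. *)
pose t' := hpartM d t.
have kt' : kx t' = z - hpartM d.+1 v *m fs_map F 0.
  rewrite -hpartM_kd -tE -hpartM_map //; apply/row_matrixP => A.
  by rewrite [LHS]rowK !linearB /= hpartD hpartN zd; congr (_ - _); rewrite rowK.
pose f' := \matrix_A to_coord Hh d (ev (row A t')).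
have f't A : from_coord Hh (row A f') = ev (row A t').
  rewrite rowK to_coordK // rowK.
  apply: (gm_piece_comb g_deg) => b; rewrite mxE => bd.
    by rewrite bd; apply: pihomogP.
  by rewrite leqNgt bd.
exists f'; apply/row_matrixP => A; apply: (@from_coord_inj _ _ _ _ Hh).
rewrite (ev_kd f't) kt' linearB /= row_mul evD evN ev_map subr0.
exact: zf.
Qed.
End BettiRegularity.

Lemma regularity_hilbert_poly (K : fieldType) n (M : gradedModule K n) m h :
  hilbert_function M h -> generated_in_degree_zero M -> regularity_le M m ->
  hilbert_poly_bounds n.+1 m h.
Proof.
move=> Hh gM [F [[F_deg [g [g_deg g_gen g_rel F_exact]]] F_betti]].
apply: (@regular_hilbert_poly m n.+1 n.+1 K h (mod_ops Hh)) => //.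
- exact: mod_ops_comm.
- exact: mod_ops_gen.
- exact: mod_ops_span.
- exact: (@betti_mod_reg K n M m F F_deg F_betti F_exact h Hh g).
Qed.

(** * Modules without free summands *)

Section Monomials.
Variable n : nat.

Definition mons d : seq 'X_{1..n.+1} := [seq s2m (tval t) | t <- enum (basis n.+1 d)].

Lemma mem_mons d m : (m \in mons d) = (mdeg m == d).
Proof. by rewrite (basis_cover d m). Qed.

Lemma uniq_mons d : uniq (mons d).
Proof. exact: uniq_basis. Qed.

Definition mon d := seq_sub (mons d).

Lemma card_mon d : #|{: mon d}| = 'C(d + n, d).
Proof. by rewrite card_seq_sub ?uniq_mons // /mons size_basis. Qed.

Lemma mdeg_mon d (x : mon d) : mdeg (ssval x) = d.
Proof. by apply/eqP; rewrite -mem_mons ssvalP. Qed.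

Lemma mon_of d m : mdeg m = d -> {x : mon d | ssval x = m}.
Proof. by move=> /eqP md; rewrite -mem_mons in md; exists (SeqSub md). Qed.

Lemma homog_monE (K : fieldType) d (p : {mpoly K[n.+1]}) : p \is d.-homog ->
  p = \sum_(x : mon d) p@_(ssval x) *: 'X_[ssval x].
Proof.
move=> ph; apply/mpolyP => m; rewrite linear_sum /=.
have [/mon_of[y <-]|ne] := eqVneq (mdeg m) d.
  rewrite (bigD1 y) //= mcoeffZ mcoeffX eqxx mulr1 big1 ?addr0 // => x xy.
  rewrite mcoeffZ mcoeffX (negPf (_ : ssval x != ssval y)) ?mulr0 //.
rewrite (dhomog_nemf_coeff ph ne) big1 // => x _; rewrite mcoeffZ mcoeffX.
by case: eqP => [xm|_]; rewrite ?mulr0 //; case/eqP: ne; rewrite -xm; apply: mdeg_mon.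
Qed.
End Monomials.

(** Beyond a Cauchy bound the sign of p is that of its leading coefficient. *)
Lemma poly_ge0_lead (p : {poly rat}) a :
  (forall j : nat, (a < j)%N -> 0 <= p.[j%:R]) -> 0 <= lead_coef p.
Proof.
move=> p0; rewrite leNgt; apply/negP => l0.
have lu : lead_coef p != 0 by rewrite lt_eqF.
have qm : (lead_coef p)^-1 *: p \is monic by rewrite monicE lead_coefZ mulVf.
have [b Hb] := monic_Cauchy_bound qm.
pose j := (maxn a.+1 (Num.bound b)).
have := Hb j%:R; rewrite hornerZ => /(_ _)H.
suff : 0 < (lead_coef p)^-1 * p.[j%:R].
  by rewrite nmulr_rgt0 ?invr_lt0 // ltNge p0 // leq_maxl.
apply: H; have := archi_boundP (x := `|b|); rewrite normr_ge0 => /(_ isT) bb.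
rewrite (le_trans (ler_norm b)) // (le_trans (ltW bb)) // ler_nat.
by rewrite /Num.bound normr_id leq_maxr.
Qed.

Lemma size_sub_shift (p : {poly rat}) k c : (size p <= k.+1)%N ->
  (size (p - (p \Po ('X - c%:P)))%R <= k)%N.
Proof.
move=> sp; rewrite -[p in X in (size X)]coefK poly_def.
rewrite linear_sum -sumrB /= (leq_trans (size_sum _ _ _)) //; apply/bigmax_leqP => i _.
rewrite linearZ /= -scalerBr (leq_trans (size_scale_leq _ _)) //.
rewrite comp_Xn_poly; apply: (@leq_trans i); last by have := leq_trans (ltn_ord i) sp.
rewrite subrXX opprB addrCA subrr addr0 mul_polyC (leq_trans (size_scale_leq _ _)) //.
rewrite (leq_trans (size_sum _ _ _)) //; apply/bigmax_leqP => j _.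
rewrite (leq_trans (size_polyMleq _ _)) // size_polyXn size_exp_XsubC.
by have := ltn_ord j; lia.
Qed.

Section Torsion.
Variables (K : fieldType) (n : nat) (M : gradedModule K n).
Local Notation S := {mpoly K[n.+1]}.

(** The ideals <x_0, ..., x_(i-1)> for i from 0 to n + 1 form the chain; each is prime as the kernel
    of [kill i], a map into a domain. *)
Lemma faithful_krull_dim : (forall p, annihilator M p -> p = 0) -> krull_dim_ge M n.+1.
Proof.
move=> faith; exists (fun i p => kill i p == 0 :> S); split=> i ilt.
  split=> [|u v|p /faith ->]; last by rewrite unfold_in kill0.
    split; rewrite ?unfold_in ?kill0 ?kill1 ?oner_eq0 //.
    move=> a u v; rewrite !unfold_in killD killM => /eqP -> /eqP ->.
    by rewrite mulr0 addr0.
  by rewrite !unfold_in killM mulf_eq0.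
split=> [p|sub].
  rewrite !unfold_in => /eqP /kill_eq0P[c ->]; apply/eqP/kill_eq0P.
  exists (fun j => if (j < i)%N then c j else 0).
  rewrite big_ord_recr /= ltnn mul0r addr0; apply: eq_bigr => j _.
  by rewrite ltn_ord.
have := sub (xvar K n.+1 i); rewrite !unfold_in !kill_xvar ltnSn ltnn eqxx => /(_ isT).
rewrite (_ : xvar K n.+1 i = 'X_(Ordinal ilt)); last by rewrite -xvarE.
move=> /eqP X0; have := mcoeffXU K (Ordinal ilt) (Ordinal ilt).
by rewrite X0 mcoeff0 eqxx => /esym/eqP; rewrite oner_eq0.
Qed.

(** As M is graded, every component of an annihilating p kills homogeneous elements; the one in the
    degree of the leading monomial is nonzero. *)
Lemma homog_annihilator : (exists2 p, annihilator M p & p != 0) ->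
  exists e (q : S), [/\ q \is e.-homog, q != 0 &
    forall d (u : M), gm_piece d u -> q *: u = 0].
Proof.
move=> [p pM p0]; exists (mdeg (mlead p)), (pihomog mdeg (mdeg (mlead p)) p).
split; first exact: pihomogP.
  apply/eqP => /mpolyP/(_ (mlead p)); rewrite mcoeff0 pihomogE.
  rewrite linear_sum /= -big_filter.
  rewrite (bigD1_seq (mlead p)) ?filter_uniq ?msupp_uniq ?mem_filter ?eqxx ?mlead_supp //=.
  rewrite big1 => [|m ne]; last by rewrite mcoeffZ mcoeffX (negPf ne) mulr0.
  rewrite mcoeffZ mcoeffX eqxx mulr1 addr0 => /eqP.
  by rewrite mleadc_eq0 (negPf p0).
move=> d u ud; set e := mdeg _.
have := @homog_component K n M 1 (fun=> d) (fun=> u) (fun=> p) (e + d).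
rewrite !big_ord1 pM => /(_ (fun=> ud) (gm_piece0 _ _)).
by rewrite leq_addl addnK.
Qed.

(** M_(e+d) is a quotient of h(0) copies of S_(e+d), through the matrix [T]. The multiples by q of
    h(0) copies of S_d, the rows of [G], lie in the kernel and are independent because S is a
    domain; the bound is the rank inequality for G T = 0. *)
Lemma annihilated_hilbert_bound (h : nat -> nat) e (q : S) :
  hilbert_function M h -> generated_in_degree_zero M ->
  q \is e.-homog -> q != 0 -> (forall d (u : M), gm_piece d u -> q *: u = 0) ->
  forall d, (h (e + d) + h 0 * 'C(d + n, d) <= h 0 * 'C(e + d + n, e + d))%N.
Proof.
move=> Hh gM qh q0 qM d.
pose J k := (mon n k * 'I_(h 0))%type.
have cJ k : #|{: J k}| = (h 0 * 'C(k + n, k))%N.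
  by rewrite card_prod card_ord card_mon mulnC.
pose b (y : 'I_(h 0)) : M := hbasis Hh y.
have b0 y : gm_piece 0 (b y) by apply: (svalP (cid (Hh 0%N))).1.
pose w k (x : J k) : M := 'X_[ssval x.1] *: b x.2.
have wk k (x : J k) : gm_piece k (w k x).
  have := @gm_pieceZ _ _ M k 0 'X_[ssval x.1] _ _ (b0 x.2); rewrite addn0; apply.
  by rewrite dhomogX /= mdeg_mon.
pose T : 'M[K]_(#|{: J (e + d)%N}|, h (e + d)%N) := \matrix_x to_coord Hh _ (w _ (enum_val x)).
have TE (v : 'rV_#|{: J (e + d)%N}|) :
    from_coord Hh (v *m T) = \sum_x (v 0 (enum_rank x))%:MP *: w _ x.
  rewrite mulmx_sum_row from_coord_sum (reindex _ (onW_bij _ (@enum_rank_bij _))) /=.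
  by apply: eq_bigr => x _; rewrite from_coordZ rowK to_coordK // enum_rankK.
pose G : 'M[K]_(#|{: J d}|, #|{: J (e + d)%N}|) := \matrix_(x, y)
  if (enum_val x).2 == (enum_val y).2 then
    (q * 'X_[ssval (enum_val x).1])@_(ssval (enum_val y).1) else 0.
have GT : G *m T = 0.
  apply/row_matrixP => x; rewrite row_mul row0; apply: (@from_coord_inj _ _ _ _ Hh).
  rewrite from_coord0 TE; set x0 := enum_val x.
  transitivity (q *: w _ x0); last exact: qM (wk _ _).
  have hom : q * 'X_[ssval x0.1] \is (e + d).-homog.
    by apply: dhomogM => //; rewrite dhomogX /= mdeg_mon.
  rewrite [in RHS]/w scalerA {1}(homog_monE hom) scaler_suml.
  transitivity (\sum_(z : mon n (e + d)) \sum_(k : 'I_(h 0))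
     (row x G 0 (enum_rank (z, k)))%:MP *: w (e + d)%N (z, k)).
    rewrite pair_big /=; apply: eq_bigr => -[z k] _ //.
  apply: eq_bigr => z _; rewrite (bigD1 x0.2) //= big1 ?addr0 => [|k kx].
    by rewrite !mxE enum_rankK eqxx scalerA mul_mpolyC.
  by rewrite !mxE enum_rankK /= -/x0 eq_sym (negPf kx) mpolyC0 scale0r.
have Gf : row_free G.
  rewrite -kermx_eq0; apply/rowV0P => v /sub_kermxP vG.
  apply/rowP => x; rewrite mxE; set x0 := enum_val x.
  pose P : S := \sum_(z : mon n d) v 0 (enum_rank (z, x0.2)) *: 'X_[ssval z].
  have P0 : q * P = 0.
    have hom : q * P \is (e + d).-homog.
      apply: dhomogM => //; apply: rpred_sum => z _; apply: rpredZ.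
      by rewrite dhomogX /= mdeg_mon.
    rewrite (homog_monE hom) big1 // => y _.
    rewrite (_ : (q * P)@_(ssval y) = 0) ?scale0r //.
    have /rowP/(_ (enum_rank (y, x0.2))) := vG; rewrite !mxE => <-.
    rewrite mulr_sumr linear_sum /=.
    transitivity (\sum_(z : mon n d) \sum_(k : 'I_(h 0))
       v 0 (enum_rank (z, k)) * G (enum_rank (z, k)) (enum_rank (y, x0.2))).
      apply: eq_bigr => z _; rewrite (bigD1 x0.2) //= big1 ?addr0 => [|k kx].
        by rewrite mxE !enum_rankK eqxx -scalerAr mcoeffZ.
      by rewrite mxE !enum_rankK /= (negPf kx) mulr0.
    rewrite pair_big [RHS](reindex _ (onW_bij _ (@enum_rank_bij _))) /=.
    by apply: eq_bigr => -[z k].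
  move/eqP: P0; rewrite mulf_eq0 (negPf q0) => /eqP/mpolyP/(_ (ssval x0.1)).
  rewrite mcoeff0 linear_sum /= (bigD1 x0.1) //= big1 => [|z zx].
    by rewrite mcoeffZ mcoeffX eqxx mulr1 addr0 -surjective_pairing enum_valK.
  by rewrite mcoeffZ mcoeffX (negPf (_ : ssval z != ssval x0.1)) ?mulr0.
have Tf : row_full T.
  rewrite -sub1mx; apply/row_subP => i; set c := row i 1%:M.
  have [r [g [p [g0 uE]]]] := gM (from_coord Hh c).
  have ud : gm_piece (e + d)%N (\sum_i p i *: g i) by rewrite -uE; apply: from_coord_piece.
  have := homog_component (e := fun=> 0%N) g0 ud; rewrite -uE /= subn0 => cE.
  pose a k := to_coord Hh 0 (g k).
  have gE k : g k = \sum_y (a k 0 y)%:MP *: b y.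
    by rewrite -[LHS](to_coordK Hh (g0 k)).
  apply/submxP; exists (\row_x (\sum_k (pihomog mdeg (e + d) (p k))@_(ssval (enum_val x).1) * a k
    0 (enum_val x).2)).
  apply: (@from_coord_inj _ _ _ _ Hh); rewrite TE cE.
  transitivity (\sum_k \sum_(x : J (e + d)%N)
      ((pihomog mdeg (e + d) (p k))@_(ssval x.1) * a k 0 x.2)%:MP *: w _ x).
    apply: eq_bigr => k _; rewrite {1}gE.
    rewrite {1}(homog_monE (pihomogP mdeg (e + d) (p k))) scaler_suml.
    rewrite -(pair_big xpredT xpredT (fun z y => ((pihomog mdeg (e + d) (p k))@_(ssval z) * a k 0
      y)%:MP *: w (e + d)%N (z, y))) /=.
    apply: eq_bigr => z _; rewrite scaler_sumr; apply: eq_bigr => y _.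
    by rewrite /w !scalerA /= -mul_mpolyC mpolyCM; congr (_ *: _); ring.
  rewrite exchange_big /=; apply: eq_bigr => x _.
  by rewrite mxE enum_rankK -scaler_suml raddf_sum.
have := mulmx0_rank_max GT.
move: Gf Tf; rewrite /row_free /row_full => /eqP -> /eqP ->.
by rewrite !cJ addnC.
Qed.
End Torsion.

(** The Hilbert polynomial of S, the binomial coefficient of s + n over n. *)
Definition binp (n : nat) : {poly rat} :=
  n`!%:R^-1 *: (rising n \Po ('X + 1)).

Lemma binpE n d : (binp n).[d%:R] = 'C(d + n, n)%:R.
Proof.
rewrite /binp hornerZ horner_comp /rising horner_prod.
have nz : n`!%:R != 0 :> rat by rewrite pnatr_eq0 -lt0n fact_gt0.
apply: (mulfI nz); rewrite mulrA divff // mul1r -natrM mulnC bin_ffact.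
elim: n {nz} => [|n IH]; first by rewrite big_ord0.
rewrite big_ord_recr /= IH !hornerE addnS ffactSS mulrC.
by rewrite natrM -natr1 natrD; congr (_ * _); ring.
Qed.

Lemma size_binp n : (size (binp n) <= n.+1)%N.
Proof.
rewrite (leq_trans (size_scale_leq _ _)) // -polyC1 size_comp_poly2 ?size_XaddC //.
by rewrite size_rising.
Qed.

(** A form of degree e in the annihilator bounds h(j) by h(0) times a difference of two values of
    [binp n] at distance e, a polynomial of degree below n in j. A q of degree n would outgrow
    it. *)
Lemma torsion_size (K : fieldType) n (M : gradedModule K n) m h (q : {poly rat}) :
  hilbert_function M h -> generated_in_degree_zero M -> ~ krull_dim_ge M n.+1 ->
  (size q <= n.+1)%N -> (forall j : nat, (m < j)%N -> q.[j%:R] = (h j)%:R) ->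
  (size q <= n)%N.
Proof.
move=> Hh gM kM sq qE.
have [p pM p0] : exists2 p, annihilator M p & p != 0.
  apply: contrapT => H; apply: kM; apply: faithful_krull_dim => p pM.
  by apply/eqP/negPn/negP => p0; apply: H; exists p.
have [e [q' [q'h q'0 q'M]]] := homog_annihilator (ex_intro2 _ _ p pM p0).
have bound := annihilated_hilbert_bound Hh gM q'h q'0 q'M.
rewrite leqNgt; apply/negP => nq.
have sqE : size q = n.+1 by apply/eqP; rewrite eqn_leq sq.
pose f := (h 0)%:R *: (binp n - (binp n \Po ('X - (e%:R)%:P))) : {poly rat}.
have sf : (size f <= n)%N.
  by rewrite (leq_trans (size_scale_leq _ _)) // size_sub_shift ?size_binp.
have lq : 0 <= lead_coef q.
  by apply: (@poly_ge0_lead _ m) => j mj; rewrite qE ?ler0n.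
have lfq : lead_coef (f - q) = - lead_coef q.
  by rewrite addrC lead_coefDl ?lead_coefN // size_polyN sqE ltnS.
have : 0 <= lead_coef (f - q).
  apply: (@poly_ge0_lead _ (m + e)) => j mj.
  have ej : (e <= j)%N by lia.
  rewrite hornerD hornerN /f hornerZ hornerD hornerN horner_comp hornerXsubC -natrB // !binpE.
  rewrite qE; last by lia.
  rewrite subr_ge0 mulrBr lerBrDr -!natrM -natrD ler_nat.
  have binC k : 'C(k + n, k) = 'C(k + n, n) by rewrite -bin_sub ?leq_addr // addKn.
  by have := bound (j - e)%N; rewrite subnKC // !binC.
rewrite lfq oppr_ge0 => lq'; have : lead_coef q == 0 by rewrite eq_le lq lq'.
by rewrite lead_coef_eq0 -size_poly_eq0 sqE.
Qed.

(** * The cone cut out by the inequalities *)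

(** Multiplication of the generating function by 1 - t, with h(-1) = 0; [psum] is the division by 1
    - t. *)
Definition bdiff (h : nat -> rat) (j : nat) : rat :=
  h j - (if j is j'.+1 then h j' else 0).

Definition psum (h : nat -> rat) (j : nat) : rat := \sum_(i < j.+1) h i.

Lemma bdiffK h : psum (bdiff h) =1 h.
Proof.
elim=> [|j IH]; first by rewrite /psum big_ord1 /bdiff subr0.
by rewrite /psum big_ord_recr /= -/(psum _ j) IH /bdiff addrC subrK.
Qed.

Lemma psumK h : bdiff (psum h) =1 h.
Proof.
case=> [|j]; rewrite /bdiff /psum; first by rewrite big_ord1 subr0.
by rewrite big_ord_recr /= [_ + h _]addrC addrK.
Qed.

Lemma eq_bdiff h h' : h =1 h' -> bdiff h =1 bdiff h'.
Proof. by move=> e [|j]; rewrite /bdiff !e. Qed.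

Lemma numerator_coefE k h j : numerator_coef k h j = iter k bdiff h j.
Proof.
elim: k j => [|k IH] j.
  rewrite /numerator_coef big_ord_recr /= subnn expr0 coef1 mul1r big1 ?add0r // => i _.
  by rewrite coef1 subn_eq0 leqNgt ltn_ord mul0r.
have -> : iter k.+1 bdiff h j = bdiff (numerator_coef k h) j.
  by apply: eq_bdiff => i; rewrite IH.
rewrite /bdiff /numerator_coef; case: j => [|j].
  by rewrite !big_ord1 subr0 !subnn -!horner_coef0 !horner_exp !hornerE !expr1n.
have E c : ((1 - 'X : {poly rat}) ^+ k.+1)`_c.+1 =
    ((1 - 'X) ^+ k)`_c.+1 - ((1 - 'X) ^+ k)`_c.
  by rewrite exprS mulrBl mul1r coefB coefXM.
rewrite big_ord_recr [in RHS]big_ord_recr /= subnn.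
rewrite [RHS]addrAC; congr (_ + _).
  rewrite -sumrB; apply: eq_bigr => i _; rewrite subSn ?E ?mulrBl //.
  by rewrite -ltnS.
by rewrite -!horner_coef0 !horner_exp !hornerE !expr1n.
Qed.

Lemma V_iter k a h : V k a h <-> forall j, (a + k < j)%N -> iter k bdiff h j = 0.
Proof.
split=> [[b sb bE] j aj|H].
  by rewrite -numerator_coefE bE nth_default // (leq_trans sb).
exists (\poly_(j < (a + k).+1) numerator_coef k h j); first exact: size_poly.
move=> j; rewrite coef_poly; case: ltnP => // aj.
by rewrite numerator_coefE H.
Qed.

(** In the induction [bdiff] leads from V_{k+1,a} to V_{k,a+1}: the difference at a + 1 still
    involves h(a), so it is polynomial only beyond a + 1. *)
Lemma V_polyP k a h : V k a h <-> exists2 q : {poly rat}, (size q <= k)%N &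
  forall j : nat, (a < j)%N -> q.[j%:R] = h j.
Proof.
rewrite V_iter; elim: k a h => [|k IH] a h.
  rewrite addn0; split=> [H|[q]].
    by exists 0; rewrite ?size_poly0 // => j aj; rewrite horner0 [RHS]H.
  by rewrite size_poly_leq0 => /eqP -> H j aj; rewrite -[LHS]H // horner0.
have -> : (forall j, (a + k.+1 < j)%N -> iter k.+1 bdiff h j = 0) <->
          (forall j, (a.+1 + k < j)%N -> iter k bdiff (bdiff h) j = 0).
  by rewrite addSnnS; split=> H j /H; rewrite iterSr.
rewrite IH; split=> [[q1 sq1 q1E]|[q sq qE]].
  have [q2 sq2 q2E] := antidifference sq1.
  pose q := q2 + (h a.+1 - q2.[a.+1%:R])%:P.
  have sq : (size q <= k.+1)%N.
    rewrite (leq_trans (size_polyD _ _)) // geq_max sq2 size_polyC.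
    by case: (_ != 0).
  exists q => // j aj; rewrite -(subnKC aj); elim: (j - a.+1)%N => [|i IHi].
    by rewrite addn0 /q hornerD hornerC addrC subrK.
  have := nablaE q (a.+1 + i.+1)%N%:R; rewrite nablaD nablaC addr0 q2E q1E; last by lia.
  rewrite addnS /bdiff -[(a.+1 + i).+1]addn1 [in X in _ = _ - q.[X]]natrD addrK IHi.
  by rewrite addn1 => /addIr ->.
exists (nabla q); first by rewrite /nabla -polyC1 size_sub_shift.
move=> [|j] aj //; rewrite nablaE -[j.+1%:R - 1](_ : j%:R = _) ?qE //.
  exact: ltnW.
by rewrite -natr1 addrK.
Qed.

Lemma V_subS n m : V n m `<=` V n.+1 m.
Proof. by move=> h /V_polyP[q sq qE]; apply/V_polyP; exists q => //; apply: leqW. Qed.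

Lemma hilbert_polyE a h (q : {poly rat}) : (forall j : nat, (a < j)%N -> q.[j%:R] = h j) ->
  hilbert_poly a h = q.
Proof.
move=> qE; rewrite /hilbert_poly; case: xgetP => [x _ xE|/(_ q)].
  by apply: (@poly_eq_large _ _ a) => j aj; rewrite xE // qE.
by case.
Qed.

Lemma V_comb k a I (r : seq I) (c : I -> rat) (v : I -> nat -> rat) :
  (forall i, V k a (v i)) -> V k a (fun j => \sum_(i <- r) c i * v i j).
Proof.
move=> Hv; have Hq i := (V_polyP k a (v i)).1 (Hv i).
pose q i := s2val (cid2 (Hq i)).
have [sq qE] : (forall i, (size (q i) <= k)%N) /\
    (forall i (j : nat), (a < j)%N -> (q i).[j%:R] = v i j).
  by split=> i; rewrite /q; case: (cid2 _).
apply/V_polyP; exists (\sum_(i <- r) c i *: q i).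
  elim/big_rec: _ => [|i p _ sp]; first by rewrite size_poly0.
  by rewrite (leq_trans (size_polyD _ _)) // geq_max sp (leq_trans (size_scale_leq _ _)).
move=> j aj; rewrite horner_sum; apply: eq_bigr => i _.
by rewrite hornerZ qE.
Qed.

Section Functionals.
Variables n m : nat.

(** The slacks of all inequalities as one family, numbered like the generators [gen], which makes
    the matrix of the values [Phi s (gen t)] diagonal. *)
Definition Phi (t : nat) (h : nat -> rat) : rat :=
  let q := hilbert_poly m h in
  if (t < m)%N then (n + t + 1)%N%:R * h t - (t + 1)%N%:R * h t.+1
  else if t == m then h m - q.[m%:R]
  else let i := (t - m.+1)%N in
    (n - i)%N%:R * (iter i nabla q).[m%:R] -
    (n + m - i)%N%:R * (iter i.+1 nabla q).[m%:R].

Lemma iter_nabla_sum i I (r : seq I) (c : I -> rat) (q : I -> {poly rat}) :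
  iter i nabla (\sum_(k <- r) c k *: q k) = \sum_(k <- r) c k *: iter i nabla (q k).
Proof.
elim: i => //= i ->; rewrite /nabla linear_sum /= -sumrB; apply: eq_bigr => k _.
by rewrite linearZ /= scalerBr.
Qed.

Lemma Phi_comb k t I (r : seq I) (c : I -> rat) (v : I -> nat -> rat) :
  (forall i, V k m (v i)) ->
  Phi t (fun j => \sum_(i <- r) c i * v i j) = \sum_(i <- r) c i * Phi t (v i).
Proof.
move=> Hv; have Hq i := (V_polyP k m (v i)).1 (Hv i).
pose q i := s2val (cid2 (Hq i)).
have qE i (j : nat) : (m < j)%N -> (q i).[j%:R] = v i j by rewrite /q; case: (cid2 _) => x _ /=;
  apply.
have vE i : hilbert_poly m (v i) = q i by apply: hilbert_polyE => j; apply: qE.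
have sE : hilbert_poly m (fun j => \sum_(i <- r) c i * v i j) = \sum_(i <- r) c i *: q i.
  apply: hilbert_polyE => j mj; rewrite horner_sum; apply: eq_bigr => i _.
  by rewrite hornerZ qE.
rewrite /Phi sE; under [RHS]eq_bigr do rewrite vE.
case: ifP => _.
  rewrite !mulr_sumr -sumrB; apply: eq_bigr => i _; ring.
case: ifP => _.
  rewrite horner_sum -sumrB; apply: eq_bigr => i _; rewrite hornerZ; ring.
rewrite !iter_nabla_sum !horner_sum !mulr_sumr -sumrB; apply: eq_bigr => i _.
by rewrite !hornerZ; ring.
Qed.

Definition ineq_cone : set (nat -> rat) :=
  [set h | V n m h /\ forall t, (t < m.+1 + n)%N -> 0 <= Phi t h].

Lemma ineq_coneE : ineq_cone = [set h | V n m h /\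
    [/\ forall j : nat, (j < m)%N ->
          (n + j + 1)%N%:R * h j >= (j + 1)%N%:R * h j.+1,
        h m >= (hilbert_poly m h).[m%:R] &
        forall i : nat, (i < n)%N ->
          (n - i)%N%:R * (iter i nabla (hilbert_poly m h)).[m%:R] >=
          (n + m - i)%N%:R * (iter i.+1 nabla (hilbert_poly m h)).[m%:R]]].
Proof.
apply/seteqP; split=> h [hV H]; split=> //.
  split=> [j jm||i ilt].
  - by have := H j; rewrite /Phi jm subr_ge0; apply; lia.
  - by have := H m; rewrite /Phi ltnn eqxx subr_ge0; apply; lia.
  - have := H (m.+1 + i)%N; rewrite ltn_add2l => /(_ ilt).
    rewrite /Phi ifN -?leqNgt ?ifN ?addKn ?subr_ge0 //; first by rewrite gtn_eqF // leq_addr.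
    by rewrite ltnW // leq_addr.
case: H => H1 H2 H3 t tlt; rewrite /Phi; case: ltnP => tm; first by rewrite subr_ge0 H1.
case: eqP => [_|/eqP tm']; first by rewrite subr_ge0.
by rewrite subr_ge0; apply: H3; lia.
Qed.

Lemma size_iter_nabla k i (q : {poly rat}) : (size q <= k)%N -> (size (iter i nabla q) <= k - i)%N.
Proof.
move=> sq; elim: i => [|i IH]; first by rewrite subn0.
rewrite iterS /nabla -polyC1; case: (posnP (k - i)) => [ki|ki].
  move: IH; rewrite ki leqn0 size_poly_eq0 => /eqP ->.
  by rewrite comp_poly0 subrr size_poly0.
by apply: size_sub_shift; rewrite (leq_trans IH) //; lia.
Qed.

Lemma nabla_eq0 k (q : {poly rat}) : (size q <= k)%N ->
  (forall i, (i < k)%N -> (iter i nabla q).[m%:R] = 0) -> q = 0.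
Proof.
elim: k q => [|k IH] q sq H; first by apply/eqP; rewrite -size_poly_leq0.
have n0 : nabla q = 0.
  apply: IH => [|i ik]; last by rewrite -iterSr H.
  by have := size_iter_nabla 1 sq; rewrite subn1.
apply: (@poly_eq_large _ _ m) => j mj; rewrite horner0 -(subnKC (ltnW mj)).
elim: (j - m)%N => [|i IHi]; first by rewrite addn0 (H 0%N).
rewrite addnS -natr1; have := nablaE q ((m + i)%N%:R + 1).
by rewrite n0 horner0 addrK IHi subr0 => <-.
Qed.

(** The system is triangular. Starting from nabla^n q = 0, each equation yields nabla^i q(m) = 0
    from the value for i + 1, as n - i > 0; then q = 0, so h(m) = 0, and h(j) = 0 follows downwards
    from h(j + 1) = 0. *)
Lemma Phi_separates h : V n m h -> (forall t, (t < m.+1 + n)%N -> Phi t h = 0) ->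
  forall j, h j = 0.
Proof.
move=> /V_polyP[q sq qE] H; have hE := hilbert_polyE qE.
have qi i : (i <= n)%N -> (iter (n - i) nabla q).[m%:R] = 0.
  elim: i => [_|i IH ilt].
    suff -> : iter (n - 0) nabla q = 0 by rewrite horner0.
    apply/eqP; rewrite -size_poly_leq0.
    by have := size_iter_nabla n sq; rewrite subnn subn0.
  have := H (m.+1 + (n - i.+1))%N; rewrite ltn_add2l => /(_ ltac:(lia)).
  rewrite /Phi ifN; last by rewrite -leqNgt; lia.
  rewrite ifN; last by rewrite gtn_eqF //; lia.
  rewrite addKn hE (_ : (n - i.+1).+1 = (n - i)%N); last by lia.
  rewrite (IH (ltnW ilt)) mulr0 subr0 => /eqP.
  rewrite mulf_eq0 pnatr_eq0 => /orP[/eqP|/eqP //]; lia.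
have q0 : q = 0.
  apply: (nabla_eq0 sq) => i ilt; have := qi (n - i)%N (leq_subr _ _).
  by rewrite subKn // ltnW.
have hm : h m = 0.
  have := H m; rewrite /Phi ltnn eqxx hE q0 horner0 subr0; apply; lia.
have hlo i : (i <= m)%N -> h (m - i)%N = 0.
  elim: i => [|i IH] im; first by rewrite subn0.
  have := H (m - i.+1)%N ltac:(lia); rewrite /Phi ifT; last by lia.
  rewrite (_ : (m - i.+1).+1 = (m - i)%N); last by lia.
  rewrite (IH (ltnW im)) mulr0 subr0 => /eqP.
  rewrite mulf_eq0 pnatr_eq0 => /orP[/eqP|/eqP //]; lia.
move=> j; have [jm|mj] := leqP j m; last by rewrite -qE // q0 horner0.
by rewrite -(subKn jm) hlo // leq_subr.
Qed.
End Functionals.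

(** * Hilbert functions of the listed modules *)

Fixpoint nmon (r d : nat) : nat :=
  if r is r'.+1 then (\sum_(t < d.+1) nmon r' t)%N else (d == 0%N).

(* Number of monomials of degree d in r + b variables of degree < e in the first r. *)
Fixpoint cnt (r e b d : nat) : nat :=
  if b is b'.+1 then (\sum_(t < d.+1) cnt r e b' t)%N
  else if (d < e)%N then nmon r d else 0%N.

Lemma nmonE r d : nmon r.+1 d = 'C(r + d, d).
Proof.
elim: r d => [|r IH] d.
  by rewrite /= big_ord_recl big1 //= addn0 add0n binn.
suff : (\sum_(t < d.+1) nmon r.+1 t)%N = 'C(r.+1 + d, d) by [].
elim: d => [|d IHd]; first by rewrite big_ord1 IH !bin0.
rewrite big_ord_recr IHd (_ : nmon r.+1 _ = 'C(r.+1 + d, d.+1)); last first.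
  by rewrite IH /= addSnnS.
by rewrite [in RHS]addnS binS [RHS]addnC.
Qed.

Lemma cnt_small r e b d : (d < e)%N -> cnt r e b d = nmon (b + r)%N d.
Proof.
elim: b d => [|b IH] d de /=; first by rewrite de.
by apply: eq_bigr => t _; rewrite IH // (leq_trans _ de).
Qed.

Lemma cntS r e b d : cnt r e b.+1 d.+1 = (cnt r e b.+1 d + cnt r e b d.+1)%N.
Proof. by rewrite /= big_ord_recr. Qed.

(** A further free variable means partial summation, so [nabla] lowers b by one. For b = 0 the
    polynomial 0 is right only beyond m; from b = 1 on, the constant of integration makes it right
    at m too. *)
Lemma cnt_poly r m b : exists q : {poly rat}, [/\ (size q <= b)%N,
  forall j, (m < j)%N -> q.[j%:R] = (cnt r m.+1 b j)%:R,
  (0 < b)%N -> q.[m%:R] = (cnt r m.+1 b m)%:R &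
  forall k, (iter k nabla q).[m%:R] = if (k < b)%N then (cnt r m.+1 (b - k) m)%:R else 0].
Proof.
elim: b => [|b [q [sq qE qm qk]]].
  exists 0; split=> [|j mj||k] //; first by rewrite size_poly0.
    by rewrite horner0 /= ltnS leqNgt mj.
  have -> : iter k nabla 0 = 0 by elim: k => //= k ->; rewrite /nabla comp_poly0 subrr.
  by rewrite horner0.
have [q1 sq1 q1E] := antidifference sq.
pose p := q1 + ((cnt r m.+1 b.+1 m)%:R - q1.[m%:R])%:P.
have np : nabla p = q by rewrite nablaD nablaC addr0.
have pm : p.[m%:R] = (cnt r m.+1 b.+1 m)%:R by rewrite /p hornerD hornerC addrC subrK.
exists p; split=> // [|j mj|k].
- rewrite (leq_trans (size_polyD _ _)) // geq_max sq1 size_polyC.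
  by case: (_ != 0).
- rewrite -(subnKC (ltnW mj)); elim: (j - m)%N => [|i IHi]; first by rewrite addn0.
  have := nablaE p (m + i.+1)%N%:R; rewrite np qE; last by lia.
  rewrite addnS cntS -[(m + i).+1 in X in _ = _ - X -> _]addn1 natrD addrK IHi => /eqP.
  by rewrite eq_sym subr_eq addrC -natrD => /eqP.
- case: k => [|k]; first by rewrite subn0 pm.
  by rewrite iterSr np qk ltnS subSS.
Qed.

Section Generators.
Variables n m : nat.

(** In the order of the theorem: the power t + 1 of the maximal ideal for t <= m, then <x_0, ...,
    x_(n-k-1)>^(m+1) for t = m + 1 + k. *)
Definition gen (t j : nat) : rat :=
  (if (t < m.+1)%N then cnt n.+1 t.+1 0 j
   else cnt (n - (t - m.+1)) m.+1 (t - m.+1).+1 j)%:R.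

Lemma gen_low t j : (t <= m)%N -> gen t j = if (j <= t)%N then 'C(n + j, j)%:R else 0.
Proof. by move=> tm; rewrite /gen ltnS tm /= ltnS -[X in if _ then X else _]/(nmon n.+1 j) nmonE;
  case: ifP. Qed.

Lemma gen_high k j : gen (m.+1 + k) j = (cnt (n - k) m.+1 k.+1 j)%:R.
Proof. by rewrite /gen ifN ?addKn // -leqNgt leq_addr. Qed.

Lemma gen_V t : (t < m.+1 + n)%N -> V n m (gen t).
Proof.
move=> tlt; apply/V_polyP; have [tm|mt] := leqP t m.
  exists 0; rewrite ?size_poly0 // => j mj; rewrite horner0 gen_low //.
  by rewrite leqNgt (leq_ltn_trans tm mj).
have [q [sq qE _ _]] := cnt_poly (n - (t - m.+1)) m (t - m.+1).+1.
exists q; first by rewrite (leq_trans sq) //; lia.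
by move=> j mj; rewrite qE // -[in RHS](subnKC mt) gen_high.
Qed.

Lemma gen_0 t : (t < m.+1 + n)%N -> gen t 0%N = 1.
Proof.
move=> tlt; have [tm|mt] := leqP t m; first by rewrite gen_low //= addn0 bin0.
by rewrite -(subnKC mt) gen_high cnt_small // (_ : (_ + _ = n.+1)%N) ?nmonE ?bin0 //; lia.
Qed.

(** Off the diagonal each functional is a binomial identity: (n+j+1) C(n+j, j) = (j+1) C(n+j+1, j+1)
    for values, and (n-i) C(n-i+m, m) = (n+m-i) C(n-i-1+m, m) for differences at m. On the diagonal
    one term is cut off, by the truncation or because nabla^(k+1) q = 0. *)
Lemma Phi_gen s t : (s < m.+1 + n)%N -> (t < m.+1 + n)%N ->
  if s == t then is_true (0 < Phi n m s (gen t)) else Phi n m s (gen t) = 0.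
Proof.
have growthC j : (n + j + 1)%N%:R * 'C(n + j, j)%:R = (j + 1)%N%:R * 'C(n + j.+1, j.+1)%:R :> rat.
  by rewrite -!natrM !addn1 addnS -mul_bin_diag.
move=> slt tlt; have [tm|mt] := leqP t m.
  have hE : hilbert_poly m (gen t) = 0.
    apply: hilbert_polyE => j mj; rewrite horner0 gen_low //.
    by rewrite leqNgt (leq_ltn_trans tm mj).
  rewrite /Phi hE; have i0 i : (iter i nabla 0).[m%:R] = 0 :> rat.
    have -> : iter i nabla 0 = 0 by elim: i => //= i ->; rewrite /nabla comp_poly0 subrr.
    by rewrite horner0.
  have [sm|ms] := ltnP s m.
    rewrite !gen_low //; have [->|ne] := eqVneq s t.
      by rewrite leqnn ltnn mulr0 subr0 -natrM ltr0n muln_gt0 bin_gt0 leq_addl; lia.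
    have [ts|st] := ltnP t s; first by rewrite (leq_gtF (ltnW ts)) !mulr0 subrr.
    by rewrite ltn_neqAle ne st growthC subrr.
  have [->|ne] := eqVneq s m.
    rewrite gen_low // horner0 subr0 [m == t]eq_sym; have [->|ne] := eqVneq t m.
      by rewrite leqnn ltr0n bin_gt0 leq_addl.
    by rewrite ifN // -ltnNge ltn_neqAle ne.
  have /negPf -> : s != t by move/eqP: ne => ne; apply/eqP; lia.
  by rewrite !i0 !mulr0 subrr.
have [k tE] : exists k, t = (m.+1 + k)%N by exists (t - m.+1)%N; lia.
have kn : (k < n)%N by lia.
have [q [sq qE qm qk]] := cnt_poly (n - k) m k.+1.
have hE : hilbert_poly m (gen t) = q.
  by apply: hilbert_polyE => j mj; rewrite qE // tE gen_high.
have tlo j : (j <= m)%N -> gen t j = 'C(n + j, j)%:R.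
  move=> jm; rewrite tE gen_high cnt_small // -nmonE; congr (nmon _ _)%:R; lia.
rewrite /Phi hE; have [sm|ms] := ltnP s m.
  by rewrite ltn_eqF ?tlo // ?growthC ?subrr //; lia.
have [sm|sm] := eqVneq s m.
  by rewrite ltn_eqF ?qm ?sm // ?subr_eq0 ?tE ?gen_high ?subrr //; lia.
have [i sE] : exists i, s = (m.+1 + i)%N by exists (s - m.+1)%N; lia.
rewrite sE tE eqn_add2l addKn !qk.
have cE j : (j <= k)%N -> (cnt (n - k) m.+1 (k.+1 - j) m)%:R = 'C(n - j + m, m)%:R :> rat.
  move=> jk; rewrite cnt_small // -nmonE; congr (nmon _ _)%:R; lia.
have [ik|ki|->] := ltngtP i k.
- rewrite ltnS (ltnW ik) ltnS ik !cE ?(ltnW ik) // -!natrM.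
  apply/eqP; rewrite subr_eq0 eqr_nat; apply/eqP.
  have -> : (n + m - i = n - i + m)%N by lia.
  have -> : (n - i.+1 + m = (n - i + m).-1)%N by lia.
  by rewrite mul_bin_down addnK.
- by rewrite !ifN ?mulr0 ?subrr // -leqNgt ?ltnS // ltnW.
- rewrite ltnSn ltnS ltnn mulr0 subr0 cE // -natrM ltr0n muln_gt0 bin_gt0 leq_addl andbT.
  by lia.
Qed.

Definition gen_cone : set (nat -> rat) :=
  [set h | exists2 c : 'I_(m.+1 + n) -> rat, forall i, 0 <= c i &
           forall j, h j = \sum_i c i * gen i j].

Lemma Phi_gen_comb (c : 'I_(m.+1 + n) -> rat) (s : 'I_(m.+1 + n)) :
  Phi n m s (fun j => \sum_i c i * gen i j) = c s * Phi n m s (gen s).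
Proof.
rewrite (@Phi_comb n m n) => [|i]; last exact: gen_V.
rewrite (bigD1 s) //= big1 ?addr0 // => i ne.
have := Phi_gen (ltn_ord s) (ltn_ord i); case: eqP => [si|_ ->]; last by rewrite mulr0.
by case/eqP: ne; apply: val_inj.
Qed.

Lemma Phi_gen_gt0 (s : 'I_(m.+1 + n)) : 0 < Phi n m s (gen s).
Proof. by have := Phi_gen (ltn_ord s) (ltn_ord s); rewrite eqxx. Qed.

Lemma gen_free (c : 'I_(m.+1 + n) -> rat) :
  (forall j, \sum_i c i * gen i j = 0) -> forall i, c i = 0.
Proof.
move=> c0 s; have := Phi_gen_comb c s.
(* The zero function is written as an empty combination, so that [Phi_comb] evaluates the functional
   on it. *)
rewrite (_ : (fun j => _) = (fun j => \sum_(i <- [::] : seq nat) 0 * gen 0 j)).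
  rewrite (@Phi_comb n m n s nat [::] (fun=> 0) (fun=> gen 0)) ?big_nil => [|_]; last exact: gen_V.
  by move/esym/eqP; rewrite mulf_eq0 (gt_eqF (Phi_gen_gt0 s)) orbF => /eqP.
by apply/funext => j; rewrite c0 big_nil.
Qed.

(** The coordinates of h are [Phi i h / Phi i (gen i)]: subtracting the resulting combination leaves
    a function on which every [Phi t] vanishes. *)
Lemma ineq_cone_gen : ineq_cone n m = gen_cone.
Proof.
apply/seteqP; split=> h; last first.
  case=> c c0 hE; have -> : h = fun j => \sum_i c i * gen i j by apply/funext.
  split; first by apply: V_comb => i; apply: gen_V.
  move=> t tlt; rewrite (Phi_gen_comb c (Ordinal tlt)) mulr_ge0 //.
  exact: ltW (Phi_gen_gt0 (Ordinal tlt)).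
move=> [hV h0]; pose c (i : 'I_(m.+1 + n)) := Phi n m i h / Phi n m i (gen i).
exists c => [i|j]; first by rewrite divr_ge0 ?h0 // ltW // Phi_gen_gt0.
(* [None] carries h and [Some i] the subtracted generators, which makes the difference a single
   linear combination. *)
pose I := option 'I_(m.+1 + n).
pose v (x : I) := if x is Some i then gen i else h.
pose b (x : I) := if x is Some i then - c i else 1.
have vV x : V n m (v x) by case: x => // i; apply: gen_V.
have sumE (F : I -> rat) : \sum_(x <- None :: [seq Some i | i <- enum 'I_(m.+1 + n)]) F x = F None
  + \sum_i F (Some i).
  by rewrite big_cons big_map big_enum.
have := @Phi_separates n m (fun j => \sum_(x <- None :: [seq Some i | i <- enum 'I_(m.+1 + n)]) b
  x * v x j) (V_comb _ _ vV).
move=> /(_ _ j); rewrite sumE /= mul1r => /(_ _)/eqP.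
rewrite (eq_bigr (fun i => - (c i * gen i j))) => [|i _]; last by rewrite mulNr.
rewrite sumrN subr_eq0 => E; apply/eqP/E => t tlt.
rewrite (@Phi_comb n m n t I _ b v vV) sumE /= mul1r (bigD1 (Ordinal tlt)) //= big1 => [|i ne].
  by rewrite addr0 mulNr /c /= divfK ?subrr // gt_eqF // (Phi_gen_gt0 (Ordinal tlt)).
have := Phi_gen tlt (ltn_ord i); case: eqP => [ti|_ ->]; last by rewrite mulr0.
by case/eqP: ne; apply: val_inj.
Qed.

Lemma gen_cone_simplicial : simplicial_cone gen_cone.
Proof. by exists (m.+1 + n)%N, (fun i => gen i); split=> //; apply: gen_free. Qed.

Lemma gen_cone_extreme rho : extreme_ray gen_cone rho <->
  exists2 t, (t < m.+1 + n)%N & rho = ray (gen t).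
Proof.
have rayP (v : nat -> rat) : ray v v by exists 1 => // j; rewrite mul1r.
have memC (c : 'I_(m.+1 + n) -> rat) : (forall i, 0 <= c i) -> gen_cone (fun j =>
  \sum_i c i * gen i j).
  by move=> c0; exists c.
have oneC (t : 'I_(m.+1 + n)) a : 0 <= a -> gen_cone (fun j => a * gen t j).
  move=> a0; exists (fun i => if i == t then a else 0) => [i|j]; first by case: ifP.
  by rewrite (bigD1 t) //= eqxx big1 ?addr0 // => i /negPf ->; rewrite mul0r.
split=> [[[v [j0 vj0] ->] sub ext]|[t tlt ->]]; last first.
  split.
  - by exists (gen t) => //; exists 0%N; rewrite gen_0 // oner_eq0.
  - by move=> h [a a0 hE]; rewrite (_ : h = fun j => a * gen t j);
    [exact: (oneC (Ordinal tlt)) | apply/funext].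
  - move=> x y [c c0 xE] [d d0 yE] [a a0 sE].
    have H (s : 'I_(m.+1 + n)) : s != Ordinal tlt -> c s + d s = 0.
      move=> ne; suff /(_ s) : forall i, c i + d i - (if i == Ordinal tlt then a else 0) = 0.
        by rewrite (negPf ne) subr0.
      apply: gen_free => j; under eq_bigr do rewrite mulrBl mulrDl.
      rewrite sumrB big_split /= -xE -yE sE (bigD1 (Ordinal tlt)) //= eqxx big1 ?addr0 ?subrr //.
      by move=> i /negPf ->; rewrite mul0r.
    have H0 s : s != Ordinal tlt -> c s = 0 /\ d s = 0.
      by move=> ne; have /eqP := H s ne; rewrite paddr_eq0 // => /andP[/eqP -> /eqP ->].
    split; [exists (c (Ordinal tlt)) | exists (d (Ordinal tlt))] => // j; rewrite ?xE ?yE.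
    + by rewrite (bigD1 (Ordinal tlt)) //= big1 ?addr0 // => i /H0[-> _]; rewrite mul0r.
    + by rewrite (bigD1 (Ordinal tlt)) //= big1 ?addr0 // => i /H0[_ ->]; rewrite mul0r.
have [c c0 vE] := sub _ (rayP v).
have [t ct] : exists t, c t != 0.
  apply: contrapT => /forallNP ct; move/eqP: vj0; apply; rewrite vE big1 // => i _.
  by have /negP/negPn/eqP -> := ct i; rewrite mul0r.
exists t => //.
(* Extremality puts this nonzero term of v on the ray of v; its value at 0 is c t, so the factor b
   is nonzero and v is a multiple of [gen t]. *)
pose x j := c t * gen t j; pose y j := \sum_(i | i != t) c i * gen i j.
have yC : gen_cone y.
  exists (fun i => if i == t then 0 else c i) => [i|j]; first by case: ifP.
  by rewrite [RHS](bigD1 t) //= eqxx mul0r add0r; apply: eq_bigr => i /negPf ->.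
have [|[b b0 xE] _] := ext x y (oneC t _ (c0 t)) yC.
  by exists 1 => // j; rewrite mul1r vE (bigD1 t).
have bN0 : b != 0.
  apply: contra_neq ct => b0'; have := xE 0%N; rewrite /x gen_0 // mulr1 b0' mul0r.
  by [].
have vg j : v j = c t / b * gen t j.
  by apply: (mulfI bN0); rewrite -xE /x mulrA mulrCA divff // mulr1.
apply/seteqP; split=> h [a a0 hE].
  exists (a * (c t / b)) => [|j]; first by rewrite mulr_ge0 // divr_ge0.
  by rewrite hE vg mulrA.
exists (a * (b / c t)) => [|j]; first by rewrite mulr_ge0 // divr_ge0.
rewrite hE vg mulrA -(mulrA a) (_ : b / c t * (c t / b) = 1) ?mulr1 //.
by rewrite mulrACA mulrC; field; rewrite bN0 ct.
Qed.
End Generators.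

(** * Coordinates on V and closures *)

Lemma iter_psumK k f : iter k bdiff (iter k psum f) =1 f.
Proof.
elim: k f => [|k IH] f j //; rewrite iterSr [iter k.+1 psum f]iterS.
rewrite -[RHS]IH; elim: k {IH} (iter k psum f) j => [|k IH] g j; first exact: psumK.
by apply: eq_bdiff => i; apply: IH.
Qed.

Lemma eq_iter_psum k f g : f =1 g -> iter k psum f =1 iter k psum g.
Proof.
move=> fg; elim: k => [|k IH] j; first exact: fg.
by apply: eq_bigr => i _; apply: IH.
Qed.

Lemma iter_bdiffK k f : iter k psum (iter k bdiff f) =1 f.
Proof.
elim: k f => [|k IH] f j //; rewrite iterSr [iter k.+1 bdiff f]iterS -[RHS]IH.
by apply: eq_iter_psum => i; apply: bdiffK.
Qed.

Lemma iter_psum_sum k (I : Type) (r : seq I) (c : I -> rat) (f : I -> nat -> rat) j :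
  iter k psum (fun j => \sum_(i <- r) c i * f i j) j =
  \sum_(i <- r) c i * iter k psum (f i) j.
Proof.
elim: k j => [|k IH] j //.
transitivity (\sum_(l < j.+1) \sum_(i <- r) c i * iter k psum (f i) l).
  by apply: eq_bigr => l _; apply: IH.
by rewrite exchange_big /=; apply: eq_bigr => i _; rewrite mulr_sumr.
Qed.

Section Closure.
Variables k a : nat.

(* The coefficients of t^i / (1 - t)^k. *)
Definition Vbasis (i j : nat) : rat := iter k psum (fun l => (l == i)%:R) j.

Lemma Vbasis_V i : (i <= a + k)%N -> V k a (Vbasis i).
Proof.
move=> ia; apply/V_iter => j aj; rewrite /Vbasis iter_psumK.
by rewrite gtn_eqF // (leq_ltn_trans ia).
Qed.

Lemma Vbasis_coord h : V k a h ->
  h = fun j => \sum_(i < (a + k).+1) V_coord k a h 0 i * Vbasis i j.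
Proof.
move=> /V_iter hV; apply/funext => j; rewrite -iter_psum_sum -[LHS](iter_bdiffK k).
apply: eq_iter_psum => l; have [la|al] := leqP l (a + k).
  rewrite (bigD1 (Ordinal (la : (l < (a + k).+1)%N))) //= mxE numerator_coefE eqxx mulr1.
  rewrite big1 ?addr0 // => i ne; rewrite (_ : (l == i) = false) ?mulr0 //.
  by apply: contraNF ne => /eqP li; apply/eqP/val_inj.
rewrite hV // big1 // => i _; rewrite gtn_eqF ?mulr0 //.
exact: leq_trans (ltn_ord i) al.
Qed.

(** In coordinates Psi is Lipschitz with constant at most the sum of the |Psi (Vbasis i)|. If Psi h
    were negative, Psi would be negative on the ball of radius -Psi h / B around h; the summand 1 in
    B keeps it positive. *)
Lemma closure_ge0 (H : set (nat -> rat)) (Psi : (nat -> rat) -> rat) h :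
  (forall (I : Type) (r : seq I) (c : I -> rat) v, (forall i, V k a (v i)) ->
     Psi (fun j => \sum_(i <- r) c i * v i j) = \sum_(i <- r) c i * Psi (v i)) ->
  (forall h', H h' -> V k a h' /\ 0 <= Psi h') ->
  V k a h -> closure (V_coord k a @` H) (V_coord k a h) -> 0 <= Psi h.
Proof.
move=> lin HP hV cl; rewrite leNgt; apply/negP => lt0.
have PsiE g : V k a g -> Psi g = \sum_(i < (a + k).+1) V_coord k a g 0 i * Psi (Vbasis i).
  by move=> /Vbasis_coord {1}->; apply: lin => i; apply: Vbasis_V; rewrite -ltnS.
pose B := 1 + \sum_(i < (a + k).+1) `|Psi (Vbasis i)|.
have B0 : 0 < B by rewrite ltr_wpDr ?sumr_ge0.
have BN : B != 0 by rewrite gt_eqF.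
pose e := - Psi h / B; have e0 : 0 < e by rewrite divr_gt0 // oppr_gt0.
have [_ [[h' Hh' <-] [_ hh']]] := cl _ (nbhsx_ballx (V_coord k a h) e e0).
have [h'V P0] := HP h' Hh'.
suff : Psi h' - Psi h < - Psi h by rewrite addrC -subr_gt0 opprD addNKr oppr_gt0 ltNge P0.
rewrite !PsiE // -sumrB.
apply: (@le_lt_trans _ _ (\sum_(i < (a + k).+1) e * `|Psi (Vbasis i)|)).
  apply: ler_sum => i _; rewrite -mulrBl (le_trans (ler_norm _)) // normrM.
  by rewrite ler_wpM2r // distrC ltW //; apply: hh'.
rewrite -mulr_sumr -PsiE // -[- Psi h](divfK BN) -/e.
by rewrite ltr_pM2l // /B ltrDr.
Qed.
End Closure.

(** The sum is the value of the numerator at t = 1; if it vanishes, a factor 1 - t cancels. *)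
Lemma V_sumE n m h : V n.+1 m h ->
  \sum_(j < (m + n.+1).+1) numerator_coef n.+1 h j = 0 -> V n m h.
Proof.
move=> /V_iter hV s0; apply/V_iter => j; rewrite -addn1 => mj.
have bE : iter n bdiff h =1 psum (iter n.+1 bdiff h) by move=> i; rewrite bdiffK.
have e : iter n bdiff h (m + n).+1 = 0.
  by rewrite bE -[RHS]s0 addnS; apply: eq_bigr => i _; rewrite numerator_coefE.
rewrite addn1 in mj; rewrite -(subnKC mj); elim: (j - _)%N => [|i IH]; first by rewrite addn0.
rewrite addnS bE /psum big_ord_recr /= -/(psum _ _) -bE IH add0r.
by rewrite -iterS hV //; lia.
Qed.

(** Closures are only known to respect inequalities, so the equation of V_{n,m} in V_{n+1,m} is
    passed on as two of them. *)
Lemma closed_hull_sub n m (A : set (nat -> rat)) :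
  A `<=` ineq_cone n m -> closed_convex_hull_V n.+1 m A `<=` ineq_cone n m.
Proof.
move=> sub h [hV cl].
have hull h' : convex_hull A h' -> ineq_cone n m h'.
  case=> r [w [f [w0 _ Af hE]]]; have {hE} -> : h' = fun j => \sum_i w i * f i j by apply/funext.
  have fV i : V n m (f i) by case: (sub _ (Af i)).
  split=> [|t tlt]; first exact: V_comb.
  rewrite (@Phi_comb n m n) //; apply: sumr_ge0 => i _; rewrite mulr_ge0 //.
  by case: (sub _ (Af i)) => _; apply.
have numlin (I : Type) (r : seq I) (c : I -> rat) v j :
    numerator_coef n.+1 (fun j => \sum_(i <- r) c i * v i j) j =
    \sum_(i <- r) c i * numerator_coef n.+1 (v i) j.
  rewrite /numerator_coef; under eq_bigr do rewrite mulr_sumr.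
  rewrite exchange_big /=; apply: eq_bigr => i _; rewrite mulr_sumr.
  by apply: eq_bigr => l _; rewrite mulrCA.
pose sg h := \sum_(j < (m + n.+1).+1) numerator_coef n.+1 h j.
have sglin (I : Type) (r : seq I) (c : I -> rat) v :
    sg (fun j => \sum_(i <- r) c i * v i j) = \sum_(i <- r) c i * sg (v i).
  rewrite /sg; under eq_bigr do rewrite numlin.
  by rewrite exchange_big /=; apply: eq_bigr => i _; rewrite mulr_sumr.
have sg0 h' : V n m h' -> sg h' = 0.
  move=> /V_iter h'V; transitivity (psum (bdiff (iter n bdiff h')) (m + n.+1)).
    by apply: eq_bigr => j _; rewrite numerator_coefE.
  by rewrite bdiffK h'V //; lia.
have hVn : V n m h.
  apply: V_sumE => //; apply/eqP; rewrite eq_le -/(sg h) -oppr_ge0; apply/andP; split.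
    apply: (closure_ge0 (Psi := fun h => - sg h) _ _ hV cl) => [I r c v _|h' /hull[h'V _]].
      by rewrite sglin -sumrN; apply: eq_bigr => i _; rewrite mulrN.
    by rewrite sg0 // oppr0; split=> //; apply: V_subS.
  apply: (closure_ge0 _ _ hV cl) => [I r c v _|h' /hull[h'V _]]; first exact: sglin.
  by rewrite sg0 //; split=> //; apply: V_subS.
split=> // t tlt; apply: (closure_ge0 _ _ hV cl) => [I r c v vV|h' /hull[h'V]].
  exact: Phi_comb vV.
by move=> /(_ t tlt) P0; split=> //; apply: V_subS.
Qed.

Lemma sub_closed_hull n m (A : set (nat -> rat)) :
  (forall (t N : nat), (t < m.+1 + n)%N -> A (fun j => N%:R * gen n m t j)) ->
  gen_cone n m `<=` closed_convex_hull_V n.+1 m A.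
Proof.
move=> HA h hC; have : ineq_cone n m h by rewrite ineq_cone_gen.
case=> hV _; split; first exact: V_subS.
apply: subset_closure; exists h => //.
case: hC => c c0 hE.
(* With N >= s, the weights c_i / N on N copies of the generators have sum at most 1; the missing
   weight 1 - s / N goes to the zero function. *)
pose s := \sum_i c i; pose N := (Num.bound s).+1.
have sN : s <= N%:R.
  have := archi_boundP (x := `|s|); rewrite normr_ge0 => /(_ isT) b.
  rewrite (le_trans (ler_norm s)) // (le_trans (ltW b)) // ler_nat /N /Num.bound normr_id.
  exact: leqnSn.
have N0 : N%:R != 0 :> rat by rewrite pnatr_eq0.
have Ngt : 0 < N%:R :> rat by rewrite ltr0n.
exists (m.+1 + n).+1.
exists (fun i => if unlift ord0 i is Some i then c i / N%:R else 1 - s / N%:R).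
exists (fun i => if unlift ord0 i is Some i then (fun j => N%:R * gen n m i j) else (fun j =>
  0%:R * gen n m 0 j)).
split.
- move=> i; case: unliftP => [i' _|_]; first by rewrite divr_ge0 // ltW.
  by rewrite subr_ge0 ler_pdivrMr // mul1r.
- rewrite big_ord_recl unlift_none; under eq_bigr do rewrite liftK.
  by rewrite -mulr_suml subrK.
- by move=> i; case: unliftP => [i' _|_]; apply: HA.
- move=> j; rewrite big_ord_recl unlift_none mul0r mulr0 add0r hE.
  apply: eq_bigr => i _; rewrite liftK; by field.
Qed.

(** * The modules S / <x_0, ..., x_{r-1}>^e *)

Section KrullDimension.
Variables (K : fieldType) (n : nat).
Local Notation S := {mpoly K[n.+1]}.

Lemma kill_coef r (p : S) :
  (forall c : 'X_{1..n.+1}, (forall l : 'I_n.+1, (l < r)%N -> c l = 0%N) -> p@_c = 0) ->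
  kill r p = 0.
Proof.
move=> p0; case E: (kill_rmorph K n.+1 r) => [f Hf].
rewrite [p]mpolyE Hf rmorph_sum big1_seq //= => m _.
have [c0|] := boolP [forall l : 'I_n.+1, (l < r)%N ==> (m l == 0%N)].
  rewrite p0 ?scale0r ?rmorph0 // => l lr.
  by move/forallP/(_ l): c0; rewrite lr => /eqP.
rewrite negb_forall => /existsP[l]; rewrite negb_imply => /andP[lr ml].
rewrite -Hf killZ (_ : 'X_[m] = 'X_[m - U_(l)] * 'X_l); last first.
  by rewrite -mpolyXD submK // lep1mP.
by rewrite killM kill_var lr mulr0 scaler0.
Qed.

Definition deg_le k (p : S) := forall m, m \in msupp p -> (mdeg m <= k)%N.

Lemma deg_leM k l p q : deg_le k p -> deg_le l q -> deg_le (k + l) (p * q).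
Proof.
move=> pk ql m /msuppM_le /allpairsP[[a b] [/= ap bq ->]].
by rewrite mdegD leq_add ?pk ?ql.
Qed.

Lemma deg_leX k i p : deg_le k p -> deg_le (i * k) (p ^+ i).
Proof.
move=> pk; elim: i => [|i IH]; last by rewrite exprS mulSn; apply: deg_leM.
by move=> m; rewrite expr0 mul0n msupp1 inE => /eqP ->; rewrite mdeg0.
Qed.

Lemma deg_le_prod I (r : seq I) k (F : I -> S) : (forall i, deg_le k (F i)) ->
  deg_le (size r * k) (\prod_(i <- r) F i).
Proof.
move=> Fk; elim: r => [|i r IH]; last by rewrite big_cons mulSn; apply: deg_leM.
by move=> m; rewrite big_nil msupp1 inE => /eqP ->; rewrite mdeg0.
Qed.

(* There are D^(n+1) products a^f with exponents below D, and fewer monomials in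
   the variables other than x_0 that can occur in them. *)
Lemma alg_dependent (a : 'I_n.+1 -> S) : exists D (v : {ffun 'I_n.+1 -> 'I_D} -> K),
  (exists f, v f != 0) /\ kill 1 (\sum_f v f *: \prod_i a i ^+ f i) = 0.
Proof.
pose s := (\max_i msize (a i))%N.
have as_ i : deg_le s (a i).
  move=> m ma; rewrite (leq_trans _ (leq_bigmax (F := fun i => msize (a i)) i)) // ltnW //.
  exact: msize_mdeg_lt.
(* The products have degree at most (n + 1) D s < B, and B <= C D, so that B^n <= C^n D^n < D^(n+1)
   because C^n < D. *)
pose C := (n.+1 * s).+1; pose D := (C ^ n).+1; pose B := (n.+1 * (D * s)).+1.
have BD : (B ^ n < D ^ n.+1)%N.
  apply: (@leq_ltn_trans (C ^ n * D ^ n)).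
    have leX x y k : (x <= y)%N -> (x ^ k <= y ^ k)%N by case: k => // k; rewrite leq_exp2r.
    by rewrite -expnMn; apply: leX; rewrite /B /C; nia.
  by rewrite expnS ltn_mul2r expn_gt0 /= ltnSn.
pose E := {ffun 'I_n.+1 -> 'I_D}; pose G := {ffun 'I_n -> 'I_B}.
pose mG (c : G) : 'X_{1..n.+1} :=
  [multinom (if unlift ord0 l is Some l' then c l' : nat else 0%N) | l < n.+1].
pose ma (f : E) : S := \prod_i a i ^+ f i.
have maD f : deg_le (n.+1 * (D * s)) (ma f).
  rewrite -[X in deg_le (X * _)](size_enum_ord n.+1) /ma -big_enum; apply: deg_le_prod => i m mi.
  by rewrite (leq_trans (deg_leX (as_ i) mi)) // leq_mul2r ltnW ?orbT.
pose A : 'M[K]_(#|{: E}|, #|{: G}|) := \matrix_(x, y) (ma (enum_val x))@_(mG (enum_val y)).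
have nz : kermx A != 0.
  rewrite -mxrank_eq0 mxrank_ker subn_eq0 -ltnNge (leq_ltn_trans (rank_leq_col _)) //.
  by rewrite !card_ffun !card_ord.
have [x vx] : exists x, row x (kermx A) != 0.
  by apply: contrapT => /forallNP H; case/eqP: nz; apply/row_matrixP => x; rewrite row0;
    apply/eqP/negPn/negP/H.
have vA : row x (kermx A) *m A = 0 by apply/sub_kermxP/row_sub.
exists D, (fun f => row x (kermx A) 0 (enum_rank f)); split.
  apply: contrapT => /forallNP H; case/eqP: vx; apply/rowP => y; rewrite [RHS]mxE.
  by have /negP/negPn/eqP := H (enum_val y); rewrite enum_valK.
apply: kill_coef => c c0; rewrite linear_sum /=.
have [cB|Bc] := ltnP (mdeg c) B; last first.
  rewrite big1 // => f _; rewrite mcoeffZ memN_msupp_eq0 ?mulr0 //.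
  by apply: contraL Bc => /maD; rewrite -ltnNge /B ltnS.
have clt (l : 'I_n.+1) : (c l < B)%N.
  by rewrite (leq_ltn_trans _ cB) // mdegE (bigD1 l) //= leq_addr.
pose y : G := [ffun l => Ordinal (clt (lift ord0 l))].
have cE : c = mG y.
  apply/mnmP => l; rewrite mnmE; case: unliftP => [l' ->|->]; first by rewrite ffunE.
  by rewrite c0.
have /rowP/(_ (enum_rank y)) := vA; rewrite !mxE => E0; rewrite -[RHS]E0.
rewrite [RHS](reindex _ (onW_bij _ (@enum_rank_bij _))) /=; apply: eq_bigr => f _.
by rewrite mcoeffZ !mxE !enum_rankK -cE.
Qed.

(** Elements a_i of P_(i+1) outside P_i satisfy a polynomial relation modulo x_0, hence in P_0.
    Going up the chain, the lowest power of a_j is cancelled in P_j, and the terms still divisible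
    by a_j vanish modulo P_(j+1); a nonzero constant in P_(n+1) remains. *)
Lemma no_prime_chain (P : nat -> {pred S}) :
  (forall i, (i <= n.+1)%N -> idealr_closed (P i) /\ prime_idealr_closed (P i)) ->
  (forall i, (i < n.+1)%N -> {subset P i <= P i.+1} /\ ~ {subset P i.+1 <= P i}) ->
  'X_ord0 \in P 0%N -> False.
Proof.
move=> PP chain X0.
have id0 i : (i <= n.+1)%N -> 0 \in P i by move=> /PP[[]].
have idM i p q : (i <= n.+1)%N -> q \in P i -> p * q \in P i.
  by move=> /PP[[P0 _ PD] _] qP; rewrite -[_ * _]addr0 PD.
have idD i p q : (i <= n.+1)%N -> p \in P i -> q \in P i -> p + q \in P i.
  by move=> /PP[[P0 _ PD] _] pP qP; rewrite -[p]mul1r PD.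
have idB i p q : (i <= n.+1)%N -> p \in P i -> q \in P i -> p - q \in P i.
  by move=> il pP qP; rewrite addrC -mulN1r; case/PP: il => -[_ _ PD] _; apply: PD.
have idS i (I : Type) (r : seq I) (Q : pred I) (F : I -> S) : (i <= n.+1)%N ->
    (forall k, Q k -> F k \in P i) -> \sum_(k <- r | Q k) F k \in P i.
  move=> il H; elim/big_rec: _ => [|k x Qk xP]; first exact: id0.
  by apply: idD => //; apply: H.
have Ha (i : 'I_n.+1) : exists a, a \in P i.+1 /\ a \notin P i.
  have [_ nsub] := chain i (ltn_ord i); apply: contrapT => /forallNP H; apply: nsub => a aP.
  by apply/negPn/negP => aN; apply: (H a).
pose a i := sval (cid (Ha i)).
have aP i : a i \in P i.+1 by case: (svalP (cid (Ha i))).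
have aN i : a i \notin P i by case: (svalP (cid (Ha i))).
have idXN (i : 'I_n.+1) k p : a i ^+ k * p \in P i -> p \in P i.
  elim: k => [|k IH]; first by rewrite expr0 mul1r.
  have [_ pr] := PP i (ltnW (ltn_ord i)).
  by rewrite exprS -mulrA => /pr; rewrite (negPf (aN i)).
have [D [v [[f0 vf0] vQ]]] := alg_dependent a.
(* In P_j, the terms of the relation whose exponents of a_0, ..., a_(j-1) are the
   successively minimal ones sum to zero after these powers are cancelled. *)
have stage j : (j <= n.+1)%N -> exists f : {ffun 'I_n.+1 -> 'I_D}, v f != 0 /\
    \sum_(h : {ffun 'I_n.+1 -> 'I_D} | [forall i : 'I_n.+1, (i < j)%N ==> (h i == f i)])
      v h *: \prod_(i : 'I_n.+1 | (j <= i)%N) a i ^+ h i \in P j.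
  elim: j => [_|j IH jn].
    exists f0; split=> //; have /kill_eq0P[c] := vQ; rewrite big_ord1 => E.
    rewrite (_ : \sum_(h | _) _ = c 0%N * xvar K n.+1 0).
      by apply: idM => //; rewrite (xvarE K (@ord0 n)).
    rewrite -E; apply: eq_big => [h|h _]; first by apply/forallP.
    by congr (_ *: _); apply: eq_bigl.
  have [f [vf Qf]] := IH (ltnW jn); pose J := Ordinal jn.
  pose agree (h : {ffun 'I_n.+1 -> 'I_D}) := [forall i : 'I_n.+1, (i < j)%N ==> (h i == f i)].
  have f_ok : (v f != 0) && agree f by rewrite vf; apply/forallP => i; rewrite eqxx implybT.
  case: (@arg_minnP _ f (fun h => (v h != 0) && agree h) (fun h : {ffun 'I_n.+1 -> 'I_D} =>
    h J : nat) f_ok) => g /andP[vg gf] gmin.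
  exists g; split=> //; set k := g J : nat.
  pose rest (h : {ffun 'I_n.+1 -> 'I_D}) : S := \prod_(i : 'I_n.+1 | (j < i)%N) a i ^+ h i.
  have prodE (h : {ffun 'I_n.+1 -> 'I_D}) : \prod_(i : 'I_n.+1 | (j <= i)%N) a i ^+ h i = a J ^+ h
    J * rest h.
    rewrite (bigD1 J) //=; congr (_ * _); apply: eq_bigl => i.
    by rewrite ltn_neqAle [(i == J)]eq_sym -val_eqE /= andbC.
  pose R : S := \sum_(h | agree h) v h *: (a J ^+ (h J - k) * rest h).
  have RP : R \in P j.
    apply: (@idXN J k).
    suff -> : a J ^+ k * R = \sum_(h | agree h) v h *: \prod_(i : 'I_n.+1 | (j <= i)%N) a i ^+ h i
      by [].
    rewrite mulr_sumr; apply: eq_bigr => h hf; rewrite prodE.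
    have [->|vh] := eqVneq (v h) 0; first by rewrite !scale0r mulr0.
    by rewrite -scalerAr mulrA -exprD subnKC // gmin // vh.
  have {}RP : R \in P j.+1 by case: (chain j jn) => + _; apply.
  rewrite /R (bigID (fun h : {ffun 'I_n.+1 -> 'I_D} => h J == g J)) /= in RP.
  set R1 := (X in X + _ \in _) in RP; set R2 := (X in _ + X \in _) in RP.
  have R2P : R2 \in P j.+1.
    apply: idS => // h /andP[hf hJ].
    have [->|vh] := eqVneq (v h) 0; first by rewrite scale0r id0.
    have : (k < h J)%N.
      rewrite ltn_neqAle gmin ?vh // andbT; apply: contraNneq hJ => e.
      by apply/eqP/val_inj.
    rewrite -subn_gt0; case: (h J - k)%N => // i _.
    rewrite (_ : _ *: _ = ((v h)%:MP * (a J ^+ i * rest h)) * a J); last first.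
      by rewrite -mul_mpolyC exprSr; ring.
    by apply: idM => //; apply: (aP J).
  have := idB _ _ _ jn RP R2P; rewrite addrK.
  suff -> : R1 = \sum_(h : {ffun 'I_n.+1 -> 'I_D} | [forall i : 'I_n.+1, (i < j.+1)%N ==>
    (h i == g i)])
      v h *: \prod_(i : 'I_n.+1 | (j < i)%N) a i ^+ h i by [].
  apply: eq_big => [h|h /andP[_ /eqP hJ]]; last by rewrite /k -hJ subnn expr0 mul1r.
  apply/andP/forallP => [[/forallP hf /eqP hJ] i|H].
    apply/implyP; rewrite ltnS leq_eqVlt => /predU1P[ij|ij].
      by rewrite (_ : i = J) ?hJ //; apply: val_inj.
    by have /implyP/(_ ij)/eqP -> := hf i; have /forallP/(_ i)/implyP/(_ ij) := gf; rewrite eq_sym.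
  split; last by have /implyP := H J; apply.
  apply/forallP => i; apply/implyP => ij.
  have /implyP/(_ (ltnW ij))/eqP -> := H i.
  by have /forallP/(_ i)/implyP/(_ ij) := gf.
have [f [vf]] := stage n.+1 (leqnn _).
rewrite (big_pred1 f) => [|h]; last first.
  apply/forallP/eqP => [H|-> i]; last by rewrite eqxx implybT.
  by apply/ffunP => i; have /implyP/(_ (ltn_ord i))/eqP := H i.
rewrite big_pred0 => [|i]; last by rewrite leqNgt ltn_ord.
move=> vP; have [[_ /negP P1 _] _] := PP n.+1 (leqnn _); apply: P1.
rewrite (_ : 1 = (v f)^-1%:MP * (v f *: 1)); first exact: idM.
by rewrite mul_mpolyC scalerA mulVf // scale1r.
Qed.

Lemma krull_dim_lt (M : gradedModule K n) e :
  (forall u : M, 'X_ord0 ^+ e *: u = 0) -> ~ krull_dim_ge M n.+1.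
Proof.
move=> Me [P [PP chain]]; apply: (@no_prime_chain P _ chain) => [i /PP[]//|].
have [[P0 P1 _] pr H] := PP 0%N (leq0n _).
have : 'X_ord0 ^+ e \in P 0%N by apply: H => u; apply: Me.
elim: e {Me} => [|e IH]; first by rewrite expr0 (negPf P1).
by rewrite exprS => /pr/orP[].
Qed.
End KrullDimension.

(** * Powers of ideals generated by variables *)

Section PartialDegree.
Variables (n : nat) (r : nat).

Definition pdeg (c : 'X_{1..n.+1}) : nat := (\sum_(l < n.+1 | (l < r)%N) c l)%N.

Lemma pdegD c c' : pdeg (c + c')%MM = (pdeg c + pdeg c')%N.
Proof. by rewrite /pdeg -big_split /=; apply: eq_bigr => l _; rewrite mnmDE. Qed.

Lemma pdegU (l : 'I_n.+1) : pdeg U_(l)%MM = (l < r)%N.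
Proof.
rewrite /pdeg; under eq_bigr do rewrite mnm1E.
rewrite -big_mkcondr /= sum1_card; case: ltnP => lr.
  rewrite (@eq_card1 _ l) // => l'; rewrite unfold_in inE /= andbC eq_sym.
  by case: eqP => // ->; rewrite lr.
rewrite eq_card0 // => l'; rewrite unfold_in /= andbC.
by case: eqP => // <-; rewrite ltnNge lr.
Qed.

Lemma pdeg_gt0 c : (0 < pdeg c)%N -> exists2 l : 'I_n.+1, (l < r)%N & c l != 0%N.
Proof.
move=> c0; apply/exists_inP; apply: contraLR c0 => /exists_inPn H.
by rewrite -leqNgt leqn0 /pdeg big1 // => l lr; apply/eqP/negPn/H.
Qed.
End PartialDegree.

Section MonomialIdeal.
Variables (K : fieldType) (n r : nat).
Local Notation S := {mpoly K[n.+1]}.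

(* hasord e p iff p lies in <x_0, ..., x_{r-1}>^e. *)
Definition hasord e (p : S) : Prop := forall c, (pdeg r c < e)%N -> p@_c = 0.

Lemma hasord0 e : hasord e 0.
Proof. by move=> c _; rewrite mcoeff0. Qed.

Lemma hasordD e p q : hasord e p -> hasord e q -> hasord e (p + q).
Proof. by move=> pe qe c ce; rewrite mcoeffD pe // qe // addr0. Qed.

Lemma hasord_sum e (I : Type) (s : seq I) (P : pred I) (F : I -> S) :
  (forall i, P i -> hasord e (F i)) -> hasord e (\sum_(i <- s | P i) F i).
Proof.
move=> Fe; elim/big_rec: _ => [|i x Pi]; first exact: hasord0.
by apply: hasordD; apply: Fe.
Qed.

Lemma hasordM a b p q : hasord a p -> hasord b q -> hasord (a + b) (p * q).
Proof.
move=> pa qb c cab; apply: memN_msupp_eq0; apply/negP => /msuppM_le.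
move=> /allpairsP[[x y] [/= xp yq cE]]; move: cab; rewrite cE pdegD ltnNge leq_add //.
  by rewrite leqNgt; apply/negP => /pa /eqP; rewrite mcoeff_eq0 xp.
by rewrite leqNgt; apply/negP => /qb /eqP; rewrite mcoeff_eq0 yq.
Qed.

Lemma hasord_all p : hasord 0 p.
Proof. by []. Qed.

Lemma hasord_mull e p q : hasord e q -> hasord e (p * q).
Proof. exact: (@hasordM 0 e). Qed.

Lemma hasordX c : hasord (pdeg r c) 'X_[c].
Proof. by move=> c'; rewrite mcoeffX; case: eqP => // ->; rewrite ltnn. Qed.

Lemma hasord_le e e' p : (e' <= e)%N -> hasord e p -> hasord e' p.
Proof. by move=> le pe c ce; apply: pe; apply: leq_trans le. Qed.
End MonomialIdeal.

Section IdealPow.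
Variables (K : fieldType) (n : nat).
Local Notation S := {mpoly K[n.+1]}.

(** From a monomial of degree at least e in x_0, ..., x_i, e of these variables are split off one by
    one; conversely, orders of vanishing add up in products. *)
Lemma ideal_powP (i e : nat) (p : S) :
  ideal_pow (@var_ideal K n i) e p <-> hasord i.+1 e p.
Proof.
have var1 (q : S) : var_ideal i q -> hasord i.+1 1 q.
  case=> s [c [a [aX ->]]]; apply: hasord_sum => k _; apply: hasord_mull.
  case: (aX k) => l li ->; have := @hasordX K n i.+1 U_(l)%MM.
  by rewrite pdegU ltnS li.
split=> [[s [c [a [aP ->]]]]|pe].
  apply: hasord_sum => k _; apply: hasord_mull; case: (aP k) => f [fI ->].
  elim: e f fI {c a aP} => [|e IH] f fI; first exact: hasord_all.
  rewrite big_ord_recl; apply: (@hasordM K n i.+1 1 e); first exact: var1.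
  by apply: IH => j; apply: fI.
have mon c : (e <= pdeg i.+1 c)%N -> exists f : 'I_e -> S,
    (forall j, var_ideal i (f j)) /\ exists q, 'X_[c] = q * \prod_j f j.
  elim: e c {pe} => [|e IH] c ec.
    by exists (fun=> 0); split=> [[]//|]; exists 'X_[c]; rewrite big_ord0 mulr1.
  have [l li cl] : exists2 l : 'I_n.+1, (l < i.+1)%N & c l != 0%N.
    by apply: pdeg_gt0; apply: leq_trans ec.
  have cE : c = ((c - U_(l)) + U_(l))%MM by rewrite submK // lep1mP.
  have [|f [fI [q qE]]] := IH (c - U_(l))%MM.
    by move: ec; rewrite {1}cE pdegD pdegU li addn1 ltnS.
  exists (fun j => if unlift ord0 j is Some j' then f j' else 'X_l); split=> [j|].
    case: unliftP => [j' _|_] //; exists 1%N, (fun=> 1), (fun=> 'X_l).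
    by split=> [_|]; [exists l | rewrite big_ord1 mul1r].
  exists q; rewrite big_ord_recl unlift_none; under eq_bigr do rewrite liftK.
  by rewrite {1}cE mpolyXD qE; ring.
have Hx (x : seq_sub (msupp p)) : exists f : 'I_e -> S, (forall j, var_ideal i (f j)) /\
    exists q, 'X_[ssval x] = q * \prod_j f j.
  apply: mon; rewrite leqNgt; apply/negP => /pe /eqP.
  by rewrite mcoeff_eq0 ssvalP.
pose f x := sval (cid (Hx x)).
have fI x j : var_ideal i (f x j) by exact: (svalP (cid (Hx x))).1.
have Hq x : exists q, 'X_[ssval x] = q * \prod_j f x j by exact: (svalP (cid (Hx x))).2.
pose q x := sval (cid (Hq x)).
exists #|{: seq_sub (msupp p)}|, (fun k => p@_(ssval (enum_val k)) *: q (enum_val k)),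
  (fun k => \prod_j f (enum_val k) j); split=> [k|].
  by exists (f (enum_val k)); split.
rewrite -(reindex _ (onW_bij xpredT (@enum_val_bij _)) (F := fun x =>
  p@_(ssval x) *: q x * \prod_j f x j)) /=.
apply/mpolyP => c; rewrite linear_sum /=.
have E x : (p@_(ssval x) *: q x * \prod_j f x j)@_c = p@_(ssval x) * (ssval x == c)%:R.
  by rewrite -scalerAl -(svalP (cid (Hq x))) mcoeffZ mcoeffX.
under eq_bigr do rewrite E.
have [cp|cp] := boolP (c \in msupp p).
  rewrite (bigD1 (SeqSub cp)) //= eqxx mulr1 big1 ?addr0 // => x ne.
  by rewrite (negPf (_ : ssval x != c)) ?mulr0.
rewrite (memN_msupp_eq0 cp) big1 // => x _; case: eqP => [xc|_]; last by rewrite mulr0.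
by move: cp; rewrite -xc ssvalP.
Qed.
End IdealPow.

(** * Counting standard monomials *)

Section Counting.

(** Exponent vectors are built from the left, so that the recursion removes the last variable, as
    that of [cnt] does for the free variables. *)
Fixpoint compositions (k d : nat) : seq (seq nat) :=
  if k is k'.+1 then [seq rcons s t | t <- iota 0 d.+1, s <- compositions k' (d - t)]
  else if d == 0%N then [:: [::]] else [::].

Lemma compositionsS k d : compositions k.+1 d =
  [seq rcons s t | t <- iota 0 d.+1, s <- compositions k (d - t)].
Proof. by []. Qed.

Lemma mem_compositions k d s : (s \in compositions k d) = (size s == k) && (sumn s == d).
Proof.
elim: k d s => [|k IH] d s.
  by case: s => [|x s]; case: d => [|d].
rewrite compositionsS; apply/allpairsPdep/idP => [[t [s' [+ + ->]]]|].
  rewrite mem_iota add0n ltnS => /andP[_ td]; rewrite IH => /andP[/eqP <- /eqP sE].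
  rewrite size_rcons eqxx sumn_rcons sE. by rewrite subnK //= eqxx.
case/lastP: s => // s t; rewrite size_rcons eqSS sumn_rcons => /andP[/eqP sk /eqP sd].
exists t, s; rewrite mem_iota IH sk eqxx -sd addnK eqxx; split=> //.
by rewrite add0n ltnS leq_addl.
Qed.

Lemma uniq_compositions k d : uniq (compositions k d).
Proof.
elim: k d => [|k IH] d; first by rewrite /=; case: ifP.
rewrite compositionsS; apply: allpairs_uniq_dep => //; first exact: iota_uniq.
by move=> [t s] [t' s'] _ _ /= /rcons_inj[-> ->].
Qed.

Definition ncomp r e k d := count (fun s => sumn (take r s) < e)%N (compositions k d).

Lemma sum_rev (f : nat -> nat) d :
  (\sum_(t < d.+1) f (d - t) = \sum_(t < d.+1) f t)%N.
Proof.
rewrite (reindex_inj rev_ord_inj) /=; apply: eq_bigr => t _.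
by rewrite subSS subKn // -ltnS.
Qed.

Lemma ncompS r e k d : (r <= k)%N ->
  ncomp r e k.+1 d = (\sum_(t < d.+1) ncomp r e k t)%N.
Proof.
move=> rk; rewrite -(sum_rev (ncomp r e k)) /ncomp compositionsS count_flatten -map_comp sumnE
  big_map.
rewrite -[RHS](big_mkord xpredT (fun t => count _ (compositions k (d - t)))).
rewrite /index_iota subn0; apply: eq_bigr => t _ /=; rewrite count_map.
apply: eq_in_count => s; rewrite mem_compositions => /andP[/eqP sk _] /=.
by rewrite -cats1 takel_cat ?sk.
Qed.

Lemma size_compositions k d : size (compositions k d) = nmon k d.
Proof.
elim: k d => [|k IH] d; first by rewrite /=; case: eqP.
rewrite compositionsS size_allpairs_dep sumnE big_map [RHS]/= -(sum_rev (nmon k)).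
rewrite -[RHS](big_mkord xpredT (fun t => nmon k (d - t))) /index_iota subn0.
by apply: eq_bigr => t _; rewrite IH.
Qed.

Lemma ncompE r e b d : ncomp r e (b + r) d = cnt r e b d.
Proof.
elim: b d => [|b IH] d; last first.
  by rewrite addSn ncompS ?leq_addl //; apply: eq_bigr => t _; rewrite IH.
rewrite /= /ncomp add0n -size_compositions; case: ltnP => de;
  [rewrite -count_predT|rewrite -(count_pred0 (compositions r d))].
all: apply: eq_in_count => s; rewrite mem_compositions => /andP[/eqP sr /eqP sd] /=.
all: by rewrite take_oversize ?sr // sd ?de // ltnNge de.
Qed.

Lemma sumn_take r (s : seq nat) :
  sumn (take r s) = (\sum_(0 <= i < size s | (i < r)%N) nth 0%N s i)%N.
Proof.
elim: s r => [|x s IH] r; first by rewrite big_geq.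
case: r => [|r]; first by rewrite big_pred0.
by rewrite /= IH big_mkcond [RHS]big_mkcond big_nat_recl.
Qed.

Lemma count_std n r e d : (r <= n.+1)%N ->
  count (fun c => pdeg r c < e)%N (mons n d) = cnt r e (n.+1 - r) d.
Proof.
move=> rn; rewrite -ncompE subnK // /ncomp.
pose f (c : 'X_{1..n.+1}) : seq nat := tval (multinom_val c).
have finj : injective f by move=> c c' e1; apply: val_inj; apply: val_inj.
have perm : perm_eq (map f (mons n d)) (compositions n.+1 d).
  apply: uniq_perm; first by rewrite map_inj_uniq // uniq_mons.
    exact: uniq_compositions.
  move=> s; rewrite mem_compositions; apply/mapP/andP => [[c]|[/eqP sn /eqP sd]].
    by rewrite mem_mons => /eqP <- ->; rewrite size_tuple /mdeg sumnE.
  have ssz : size s == n.+1 by rewrite sn.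
  exists [multinom (Tuple ssz)] => //.
  by rewrite mem_mons /mdeg -sumnE /= sd.
have /permP/(_ (fun s => sumn (take r s) < e)%N) := perm; rewrite count_map => <-.
apply: eq_in_count => c _ /=.
rewrite sumn_take size_tuple big_mkord /pdeg; congr (_ < _)%N.
by apply: eq_bigr => l _; rewrite (mnm_nth 0%N).
Qed.
End Counting.

(** * The quotient modules on normal forms *)

Section NormalForms.
Variables (K : fieldType) (n r e : nat).
Local Notation S := {mpoly K[n.+1]}.

(* Normal form of p modulo <x_0, ..., x_{r-1}>^e. *)
Definition nf (p : S) : S := \sum_(c <- msupp p | (pdeg r c < e)%N) p@_c *: 'X_[c].

Lemma nf_coef p c : (nf p)@_c = if (pdeg r c < e)%N then p@_c else 0.
Proof.
rewrite /nf linear_sum /= -big_filter.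
have E c' : (p@_c' *: 'X_[c'])@_c = p@_c' * (c' == c)%:R by rewrite mcoeffZ mcoeffX.
under eq_bigr do rewrite E.
have [cs|cs] := boolP (c \in [seq c <- msupp p | (pdeg r c < e)%N]).
  rewrite (bigD1_seq c) ?filter_uniq ?msupp_uniq //= eqxx mulr1 big1 ?addr0.
    by move: cs; rewrite mem_filter => /andP[->].
  by move=> c' /negPf ->; rewrite mulr0.
rewrite big1_seq => [|c' /= c's].
  case: ifP => // ce; rewrite memN_msupp_eq0 //.
  by move: cs; rewrite mem_filter ce.
case: eqP => [cc|_]; last by rewrite mulr0.
by move: cs; rewrite -cc c's.
Qed.

Lemma nfK p : nf (nf p) = nf p.
Proof. by apply/mpolyP => c; rewrite !nf_coef; case: (pdeg r c < e)%N. Qed.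

Lemma nfD p q : nf (p + q) = nf p + nf q.
Proof. by apply/mpolyP => c; rewrite mcoeffD !nf_coef mcoeffD; case: (pdeg r c < e)%N;
  rewrite ?addr0. Qed.

Lemma nfN p : nf (- p) = - nf p.
Proof. by apply/mpolyP => c; rewrite mcoeffN !nf_coef mcoeffN; case: (pdeg r c < e)%N;
  rewrite ?oppr0. Qed.

Lemma nf_eq0 p : nf p = 0 <-> hasord r e p.
Proof.
split=> [p0 c ce|pe]; first by have := nf_coef p c; rewrite p0 mcoeff0 ce.
by apply/mpolyP => c; rewrite nf_coef mcoeff0; case: ifP => // /pe.
Qed.

Lemma nf0 : nf 0 = 0.
Proof. by apply/nf_eq0/hasord0. Qed.

Lemma nf_sum I (s : seq I) (F : I -> S) : nf (\sum_(i <- s) F i) = \sum_(i <- s) nf (F i).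
Proof. by elim/big_rec2: _ => [|i x y _ <-]; rewrite ?nf0 ?nfD. Qed.

Lemma nf_mulr p q : nf (p * nf q) = nf (p * q).
Proof.
apply/eqP; rewrite eq_sym -subr_eq0 -nfN -nfD -mulrBr; apply/eqP/nf_eq0.
by apply: hasord_mull; apply/nf_eq0; rewrite nfD nfN nfK subrr.
Qed.

Lemma nf_homog d p : p \is d.-homog -> nf p \is d.-homog.
Proof.
move=> ph; apply/dhomogP => c; rewrite mcoeff_msupp nf_coef.
case: ifP => _; last by rewrite eqxx.
by rewrite -mcoeff_msupp; apply: (dhomogP _ _ _ ph).
Qed.

(** The quotient is carried by its normal forms, a subtype of S, which gives each class a canonical
    representative. *)
Record nform := NForm { nf_val : S; _ : nf nf_val == nf_val }.
HB.instance Definition _ := [isSub for nf_val].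
HB.instance Definition _ := [Choice of nform by <:].

Lemma mk_nf_subproof p : nf (nf p) == nf p.
Proof. by rewrite nfK. Qed.
Definition mk_nf p : nform := NForm (mk_nf_subproof p).

Lemma nf_valK u : nf (nf_val u) = nf_val u.
Proof. by apply/eqP; case: u. Qed.

Lemma nform_inj u v : nf_val u = nf_val v -> u = v.
Proof. exact: val_inj. Qed.

Definition nf_add u v := mk_nf (nf_val u + nf_val v).
Definition nf_opp u := mk_nf (- nf_val u).
Definition nf_scale p u := mk_nf (p * nf_val u).

Lemma nf_addA : associative nf_add.
Proof. by move=> u v w; apply: nform_inj; rewrite /= !nfD !nfK addrA. Qed.
Lemma nf_addC : commutative nf_add.
Proof. by move=> u v; apply: nform_inj; rewrite /= addrC. Qed.
Lemma nf_add0 : left_id (mk_nf 0) nf_add.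
Proof. by move=> u; apply: nform_inj; rewrite /= nf0 add0r nf_valK. Qed.
Lemma nf_addN : left_inverse (mk_nf 0) nf_opp nf_add.
Proof. by move=> u; apply: nform_inj; rewrite /= nfD nfK nfN addNr nf0. Qed.

HB.instance Definition _ := GRing.isZmodule.Build nform nf_addA nf_addC nf_add0 nf_addN.

Lemma nf_scaleA p q u : nf_scale p (nf_scale q u) = nf_scale (p * q) u.
Proof. by apply: nform_inj; rewrite /= nf_mulr mulrA. Qed.
Lemma nf_scale1 : left_id 1 nf_scale.
Proof. by move=> u; apply: nform_inj; rewrite /= mul1r nf_valK. Qed.
Lemma nf_scaleDr : right_distributive nf_scale +%R.
Proof.
move=> p u v; apply: nform_inj => /=.
by rewrite nf_mulr mulrDr !nfD !nfK.
Qed.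
Lemma nf_scaleDl u : {morph nf_scale^~ u : p q / p + q}.
Proof. by move=> p q; apply: nform_inj; rewrite /= mulrDl !nfD !nfK. Qed.

HB.instance Definition _ := GRing.Zmodule_isLmodule.Build S nform
  nf_scaleA nf_scale1 nf_scaleDr nf_scaleDl.

Lemma nf_val0 : nf_val 0 = 0.
Proof. exact: nf0. Qed.
Lemma nf_valD (u v : nform) : nf_val (u + v) = nf_val u + nf_val v.
Proof. by rewrite [LHS]nfD !nf_valK. Qed.
Lemma nf_valZ p (u : nform) : nf_val (p *: u) = nf (p * nf_val u).
Proof. by []. Qed.
Lemma nf_val_sum I (s : seq I) (P : pred I) (F : I -> nform) :
  nf_val (\sum_(i <- s | P i) F i) = \sum_(i <- s | P i) nf_val (F i).
Proof. by elim/big_rec2: _ => [|i x y _ <-]; rewrite ?nf_val0 ?nf_valD. Qed.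

Section Power.
Variable N : nat.
Local Notation T := {ffun 'I_N -> nform}.

Definition nf_piece d : set T := [set u | forall k, nf_val (u k) \is d.-homog].

Lemma nf_piece0 d : nf_piece d 0.
Proof. by move=> k; rewrite ffunE nf_val0 dhomog0. Qed.

Lemma nf_pieceD d u v : nf_piece d u -> nf_piece d v -> nf_piece d (u + v).
Proof. by move=> ud vd k; rewrite ffunE nf_valD dhomogD. Qed.

Lemma nf_pieceZ f d (p : S) u : p \is f.-homog -> nf_piece d u -> nf_piece (f + d) (p *: u).
Proof. by move=> pf ud k; rewrite ffunE nf_valZ nf_homog // dhomogM. Qed.

Lemma nf_ffun_sum I (s : seq I) (P : pred I) (F : I -> T) k :
  nf_val ((\sum_(i <- s | P i) F i) k) = \sum_(i <- s | P i) nf_val (F i k).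
Proof. by rewrite sum_ffunE nf_val_sum. Qed.

Lemma nf_span (u : T) : exists D (v : nat -> T),
  (forall d, nf_piece d (v d)) /\ u = \sum_(d < D) v d.
Proof.
pose v d : T := [ffun k => mk_nf (pihomog mdeg d (nf_val (u k)))].
exists (\max_k msize (nf_val (u k)))%N, v; split=> [d k|].
  by rewrite ffunE /= nf_homog // pihomogP.
apply/ffunP => k; apply: nform_inj; rewrite nf_ffun_sum.
rewrite (eq_bigr (fun d : 'I_ _ => nf (pihomog mdeg d (nf_val (u k))))) => [|d _];
  last by rewrite ffunE.
rewrite -{1}(nf_valK (u k)) {1}(@pihomog_partitionE _ _ mdeg (\max_k msize (nf_val (u k)))%N
  (nf_val (u k))).
  exact: nf_sum.
exact: (leq_bigmax (F := fun k => msize (nf_val (u k)))).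
Qed.

Lemma nf_direct D (v : nat -> T) : (forall d, nf_piece d (v d)) ->
  \sum_(d < D) v d = 0 -> forall d, (d < D)%N -> v d = 0.
Proof.
move=> vd v0 d dD; apply/ffunP => k; apply: nform_inj; rewrite ffunE nf_val0.
have := congr1 (pihomog mdeg d) (nf_ffun_sum (index_enum 'I_D) xpredT (fun d => v d) k).
rewrite v0 ffunE nf_val0 linear0 linear_sum /= (bigD1 (Ordinal dD)) //= big1 ?addr0.
  by rewrite pihomog_dE //; apply: vd.
move=> i ne; rewrite (@pihomog_ne0 _ _ mdeg i d) //; last exact: vd.
Qed.

(** For N = 0 this is the zero module, which the convex combinations use. *)
Definition nf_module : gradedModule K n :=
  @GradedModule K n T nf_piece nf_piece0 nf_pieceD nf_pieceZ nf_span nf_direct.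

Definition nf_gen (k : 'I_N) : nf_module := [ffun k' => mk_nf (k == k')%:R] : T.

Lemma nf_gen_comb (p : 'I_N -> S) k :
  nf_val ((\sum_k' p k' *: nf_gen k' : T) k) = nf (p k).
Proof.
rewrite nf_ffun_sum (bigD1 k) //= big1 ?addr0 => [|k' ne].
  by rewrite ffunE nf_valZ ffunE eqxx /= nf_mulr mulr1.
by rewrite ffunE nf_valZ ffunE (negPf ne) /= nf0 mulr0 nf0.
Qed.

End Power.
End NormalForms.

Lemma hilbert_function_unique (K : fieldType) n (M : gradedModule K n) h h' :
  hilbert_function M h -> hilbert_function M h' -> h =1 h'.
Proof.
suff le_h g g' : hilbert_function M g -> hilbert_function M g' -> forall d, (g d <= g' d)%N.
  by move=> Hh Hh' d; apply/eqP; rewrite eqn_leq !le_h.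
move=> Hg Hg' d.
pose A := \matrix_i to_coord Hg' d (from_coord Hg (delta_mx 0 i : 'rV_(g d))).
have AE v : from_coord Hg' (v *m A) = from_coord Hg v.
  rewrite mulmx_sum_row from_coord_sum {2}[v]row_sum_delta from_coord_sum.
  apply: eq_bigr => i _; rewrite !from_coordZ rowK to_coordK //.
  exact: from_coord_piece.
have : row_free A.
  rewrite -kermx_eq0; apply/rowV0P => v /sub_kermxP vA.
  by apply: (@from_coord_inj _ _ _ _ Hg); rewrite from_coord0 -AE vA from_coord0.
by rewrite /row_free => /eqP <-; apply: rank_leq_col.
Qed.

Section Presentation.
Variables (K : fieldType) (n r e N : nat) (M : gradedModule K n) (g : 'I_N -> M).
Local Notation S := {mpoly K[n.+1]}.

(* M is isomorphic to N copies of S / <x_0, ..., x_{r-1}>^e. *)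
Definition monomial_presentation := [/\ forall k, gm_piece 0 (g k),
  forall u, exists p : 'I_N -> S, u = \sum_k p k *: g k &
  forall p : 'I_N -> S, \sum_k p k *: g k = 0 <-> forall k, hasord r e (p k)].

Hypothesis Mg : monomial_presentation.

Lemma pres_fg : finitely_generated M.
Proof. by case: Mg => _ gM _; exists N, g. Qed.

Lemma pres_gen0 : generated_in_degree_zero M.
Proof. by case: Mg => g0 gM _ u; have [p ->] := gM u; exists N, g, p. Qed.

Lemma pres_annihilator (u : M) : (0 < r)%N -> 'X_ord0 ^+ e *: u = 0.
Proof.
case: Mg => _ gM rel r0; have [p ->] := gM u.
rewrite scaler_sumr (eq_bigr (fun k => ('X_ord0 ^+ e * p k) *: g k)) => [|k _];
  last by rewrite scalerA.
apply/rel => k; rewrite mulrC; apply: hasord_mull; rewrite mpolyXn.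
have := @hasordX K n r (U_(ord0) *+ e)%MM; rewrite (_ : pdeg r _ = e) //.
elim: e => [|f IH]; first by rewrite mulm0n /pdeg big1 // => l _; rewrite mnm0E.
by rewrite mulmS pdegD IH pdegU r0.
Qed.

Definition stdmon d := seq_sub [seq c <- mons n d | (pdeg r c < e)%N].

Lemma card_stdmon d : (r <= n.+1)%N -> #|{: stdmon d}| = cnt r e (n.+1 - r) d.
Proof.
move=> rn; rewrite card_seq_sub ?filter_uniq ?uniq_mons // size_filter.
exact: count_std.
Qed.

Lemma stdmonP d (x : stdmon d) : mdeg (ssval x) = d /\ (pdeg r (ssval x) < e)%N.
Proof. by have := ssvalP x; rewrite mem_filter mem_mons => /andP[-> /eqP ->]. Qed.

(** Passing to normal forms of the coefficients shows that the standard monomials times the g_k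
    span; comparing coefficients at standard monomials gives uniqueness. *)
Lemma pres_hilbert : hilbert_function M (fun d => #|{: stdmon d * 'I_N}|).
Proof.
case: Mg => g0 gM rel d.
pose b (x : stdmon d * 'I_N) : M := 'X_[ssval x.1] *: g x.2.
have combE (c : 'rV[K]_#|{: stdmon d * 'I_N}|) :
    \sum_i (c 0 i)%:MP *: b (enum_val i) =
    \sum_k (\sum_(x : stdmon d) c 0 (enum_rank (x, k)) *: 'X_[ssval x]) *: g k.
  rewrite (reindex _ (onW_bij _ (@enum_rank_bij _))) /=.
  transitivity (\sum_(x : stdmon d) \sum_(k < N) (c 0 (enum_rank (x, k)) *: 'X_[ssval x]) *: g k).
    rewrite pair_big /=; apply: eq_bigr => -[x k] _.
    by rewrite enum_rankK /b /= scalerA mul_mpolyC.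
  by rewrite exchange_big /=; apply: eq_bigr => k _; rewrite scaler_suml.
have coefE (f : stdmon d -> K) x : (\sum_(y : stdmon d) f y *: 'X_[ssval y])@_(ssval x) = f x.
  rewrite linear_sum /= (bigD1 x) //= big1 ?addr0 => [|y ne]; rewrite mcoeffZ mcoeffX.
    by rewrite eqxx mulr1.
  by rewrite (negPf (_ : ssval y != ssval x)) ?mulr0.
exists (fun i => b (enum_val i)); split=> [i|u ud].
  have := @gm_pieceZ _ _ M d 0 'X_[ssval (enum_val i).1] _ _ (g0 (enum_val i).2).
  by rewrite addn0; apply; rewrite dhomogX /= (stdmonP _).1.
have [p uE] := gM u.
have ud' : gm_piece d (\sum_k p k *: g k) by rewrite -uE.
have := homog_component (e := fun=> 0%N) g0 ud'; rewrite -uE /= subn0 => {}uE.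
pose q k := pihomog mdeg d (p k).
exists (\row_i (q (enum_val i).2)@_(ssval (enum_val i).1)); split.
  rewrite combE uE; apply/eqP; rewrite -subr_eq0 -sumrB; apply/eqP.
  transitivity (\sum_k (q k - nf r e (q k)) *: g k); last first.
    by apply/rel => k; apply/nf_eq0; rewrite nfD nfN nfK subrr.
  apply: eq_bigr => k _; rewrite -scalerBl; congr ((_ - _) *: _).
  apply/mpolyP => c; rewrite nf_coef.
  under eq_bigr do rewrite mxE enum_rankK /=.
  have [cin|cout] := boolP (c \in [seq c <- mons n d | (pdeg r c < e)%N]).
    rewrite (coefE (fun x => (q k)@_(ssval x)) (SeqSub cin)) /=.
    by move: cin; rewrite mem_filter => /andP[->].
  rewrite linear_sum /= big1 => [|x _]; last first.
    rewrite mcoeffZ mcoeffX; case: eqP => [xc|_]; last by rewrite mulr0.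
    by move: cout; rewrite -xc ssvalP.
  case: ifP => // ce; rewrite (dhomog_nemf_coeff (pihomogP mdeg d (p k))) //=.
  by move: cout; rewrite mem_filter ce mem_mons.
move=> c; rewrite uE => cE; apply/rowP => i; rewrite mxE.
have : \sum_k (q k - \sum_(x : stdmon d) c 0 (enum_rank (x, k)) *: 'X_[ssval x]) *: g k = 0.
  by under eq_bigr do rewrite scalerBl; rewrite sumrB -combE -cE subrr.
case/rel/(_ (enum_val i).2 (ssval (enum_val i).1) (stdmonP (enum_val i).1).2)/eqP.
rewrite mcoeffB subr_eq0 => /eqP ->; rewrite coefE.
by rewrite -surjective_pairing enum_valK.
Qed.

Lemma pres_hilbertE h d : (r <= n.+1)%N -> hilbert_function M h ->
  h d = (N * cnt r e (n.+1 - r) d)%N.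
Proof.
move=> rn /hilbert_function_unique/(_ pres_hilbert) ->.
by rewrite card_prod card_ord card_stdmon // mulnC.
Qed.
End Presentation.

Lemma nf_module_pres (K : fieldType) n r e N :
  monomial_presentation r e (@nf_gen K n r e N).
Proof.
have gE (u : nf_module K n r e N) :
    u = \sum_k (nf_val ((u : {ffun 'I_N -> nform K n r e}) k)) *: nf_gen K n r e k.
  by apply/ffunP => k; apply: nform_inj; rewrite nf_gen_comb nf_valK.
split=> [k k'|u|p].
- rewrite ffunE /= nf_homog //.
  by case: (k == k'); rewrite ?dhomog0 ?dhomog1.
- by eexists; apply: gE.
- split=> [p0 k|pe].
    by apply/nf_eq0; rewrite -nf_gen_comb p0 ffunE nf_val0.
  by apply/ffunP => k; apply: nform_inj; rewrite nf_gen_comb ffunE nf_val0; apply/nf_eq0.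
Qed.

(** * The Koszul resolution in the operators x_l - y_l *)

Lemma kd0 (R : nzRingType) g g' (X : nat -> 'M[R]_(g, g')) r p : @kd R g g' X r p 0 = 0.
Proof. by rewrite -[X in kd _ X](subrr 0) kdB subrr. Qed.

Lemma kd_subop (R : nzRingType) g g' (X Y : nat -> 'M[R]_(g, g')) r p f :
  kd (fun i => X i - Y i) f = kd X f - @kd R g g' Y r p f.
Proof.
elim: r p f => [|r IH] p f /=; first by rewrite subr0.
case: p f => [|p] f; rewrite !IH mulmxBr; first by rewrite opprD addrACA.
by rewrite opp_col_mx add_col_mx !opprD addrACA.
Qed.

(* The resolution of N copies of S / <x_0, ..., x_{r-1}>^e is the Koszul complex of
   the operators x_l - y_l on N copies of S (x) K[y_0, ..., y_{r-1}] / <y>^e; the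
   latter has the basis indexed by exponents be and components ki. *)
Lemma truncated_basis n r e N : exists G (be : 'I_G -> 'X_{1..n.+1}) (ki : 'I_G -> 'I_N),
  [/\ forall j, (mdeg (be j) < e)%N,
      forall j (l : 'I_n.+1), (r <= l)%N -> be j l = 0%N,
      forall j j', be j = be j' -> ki j = ki j' -> j = j' &
      forall c k, (mdeg c < e)%N -> (forall l : 'I_n.+1, (r <= l)%N -> c l = 0%N) ->
        exists j, be j = c /\ ki j = k].
Proof.
pose yexp := {b : 'X_{1..n.+1 < e} | [forall l : 'I_n.+1, (r <= l)%N ==> (bmnm b l == 0%N)]}.
exists #|{: yexp * 'I_N}|, (fun j => bmnm (val (enum_val j).1)), (fun j => (enum_val j).2).
split=> [j|j l rl|j j' bb kk|c k ce c0]; first exact: bmdeg.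
- by apply/eqP; have /forallP/(_ l) := valP (enum_val j).1; rewrite rl.
- apply: enum_val_inj; rewrite [LHS]surjective_pairing [RHS]surjective_pairing.
  by congr pair => //; apply: val_inj; apply: val_inj.
have cP : [forall l : 'I_n.+1, (r <= l)%N ==> (bmnm (BMultinom ce) l == 0%N)].
  by apply/forallP => l; apply/implyP => rl; rewrite /= c0.
by exists (enum_rank (exist _ (BMultinom ce) cP : yexp, k)); rewrite enum_rankK.
Qed.

Lemma mx_subE (V : zmodType) a b (P Q : 'M[V]_(a, b)) i j : (P - Q) i j = P i j - Q i j.
Proof. by rewrite !mxE. Qed.

Section TensorBasis.
Variables (K : fieldType) (n r e N : nat).
Local Notation S := {mpoly K[n.+1]}.
Variables (G : nat) (be : 'I_G -> 'X_{1..n.+1}) (ki : 'I_G -> 'I_N).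
Hypothesis be_small : forall j, (mdeg (be j) < e)%N.
Hypothesis be_supp : forall j (l : 'I_n.+1), (r <= l)%N -> be j l = 0%N.
Hypothesis be_inj : forall j j', be j = be j' -> ki j = ki j' -> j = j'.
Hypothesis be_exists : forall c k, (mdeg c < e)%N ->
  (forall l : 'I_n.+1, (r <= l)%N -> c l = 0%N) -> exists j, be j = c /\ ki j = k.

Lemma pdeg_be j : pdeg r (be j) = mdeg (be j).
Proof.
rewrite mdegE /pdeg big_mkcond /=; apply: eq_bigr => l _.
by case: ltnP => // rl; rewrite be_supp.
Qed.

(** Multiplication by y_l, for l < r, on the copies of K[y] / <y>^e: a product of degree e matches
    no basis vector and gives 0. *)
Definition ymul (l : nat) : 'M[S]_G :=
  \matrix_(x, y) ((be y == be x + U_(inord l))%MM && (ki x == ki y))%:R.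

Lemma ymulM i j x y : (ymul i *m ymul j) x y =
  ((be y == be x + U_(inord i) + U_(inord j))%MM && (ki x == ki y))%:R.
Proof.
rewrite !mxE; case: andP => [[/eqP by_ /eqP kxy]|H].
  have [z [bz kz]] : exists z, be z = (be x + U_(inord i))%MM /\ ki z = ki x.
    apply: be_exists => [|l rl].
      by apply: leq_ltn_trans (be_small y); rewrite by_ [X in (_ <= X)%N]mdegD leq_addr.
    by have := be_supp y rl; rewrite by_ mnmDE => /eqP; rewrite addn_eq0 => /andP[/eqP].
  rewrite (bigD1 z) //= !mxE bz kz kxy by_ !eqxx mulr1 big1 ?addr0 // => z' ne.
  rewrite !mxE; case: andP => [[/eqP bz' /eqP kz']|]; last by rewrite mul0r.
  by case/eqP: ne; apply: be_inj; rewrite ?bz' ?bz // kz -kz' kxy.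
rewrite big1 // => z _; rewrite !mxE.
case: andP => [[/eqP bz /eqP kz]|]; last by rewrite mul0r.
case: andP => [[/eqP bz' /eqP kz']|]; last by rewrite mulr0.
by case: H; rewrite bz' bz kz kz' !eqxx.
Qed.

Lemma ymulC i j : ymul i *m ymul j = ymul j *m ymul i.
Proof.
apply/matrixP => x y; rewrite !ymulM.
by rewrite -!addmA [(U_(inord i) + _)%MM]addmC.
Qed.

Definition theta (l : nat) : 'M[S]_G := xmul K n.+1 G l - ymul l.

Lemma thetaC i j : theta i *m theta j = theta j *m theta i.
Proof.
have H k l : theta k *m theta l = (xvar K n.+1 k * xvar K n.+1 l)%:M -
    xvar K n.+1 k *: ymul l + (ymul k *m ymul l - xvar K n.+1 l *: ymul k).
  by rewrite /theta /xmul mulmxBl !mulmxBr -scalar_mxM mul_scalar_mx mul_mx_scalar opprB.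
have E (a b c d : 'M[S]_G) : a - b + (c - d) = a - d + (c - b).
  by rewrite addrACA [RHS]addrACA [- d - b]addrC.
apply: etrans (H i j) (etrans _ (esym (H j i))).
by rewrite (ymulC j i) (mulrC (xvar K n.+1 j)); apply: E.
Qed.

(** The filtration by y-degree; on its graded pieces x_l - y_l acts as x_l. *)
Definition yord s (u : 'rV[S]_G) := forall j, (mdeg (be j) < s)%N -> u 0 j = 0.

Definition ypart s : 'M[S]_G := diag_mx (\row_j (mdeg (be j) == s)%:R).

Lemma ypartE s a (z : 'M_(a, G)) A j : (z *m ypart s) A j = if mdeg (be j) == s then z A j else 0.
Proof. by rewrite mul_mx_diag !mxE; case: eqP; rewrite ?mulr1 ?mulr0. Qed.

Lemma ypart_idem s : ypart s *m ypart s = ypart s.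
Proof.
rewrite mulmx_diag; congr diag_mx; apply/rowP => a; rewrite !mxE.
by case: eqP => _; rewrite ?mulr1 ?mulr0.
Qed.

Lemma kd_ymul_ord p s (w : 'M[S]_(krank r p.+1, G)) : (forall A, yord s (row A w)) ->
  forall A, yord s.+1 (row A (kd ymul w)).
Proof.
move=> ws; apply: (@kd_rel S S _ _ _ _ ymul ymul (fun u _ => yord s u) (fun u _ =>
  yord s.+1 u) r p w w) => //.
- by move=> j _; rewrite mxE.
- by move=> u _ v _ us vs j js; rewrite mxE us // vs // addr0.
- by move=> u _ us j js; rewrite mxE us // oppr0.
- move=> i _ u _ us j js; rewrite mxE big1 // => x _; rewrite mxE.
  case: andP => [[/eqP bj _]|]; last by rewrite mulr0.
  by rewrite us ?mul0r //; move: js; rewrite bj mdegD mdeg1 addn1.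
Qed.

Lemma kd_xmul_part p s (w : 'M[S]_(krank r p.+1, G)) :
  kd (xmul K n.+1 G) w *m ypart s = kd (xmul K n.+1 G) (w *m ypart s).
Proof. by apply: kd_nat => i _; rewrite /xmul scalar_mxC. Qed.

(** In the lowest y-degree s the differential is that of the variables, so subtracting the boundary
    of [w *m ypart s] clears this degree and only disturbs higher ones. *)
Lemma filtration_step p s (z : 'M[S]_(krank r p, G)) (w : 'M[S]_(krank r p.+1, G)) :
  (forall A, yord s (row A z)) -> z *m ypart s = kd (xmul K n.+1 G) w ->
  forall A, yord s.+1 (row A (z - kd theta (w *m ypart s))).
Proof.
move=> zs zw A j; rewrite ltnS leq_eqVlt => js.
rewrite mxE [kd theta _]kd_subop -kd_xmul_part -zw -mulmxA ypart_idem.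
rewrite !mx_subE ypartE.
have -> : kd ymul (w *m ypart s) A j = 0.
  have := @kd_ymul_ord p s (w *m ypart s) _ A j; rewrite mxE; apply; last by rewrite ltnS leq_eqVlt.
  by move=> B l ls; rewrite mxE ypartE ltn_eqF.
case: eqP js => [->|_] /= js; first by rewrite subr0 subrr.
by have := zs A j js; rewrite mxE => ->; rewrite !subr0.
Qed.

(** The y-degrees are cleared one after the other, each by exactness for the variables; all of them
    are below e. *)
Lemma theta_exact p (z : 'M[S]_(krank r p.+1, G)) : (r <= n.+1)%N ->
  kd theta z = 0 -> exists w, z = kd theta w.
Proof.
move=> rn.
suff H t s (z' : 'M[S]_(krank r p.+1, G)) : (s + t = e)%N -> (forall A, yord s (row A z')) ->
    kd theta z' = 0 -> exists w, z' = kd theta w by apply: (H e 0%N).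
elim: t s z' => [|t IH] s x st xs x0.
  exists 0; apply/matrixP => A j; have := xs A j; rewrite mxE => ->.
    by rewrite kd0 mxE.
  by rewrite -[s]addn0 st; apply: be_small.
have [w wE] : exists w, x *m ypart s = kd (xmul K n.+1 G) w.
  apply: koszul_exact rn _; rewrite -kd_xmul_part; apply/matrixP => A j; rewrite ypartE [RHS]mxE.
  case: eqP => // js; have /matrixP/(_ A j) := x0; rewrite [kd theta _]kd_subop mx_subE [RHS]mxE.
  have := @kd_ymul_ord p s x xs A j; rewrite js ltnSn mxE => /(_ isT) yj0 /eqP.
  by rewrite subr_eq0 => /eqP H; apply: etrans H yj0.
have st' : (s.+1 + t = e)%N by rewrite addSnnS.
have k0 : kd theta (x - kd theta (w *m ypart s)) = 0.
  by rewrite kdB x0 sub0r (kdkd _ thetaC) oppr0.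
have [v vE] := IH _ _ st' (filtration_step xs wE) k0.
by exists (v + w *m ypart s); rewrite kdD -vE subrK.
Qed.

Section Augmentation.
Variables (M : gradedModule K n) (g : 'I_N -> M).
Hypothesis Mg : monomial_presentation r e g.

(** The augmentation, which evaluates each y_l at x_l. *)
Definition evrow (u : 'rV[S]_G) : M := \sum_j u 0 j *: ('X_[be j] *: g (ki j)).

Lemma evrowE u : evrow u = \sum_k (\sum_(j | ki j == k) u 0 j * 'X_[be j]) *: g k.
Proof.
rewrite /evrow (partition_big ki xpredT) //=; apply: eq_bigr => k _.
by rewrite scaler_suml; apply: eq_bigr => j /eqP <-; rewrite scalerA.
Qed.

Lemma evrowD u v : evrow (u + v) = evrow u + evrow v.
Proof. by rewrite -big_split; apply: eq_bigr => j _; rewrite mxE scalerDl. Qed.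
Lemma evrowN u : evrow (- u) = - evrow u.
Proof. by rewrite -sumrN; apply: eq_bigr => j _; rewrite mxE scaleNr. Qed.
Lemma evrow0 : evrow 0 = 0.
Proof. by rewrite /evrow big1 // => j _; rewrite mxE scale0r. Qed.

Lemma evrow_theta l u : (l < r)%N -> (r <= n.+1)%N -> evrow (u *m theta l) = 0.
Proof.
case: Mg => _ _ rel lr rn; rewrite /theta mulmxBr evrowD evrowN; apply/eqP; rewrite subr_eq0;
  apply/eqP.
have xE : xvar K n.+1 l = 'X_(inord l).
  by rewrite -xvarE inordK // (leq_trans lr).
transitivity (\sum_x u 0 x *: ('X_[be x + U_(inord l)] *: g (ki x))).
  apply: eq_bigr => x _; rewrite /xmul mul_mx_scalar mxE xE mpolyXD !scalerA.
  by congr (_ *: _); ring.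
rewrite /evrow; under [RHS]eq_bigr do rewrite mxE scaler_suml.
rewrite exchange_big /=; apply: eq_bigr => x _.
have [ce|ec] := ltnP (mdeg (be x + U_(inord l))%MM) e.
  have [y [yx ky]] : exists y, be y = (be x + U_(inord l))%MM /\ ki y = ki x.
    apply: be_exists => // l' rl; rewrite mnmDE be_supp // mnm1E.
    case: eqP => // ll; have lE : (l' : nat) = l by rewrite -ll inordK // (leq_trans lr).
    by move: rl; rewrite lE leqNgt lr.
  rewrite (bigD1 y) //= mxE yx ky !eqxx mulr1 big1 ?addr0 // => y' ne.
  rewrite mxE; case: andP => [[/eqP b' /eqP k']|]; last by rewrite mulr0 scale0r.
  by case/eqP: ne; apply: be_inj; rewrite ?b' ?yx // -k'.
(* In y-degree e the product with y_l is zero, and so is its image, a multiple of an element of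
   <x_0, ..., x_(r-1)>^e times a generator. *)
rewrite big1 => [|y _]; last first.
  rewrite mxE; case: andP => [[/eqP b' _]|]; last by rewrite mulr0 scale0r.
  by move: ec; rewrite -b' leqNgt be_small.
rewrite scalerA -[RHS](scale0r (g (ki x))).
have /rel : forall k, hasord r e ((k == ki x)%:R * (u 0 x * 'X_[be x + U_(inord l)]) : S).
  move=> k; apply: hasord_mull; apply: hasord_mull; apply: hasord_le (@hasordX K n r _).
  by move: ec; rewrite pdegD pdegU inordK ?lr ?(leq_trans lr) // pdeg_be mdegD mdeg1.
rewrite (bigD1 (ki x)) //= eqxx mul1r big1 ?addr0 => [->|k /negPf ->]; first by rewrite scale0r.
by rewrite mul0r scale0r.
Qed.

Lemma evrow_kd (w : 'M[S]_(krank r 1, G)) A : (r <= n.+1)%N -> evrow (row A (kd theta w)) = 0.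
Proof.
move=> rn; apply: (@kd_rel S S _ _ _ _ theta theta (fun _ _ => True) (fun u _ =>
  evrow u = 0) r 0 w w) => //.
- exact: evrow0.
- by move=> u _ v _ u0 v0; rewrite evrowD u0 v0 addr0.
- by move=> u _ u0; rewrite evrowN u0 oppr0.
- by move=> l lr u _ _; apply: evrow_theta.
Qed.

(** Coefficients are compared at x^(be j) times a monomial in the remaining variables. A
    contribution from another j' requires that [be j'] divide [be j] and have degree at least s, so
    both exponents agree, and then j' = j. *)
Lemma evrow_kill s (u : 'rV[S]_G) j : yord s u -> evrow u = 0 -> mdeg (be j) = s ->
  kill r (u 0 j) = 0.
Proof.
case: Mg => _ _ rel us; rewrite evrowE => /rel/(_ (ki j)) uo js.
apply: kill_coef => c c0.
have := uo (be j + c)%MM; rewrite pdegD pdeg_be (_ : pdeg r c = 0%N); last first.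
  by rewrite /pdeg big1 // => l /c0.
rewrite addn0 be_small => /(_ isT); rewrite linear_sum /= (bigD1 j) //=.
rewrite mcoeffMX big1 ?addr0 // => j' /andP[/eqP kj' ne].
apply: memN_msupp_eq0; rewrite (perm_mem (msuppMX _ _)); apply/mapP => -[c' c's E].
have uj : u 0 j' != 0 by apply: contraTneq c's => ->; rewrite msupp0.
have sj : (s <= mdeg (be j'))%N by rewrite leqNgt; apply: contra uj => /us ->.
have le_b : (be j' <= be j)%MM.
  apply/mnm_lepP => l; have [lr|rl] := ltnP l r; last by rewrite be_supp.
  have := congr1 (fun c : 'X_{1..n.+1} => c l) E; rewrite !mnmDE c0 // addn0 => ->.
  by rewrite leq_addr.
have bE : be j = (be j - be j' + be j')%MM by rewrite submK.
have d0 : (be j - be j')%MM = 0%MM.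
  have := congr1 (fun c : 'X_{1..n.+1} => mdeg c) bE; rewrite mdegD js => sE.
  by apply/eqP; rewrite -mdeg_eq0; apply/eqP; lia.
by case/eqP: ne; apply: be_inj; rewrite // bE d0 add0m.
Qed.

Lemma evrow_exact (z : 'M[S]_(krank r 0, G)) : (r <= n.+1)%N ->
  (forall A, evrow (row A z) = 0) -> exists w, z = kd theta w.
Proof.
move=> rn.
suff H t s (z' : 'M[S]_(krank r 0, G)) : (s + t = e)%N -> (forall A, yord s (row A z')) ->
    (forall A, evrow (row A z') = 0) -> exists w, z' = kd theta w by apply: (H e 0%N).
elim: t s z' => [|t IH] s x st xs x0.
  exists 0; apply/matrixP => A j; have := xs A j; rewrite mxE => ->.
    by rewrite kd0 mxE.
  by rewrite -[s]addn0 st; apply: be_small.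
have [w wE] : exists w, x *m ypart s = kd (xmul K n.+1 G) w.
  apply: koszul_aug => A j; rewrite ypartE; case: eqP => js; last by rewrite kill0.
  by have := evrow_kill (xs A) (x0 A) js; rewrite mxE.
have st' : (s.+1 + t = e)%N by rewrite addSnnS.
have k0 A : evrow (row A (x - kd theta (w *m ypart s))) = 0.
  by rewrite linearB /= evrowD evrowN x0 evrow_kd // subr0.
have [v vE] := IH _ _ st' (filtration_step xs wE) k0.
by exists (v + w *m ypart s); rewrite kdD -vE subrK.
Qed.
End Augmentation.

Definition mxvec_col a b (x : 'I_(a * b)) : 'I_b :=
  (enum_val (cast_ord (esym (mxvec_cast a b)) x)).2.

Lemma mxvec_colE a b (i : 'I_a) (j : 'I_b) : mxvec_col (mxvec_index i j) = j.
Proof. by rewrite /mxvec_col /mxvec_index cast_ordK enum_rankK. Qed.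

(** A Koszul generator of homological degree p has degree p, and y^c has degree |c|; this makes x_l
    - y_l homogeneous. *)
Definition koszul_seq : freeSeq K n :=
  @FreeSeq K n (fun p => krank r p * G)%N (fun p a => p + mdeg (be (mxvec_col a)))%N
    (fun p => lin_mx (@kd S G G theta r p)).

Lemma koszul_seq_mul p (z : 'rV_(krank r p.+1 * G)) :
  z *m fs_map koszul_seq p = mxvec (kd theta (vec_mx z)).
Proof. by rewrite -{1}(vec_mxK z) [LHS]mul_vec_lin. Qed.

Definition yhomog s (u : 'rV[S]_G) :=
  forall j c, c \in msupp (u 0 j) -> (mdeg c + mdeg (be j))%N = s.

Lemma kd_theta_homog p s (w : 'M[S]_(krank r p.+1, G)) : (forall A, yhomog s (row A w)) ->
  forall A, yhomog s.+1 (row A (kd theta w)).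
Proof.
have hD t u v : yhomog t u -> yhomog t v -> yhomog t (u + v).
  move=> ut vt j c; rewrite mxE => /msuppD_le; rewrite mem_cat => /orP[/ut|/vt] //.
have hN t u : yhomog t u -> yhomog t (- u).
  by move=> ut j c; rewrite mxE (perm_mem (msuppN _)) => /ut.
move=> ws; apply: (@kd_rel S S _ _ _ _ theta theta (fun u _ => yhomog s u) (fun u _ =>
  yhomog s.+1 u) r p w w) => //.
- by move=> j c; rewrite mxE msupp0.
- by move=> u _ v _; apply: hD.
- by move=> u _; apply: hN.
move=> i ir u _ us; rewrite /theta mulmxBr; apply: hD; last apply: hN.
  move=> j c; rewrite /xmul mul_mx_scalar mxE /xvar; case: insubP => [l _ _|_];
    last by rewrite mul0r msupp0.
  rewrite mulrC (perm_mem (msuppMX _ _)) => /mapP[c' c'u ->].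
  by rewrite mdegD mdeg1 add1n addSn (us j c' c'u).
move=> j c; rewrite mxE => /msupp_sum_le; rewrite filter_predT => /flatten_mapP[x _].
rewrite mxE; case: andP => [[/eqP bj _]|_]; last by rewrite mulr0 msupp0.
rewrite mulr1 => /us E; by rewrite bj mdegD mdeg1 addn1 addnS E.
Qed.

Lemma koszul_seq_deg : degree_preserving koszul_seq.
Proof.
move=> p a b.
case/mxvec_indexP: a => A j; case/mxvec_indexP: b => B j'.
have E : fs_map koszul_seq p (mxvec_index A j) (mxvec_index B j') =
    kd theta (delta_mx A j : 'M[S]_(krank r p.+1, G)) B j'.
  transitivity (((delta_mx 0 (mxvec_index A j) : 'rV[S]_(krank r p.+1 * G)) *m fs_map koszul_seq
    p) (0 : 'I_1) (mxvec_index B j'))%R.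
    by rewrite -rowE [RHS]mxE.
  by rewrite koszul_seq_mul mxvecE vec_mx_delta.
have H c : c \in msupp (fs_map koszul_seq p (mxvec_index A j) (mxvec_index B j')) ->
    (mdeg c + mdeg (be j') = (mdeg (be j)).+1)%N.
  move=> cs; apply: (@kd_theta_homog p (mdeg (be j)) (delta_mx A j) _ B j' c).
    move=> A' l c'; rewrite !mxE; case: andP => [[_ /eqP ->]|_]; last by rewrite msupp0.
    by rewrite msupp1 inE => /eqP ->; rewrite mdeg0.
  by rewrite mxE -E.
rewrite /= !mxvec_colE; split=> [le|lt].
  by apply/dhomogP => c /H /=; lia.
apply/eqP; rewrite -msupp_eq0; case M : (msupp _) => [//|c s].
by have := H c; rewrite M inE eqxx => /(_ isT); lia.
Qed.

(** The basis vectors of F_i have degree at most i + e - 1 <= i + m, so the strands above are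
    zero. *)
Lemma koszul_seq_betti m i j : (e <= m.+1)%N -> betti koszul_seq i j != 0%N -> (j <= i + m)%N.
Proof.
move=> em; apply: contraNT; rewrite -ltnNge => ij.
have s0 : strand_space koszul_seq i j = 0.
  apply/matrixP => a b; rewrite !mxE /= [_ == j](_ : _ = false) ?mul0rn //.
  by apply/eqP => E; have := be_small (mxvec_col a); lia.
rewrite /betti (_ : \rank (strand_cycles koszul_seq i j) = 0%N) ?sub0n //.
apply/eqP; rewrite mxrank_eq0 -submx0 -s0.
by case: i {ij s0} => [|i] //=; apply: capmxSl.
Qed.

Lemma koszul_regularity (M : gradedModule K n) (g : 'I_N -> M) m :
  monomial_presentation r e g -> (r <= n.+1)%N -> (0 < e)%N -> (e <= m.+1)%N ->
  regularity_le M m.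
Proof.
move=> Mg rn e0 em; exists koszul_seq; split; last by move=> i j; apply: koszul_seq_betti.
split; first exact: koszul_seq_deg.
have [g0 gM rel] := Mg.
have L0 : krank r 0 = 1%N by elim: r.
have [A0 A0E] : exists A0 : 'I_(krank r 0), forall A, A = A0.
  have lt0 : (0 < krank r 0)%N by rewrite L0.
  exists (Ordinal lt0) => A; apply: val_inj => /=.
  by have := ltn_ord A; rewrite {2}L0 ltnS leqn0 => /eqP.
pose gq (b : 'I_(krank r 0 * G)) : M := 'X_[be (mxvec_col b)] *: g (ki (mxvec_col b)).
have evE (p : 'rV_(krank r 0 * G)) : \sum_b p 0 b *: gq b = evrow g (row A0 (vec_mx p)).
  rewrite (reindex _ (curry_mxvec_bij _ _)) /=.
  transitivity (\sum_A \sum_j p 0 (mxvec_index A j) *: gq (mxvec_index A j)).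
    by rewrite pair_big /=; apply: eq_bigr => -[A j].
  rewrite (bigD1 A0) //= [X in _ + X]big1 ?addr0 => [|A]; last by rewrite (A0E A) eqxx.
  by apply: eq_bigr => j _; rewrite /gq mxvec_colE !mxE.
exists gq; split=> [b|u|p|p z].
- rewrite -[fs_deg _ _ _]addn0; apply: gm_pieceZ (g0 _).
  by rewrite dhomogX /= add0n.
- have [p ->] := gM u.
  (* The basis vectors with exponent 0 map to the g_k and already generate; they exist because e >
     0. *)
  pose z : 'rV[S]_G := \row_j (if be j == 0%MM then p (ki j) else 0).
  exists (mxvec (\matrix_(A < krank r 0) z)); rewrite evE mxvecK rowK evrowE.
  apply: eq_bigr => k _; congr (_ *: _).
  have [j [bj kj]] : exists j, be j = 0%MM /\ ki j = k.
    by apply: be_exists => [|l _]; rewrite ?mdeg0 ?mnm0E.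
  rewrite (bigD1 j) ?kj ?eqxx //= mxE bj eqxx kj mpolyX0 mulr1 big1 ?addr0 //.
  move=> j' /andP[/eqP kj' ne]; rewrite mxE; case: eqP => [bj'|_]; last by rewrite mul0r.
  by case/eqP: ne; apply: be_inj; rewrite ?bj ?kj.
- rewrite evE; split=> [p0|[q ->]].
    have [A|w wE] := @evrow_exact M g Mg (vec_mx p) rn; first by rewrite (A0E A).
    by exists (mxvec w); rewrite koszul_seq_mul mxvecK -wE vec_mxK.
  by rewrite koszul_seq_mul mxvecK evrow_kd.
- rewrite koszul_seq_mul; split=> [z0|[q ->]].
    have [|w wE] := @theta_exact p (vec_mx z) rn; first by apply: (can_inj mxvecK);
      rewrite z0 linear0.
    by exists (mxvec w); rewrite koszul_seq_mul mxvecK -wE vec_mxK.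
  by rewrite koszul_seq_mul mxvecK (kdkd _ thetaC) linear0.
Qed.
End TensorBasis.

Lemma presentation_regularity (K : fieldType) n r e N m (M : gradedModule K n) (g : 'I_N -> M) :
  monomial_presentation r e g -> (r <= n.+1)%N -> (0 < e)%N -> (e <= m.+1)%N ->
  regularity_le M m.
Proof.
have [G [be [ki [bs bp bi bx]]]] := truncated_basis n r e N.
exact: (koszul_regularity bs bp bi bx).
Qed.

(** * The two inclusions and the extreme rays *)

Lemma regular_ineq_cone K n m : regular_hilbert_functions K n m `<=` ineq_cone n m.
Proof.
move=> _ [M [h [_ gM kM reg [Hh ->]]]].
have [q [sq qE qm qk]] := regularity_hilbert_poly Hh gM reg.
have sqn := torsion_size Hh gM kM sq qE.
rewrite ineq_coneE /=; split; first by apply/V_polyP; exists q.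
rewrite (hilbert_polyE qE); split=> [j _||i ilt] //.
  have := mod_growth Hh gM j; rewrite -(ler_nat rat) !natrM addn1.
  by rewrite -[(n + j + 1)%N]/((n + j + 1)%N) addn1 addSn.
have := qk i (ltnW _); rewrite ltnS => /(_ ilt) /= H.
rewrite nablaE -subr_ge0.
move: H; rewrite -subr_ge0; have -> : (n + m - i)%N%:R = (n - i)%N%:R + m%:R :> rat.
  by rewrite -natrD; congr _%:R; lia.
by congr (is_true (0 <= _)); ring.
Qed.

Definition gen_vars n m t := if (t < m.+1)%N then n.+1 else (n - (t - m.+1))%N.
Definition gen_exp m t := if (t < m.+1)%N then t.+1 else m.+1.

Lemma gen_bounds n m t : (t < m.+1 + n)%N ->
  [/\ (0 < gen_vars n m t)%N, (gen_vars n m t <= n.+1)%N, (0 < gen_exp m t)%N &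
      (gen_exp m t <= m.+1)%N].
Proof. by rewrite /gen_vars /gen_exp; case: (ltnP t m.+1) => tm tlt; split; lia. Qed.

Lemma gen_cnt n m t : (t < m.+1 + n)%N ->
  gen n m t = fun j => (cnt (gen_vars n m t) (gen_exp m t) (n.+1 - gen_vars n m t) j)%:R.
Proof.
move=> tlt; apply/funext => j; rewrite /gen /gen_vars /gen_exp; case: ifP => tm.
  by rewrite subnn.
by congr (cnt _ _ _ _)%:R; lia.
Qed.

Lemma gen_regular K n m t N : (t < m.+1 + n)%N ->
  regular_hilbert_functions K n m (fun j => N%:R * gen n m t j).
Proof.
move=> tlt; have [r0 rn e0 em] := gen_bounds tlt.
have Mg := @nf_module_pres K n (gen_vars n m t) (gen_exp m t) N.
exists (nf_module K n (gen_vars n m t) (gen_exp m t) N), (fun d =>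
  #|{: stdmon n (gen_vars n m t) (gen_exp m t) d * 'I_N}|).
split; first exact: pres_fg Mg.
- exact: pres_gen0 Mg.
- apply: (@krull_dim_lt _ _ _ (gen_exp m t)) => u; exact: pres_annihilator Mg _ r0.
- exact: presentation_regularity Mg rn e0 em.
split; first exact: pres_hilbert Mg.
by apply/funext => j; rewrite (pres_hilbertE Mg _ rn (pres_hilbert Mg)) natrM (gen_cnt tlt).
Qed.

Lemma R_coneE K n m : R_cone K n m = ineq_cone n m.
Proof.
apply/seteqP; split; first exact: closed_hull_sub (@regular_ineq_cone K n m).
by rewrite ineq_cone_gen; apply: sub_closed_hull => t N; apply: gen_regular.
Qed.

Lemma quotient_hilbertE K n i e h : (i <= n)%N ->
  quotient_hilbert_function (ideal_pow (@var_ideal K n i) e) h <->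
  h = fun j => (cnt i.+1 e (n - i) j)%:R.
Proof.
move=> i_n; split=> [[M [h0 [[g [g0 gM rel]] Hh ->]]]|->].
  have Mg : monomial_presentation i.+1 e (fun _ : 'I_1 => g).
    split=> // [u|p]; first by have [p ->] := gM u; exists (fun=> p); rewrite big_ord1.
    rewrite big_ord1 rel; split=> [/ideal_powP pe k|pe]; last exact/ideal_powP.
    by rewrite ord1.
  by apply/funext => j; rewrite (pres_hilbertE Mg) // mul1n subSS.
have Mg := @nf_module_pres K n i.+1 e 1.
exists (nf_module K n i.+1 e 1), (fun d => #|{: stdmon n i.+1 e d * 'I_1}|); split.
- have [g0 gM rel] := Mg; exists (nf_gen K n i.+1 e ord0); split=> // [u|p].
    by have [p ->] := gM u; exists (p ord0); rewrite big_ord1.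
  have := rel (fun=> p); rewrite big_ord1 => ->; split=>
    [/(_ ord0)/ideal_powP //|/ideal_powP pe k //].
- exact: pres_hilbert Mg.
- by apply/funext => j; rewrite (pres_hilbertE Mg _ _ (pres_hilbert Mg)) // mul1n subSS.
Qed.

Lemma quotient_hilbert_gen K n m h :
  (exists2 t, (t < m.+1 + n)%N & h = gen n m t) <->
  (exists2 e : nat, (1 <= e <= m.+1)%N &
           quotient_hilbert_function (ideal_pow (@var_ideal K n n) e) h) \/
  (exists2 i : nat, (i < n)%N &
           quotient_hilbert_function (ideal_pow (@var_ideal K n i) m.+1) h).
Proof.
split=> [[t tlt ->]|[[[|e] // em]|[i i_n]]].
- have [tm|mt] := ltnP t m.+1; [left; exists t.+1 => // | right; exists (n - (t - m.+1)).-1;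
  first by lia].
    by apply/quotient_hilbertE; rewrite // gen_cnt // /gen_vars /gen_exp tm subSS.
  apply/quotient_hilbertE; first by lia.
  rewrite gen_cnt // /gen_vars /gen_exp ltnNge mt /=; apply/funext => j.
  by congr (cnt _ _ _ _)%:R; lia.
- move=> /quotient_hilbertE -> //; exists e; first by lia.
  by rewrite gen_cnt ?/gen_vars ?/gen_exp; [rewrite (_ : (e < m.+1)%N) ?subSS //; lia | lia].
- move=> /quotient_hilbertE -> //; last exact: ltnW.
  exists (m.+1 + (n - i.+1))%N; first by lia.
  rewrite gen_cnt; last by lia.
  apply/funext => j; rewrite /gen_vars /gen_exp ifN -?leqNgt ?leq_addr // ifN -?leqNgt ?leq_addr
    // addKn.
  by congr (cnt _ _ _ _)%:R; lia.
Qed.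

Theorem theorem1p3 (n m : nat) (K : fieldType) :
  (regular_hilbert_functions K n m `<=` V n.+1 m /\ V n m `<=` V n.+1 m) /\
  R_cone K n m `<=` V n m /\
  R_cone K n m = [set h | V n m h /\
    [/\ forall j : nat, (j < m)%N ->
          (n + j + 1)%N%:R * h j >= (j + 1)%N%:R * h j.+1,
        h m >= (hilbert_poly m h).[m%:R] &
        forall i : nat, (i < n)%N ->
          (n - i)%N%:R * (iter i nabla (hilbert_poly m h)).[m%:R] >=
          (n + m - i)%N%:R * (iter i.+1 nabla (hilbert_poly m h)).[m%:R]]] /\
  simplicial_cone (R_cone K n m) /\
  (forall rho : set (nat -> rat),
     extreme_ray (R_cone K n m) rho <->
     exists h : nat -> rat, rho = ray h /\
       ((exists2 e : nat, (1 <= e <= m.+1)%N &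
           quotient_hilbert_function (ideal_pow (@var_ideal K n n) e) h) \/
        (exists2 i : nat, (i < n)%N &
           quotient_hilbert_function (ideal_pow (@var_ideal K n i) m.+1) h))).
Proof.
rewrite R_coneE; split; first by split=> [h /regular_ineq_cone[hV _]|];
  [apply: V_subS | exact: V_subS].
split; first by move=> h [].
split; first exact: ineq_coneE.
rewrite ineq_cone_gen; split; first exact: gen_cone_simplicial.
move=> rho; rewrite gen_cone_extreme; split=> [[t tlt ->]|[h [-> /quotient_hilbert_gen[t tlt ->]]]].
  by exists (gen n m t); split=> //; apply/quotient_hilbert_gen; exists t.
by exists t.
Qed.
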